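(* Let $0<d<k$ be integers and fix $c,\epsilon>0$. For Lebesgue almost all linear maps $L:\mathbb{R}^d\to\mathbb{R}^{k-d}$ the following holds for every corresponding cubical cut and project set $Y=Y_s$ (for every admissible internal space $F_\pi$ and every regular $s\in\mathbb{R}^k$): (1) $Y$ is not $\phi$-repulsive for any $\phi:\mathbb{R}_+\to\mathbb{R}_+$ with \[ \phi(r)\ge\frac{c\,r^{k-d}}{(\log r)^{1/d}} \] for all sufficiently large $r$; (2) $Y$ is $\phi$-repulsive for every $\phi:\mathbb{R}_+\to\mathbb{R}_+$ with \[ \phi(r)\le\frac{c\,r^{k-d}}{(\log r)^{(1/d)+k-d+\epsilon}} \] for all sufficiently large $r$.
   Context: Cut and project setting. Let $0<d<k$ be integers. A linear map $L:\mathbb{R}^d\to\mathbb{R}^{k-d}$ is identified with its matrix $(\alpha_{ij})\in\mathbb{R}^{d(k-d)}$, $L(x)_i=\sum_{j=1}^d\alpha_{ij}x_j$, and ''almost all $L$'' refers to Lebesgue measure on $\mathbb{R}^{d(k-d)}$. The physical space is $E=\{(x,L(x)) : x\in\mathbb{R}^d\}\subset\mathbb{R}^k$. Standing assumption: $E$ is totally irrational, i.e. $E+\mathbb{Z}^k$ is dense in $\mathbb{R}^k$. An admissible internal space is a linear subspace $F_\pi\subset\mathbb{R}^k$ complementary to $E$ such that the projection $\pi:\mathbb{R}^k\to E$ along $F_\pi$ is injective on $\mathbb{Z}^k$; $\pi^*$ denotes the projection onto $F_\pi$ along $E$. The cubical window is $\mathcal{W}_\pi=\pi^*(\{0\}^d\times[0,1]^{k-d})$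 and the slice is $\mathcal{S}=\mathcal{W}_\pi+E$. For $s\in\mathbb{R}^k$ the cubical cut and project set is $Y_s=\pi(\mathcal{S}\cap(\mathbb{Z}^k+s))$. The point $s$ (and $Y_s$) is regular if $\partial\mathcal{S}\cap(\mathbb{Z}^k+s)=\emptyset$. For $y\in Y=Y_s$, $\tilde y$ denotes the unique element of $\mathbb{Z}^k+s$ with $\pi(\tilde y)=y$. Patches. For $r>0$ let $C(r)=\mathbb{Z}^k\cap([-r,r]^d\times\mathbb{R}^{k-d})$. The $r$-patch at $y\in Y$ is $P(y,r)=\{y'\in Y : \tilde y'-\tilde y\in C(r)\}$. Two $r$-patches $P(y_1,r),P(y_2,r)$ are equivalent if $P(y_1,r)-y_1=P(y_2,r)-y_2$; $\mathcal{P}(y,r)$ denotes the equivalence class of $P(y,r)$. Repulsivity. For $\phi:\mathbb{R}_+\to\mathbb{R}_+$, $Y$ is $\phi$-repulsive if, for all sufficiently large $r$, whenever $y,y'\in Y$ are distinct and $\mathcal{P}(y,r)=\mathcal{P}(y',r)$, the distance between $y$ and $y'$ is strictly greater than $\phi(r)$. *)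

(* Defs.v *)
From HB Require Import structures.
From mathcomp Require Import all_boot all_order all_algebra.
From mathcomp Require Import all_classical all_reals all_analysis.

Set Implicit Arguments.
Unset Strict Implicit.
Unset Printing Implicit Defensive.

Import Order.TTheory GRing.Theory Num.Theory.
Import numFieldNormedType.Exports.

Local Open Scope classical_set_scope.
Local Open Scope ring_scope.

(* Lebesgue measure on R^n, realised on n-tuples: Dirac mass at the empty
   tuple for n = 0, and the image of (Lebesgue on R) x (Lebesgue on R^n)
   under (x, t) |-> x :: t for n + 1. *)
Section lebesgue_tuple.
Context {R : realType}.
Local Notation T := (measurableTypeR R).

Definition tuple_cons n (p : T * n.-tuple T) : n.+1.-tuple T :=
  [tuple of p.1 :: p.2].

Lemma measurable_tuple_cons n : measurable_fun [set: _] (@tuple_cons n).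
Proof. exact: measurable_cons. Qed.

Section step.
Context n (mu : {sigma_finite_measure set (n.-tuple T) -> \bar R}).

Definition lebesgue_step : set (n.+1.-tuple T) -> \bar R :=
  pushforward (@lebesgue_measure R \x mu)%E (@tuple_cons n).

Let lebesgue_step0 : lebesgue_step set0 = 0%E.
Proof. by rewrite /lebesgue_step /pushforward preimage_set0 measure0. Qed.

Let lebesgue_step_ge0 A : (0 <= lebesgue_step A)%E.
Proof. by rewrite /lebesgue_step /pushforward; exact: measure_ge0. Qed.

Let measurable_preimage A : measurable A ->
  measurable (@tuple_cons n @^-1` A).
Proof. by rewrite -[X in _ -> measurable X]setTI; exact: measurable_tuple_cons. Qed.

Let lebesgue_step_sigma_additive : semi_sigma_additive lebesgue_step.
Proof.
move=> F mF tF mUF; rewrite /lebesgue_step /pushforward preimage_bigcup.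
apply: measure_semi_sigma_additive.
- by move=> i; exact: measurable_preimage.
- apply/trivIsetP => /= i j _ _ ij; rewrite -preimage_setI.
  by move/trivIsetP : tF => /(_ _ _ _ _ ij) ->//; rewrite preimage_set0.
- by rewrite -preimage_bigcup; exact: measurable_preimage.
Qed.

HB.instance Definition _ := isMeasure.Build _ _ _ lebesgue_step
  lebesgue_step0 lebesgue_step_ge0 lebesgue_step_sigma_additive.

Let lebesgue_step_sigma_finite : sigma_finite [set: _] lebesgue_step.
Proof.
have /sigma_finiteP[F [FT ndF mF]] : sigma_finite [set: T] (@lebesgue_measure R).
  exact: sigma_finiteT.
have /sigma_finiteP[G [GT ndG mG]] := sigma_finiteT mu.
pose h (t : n.+1.-tuple T) : T * n.-tuple T := (thead t, [tuple of behead t]).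
have mh : measurable_fun [set: _] h.
  apply/measurable_fun_pairP; split; first exact: measurable_tnth.
  exact: measurable_behead.
have hK p : h (tuple_cons p) = p.
  by case: p => x t; rewrite /h theadE; congr pair; exact/val_inj.
exists (fun i => h @^-1` (F i `*` G i)).
  rewrite -preimage_bigcup; apply/esym; rewrite -subTset => t _ /=.
  have [i _ Fi] : (\bigcup_i F i) (h t).1 by rewrite -FT.
  have [j _ Gj] : (\bigcup_i G i) (h t).2 by rewrite -GT.
  exists (maxn i j) => //; split.
    by move: Fi; exact/subsetPset/ndF/leq_maxl.
  by move: Gj; exact/subsetPset/ndG/leq_maxr.
move=> i; have [mFi Foo] := mF i; have [mGi Goo] := mG i; split.
  by rewrite -[X in measurable X]setTI; apply: mh => //; exact: measurableX.
rewrite /lebesgue_step /pushforward.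
rewrite -comp_preimage (_ : h \o _ = id); last exact/funext.
rewrite preimage_id.
by rewrite product_measure1E// lte_mul_pinfty// ge0_fin_numE.
Qed.

HB.instance Definition _ :=
  @Measure_isSigmaFinite.Build _ _ _ lebesgue_step lebesgue_step_sigma_finite.

End step.

Fixpoint lebesgue_tuple n : {sigma_finite_measure set (n.-tuple T) -> \bar R} :=
  if n is n'.+1 then lebesgue_step (lebesgue_tuple n') else \d_[tuple].

Lemma lebesgue_tuple_box n (A : 'I_n -> set T) :
  (forall i, measurable (A i)) ->
  lebesgue_tuple n [set t | forall i, A i (tnth t i)] =
  (\prod_(i < n) lebesgue_measure (A i))%E.
Proof.
elim: n => [|n IHn] in A *.
  by move=> _; rewrite big_ord0 /= diracE mem_set// => -[].
move=> mA; rewrite big_ord_recl /= /lebesgue_step /pushforward.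
rewrite -IHn; last by move=> i; exact: mA.
rewrite -product_measure1E//; last first.
  rewrite (_ : mkset _ = \bigcap_(i in [set: 'I_n])
      ((@tnth n T)^~ i @^-1` A (lift ord0 i))).
    apply: fin_bigcap_measurable => // i _; rewrite -[X in measurable X]setTI.
    exact: measurable_tnth.
  by apply/seteqP; split=> [t At i _|t At i] /=; [exact: At|exact: At].
congr product_measure1; apply/seteqP; split=> -[x t].
  move=> At; split => [|i]; first exact: (At ord0).
  by have := At (lift ord0 i); rewrite tnthS.
move=> [/= Ax At] i; case: (unliftP ord0 i) => [j ->|->]; last exact: Ax.
by rewrite tnthS; exact: At.
Qed.

End lebesgue_tuple.

(* The coordinates of R^(md) are the entries of the matrix, row by row. *)
Definition almost_all_linear (R : realType) m d (P : 'M[R]_(m, d) -> Prop) :=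
  {ae @lebesgue_tuple R (m * d),
    forall t : (m * d).-tuple (measurableTypeR R),
      P (vec_mx (\row_i (tnth t i : R)))}.

Definition integer_points {R : realType} n : set 'rV[R]_n :=
  [set v | forall i, v 0 i \is a Num.int].

Definition boundary (X : topologicalType) (A : set X) : set X :=
  closure A `\` interior A.

Definition euclidean_dist {R : realType} n (x y : 'rV[R]_n) : R :=
  Num.sqrt (\sum_i (x 0 i - y 0 i) ^+ 2).

(* R^k is 'rV_(d + m), with m = k - d; lsubmx and rsubmx are the projections
   onto the first d and the last m coordinates. *)
Section cut_and_project.
Context {R : realType} {d m : nat}.
Local Notation V := 'rV[R]_(d + m).
Local Notation Zk := (@integer_points R (d + m)).
Implicit Types (L : 'M[R]_(m, d)) (F : {vspace V}) (s : V).

(* Vectors are rows, so that L(x) is x *m L^T. *)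
Definition graph_map L (x : 'rV[R]_d) : V := row_mx x (x *m L^T).

Lemma graph_map_is_linear L : linear (graph_map L).
Proof.
by move=> a x y; rewrite /graph_map mulmxDl -scalemxAl -add_row_mx scale_row_mx.
Qed.

HB.instance Definition _ L :=
  GRing.isLinear.Build R 'rV[R]_d V _ (graph_map L) (graph_map_is_linear L).

Definition physical_space L : {vspace V} := limg (linfun (graph_map L)).

Lemma physical_spaceE L :
  [set` physical_space L] = [set row_mx x (x *m L^T) | x in [set: 'rV[R]_d]].
Proof.
apply/seteqP; split=> [v /memv_imgP[x _ ->]|_ [x _ <-]] /=.
  by exists x => //; rewrite lfunE.
by apply/memv_imgP; exists x; rewrite ?memvf// lfunE.
Qed.

Definition totally_irrational L :=
  dense [set e + z | e in [set` physical_space L] & z in Zk].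

(* daddv_pi U W is the projection onto U along W, for U and W complementary. *)
Definition proj_physical L F : V -> V := daddv_pi (physical_space L) F.

Definition proj_internal L F : V -> V := daddv_pi F (physical_space L).

Definition admissible L F :=
  [/\ (physical_space L + F = fullv)%VS,
      (physical_space L :&: F = 0)%VS &
      set_inj Zk (proj_physical L F)].

Definition unit_box : set V :=
  [set v | lsubmx v = 0 /\ forall i, 0 <= rsubmx v 0 i <= 1].

Definition window L F : set V := proj_internal L F @` unit_box.

Definition slice L F : set V :=
  [set w + e | w in window L F & e in [set` physical_space L]].

Definition shifted_lattice s : set V := [set z + s | z in Zk].

Definition cut_project L F s : set V :=
  proj_physical L F @` (slice L F `&` shifted_lattice s).

Definition regular L F s := boundary (slice L F) `&` shifted_lattice s = set0.

(* The point of Z^k + s above y, unique for admissible F and y in Y_s; the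
   value is 0 if there is none. *)
Definition lift_point L F s (y : V) : V :=
  xget 0 [set z | shifted_lattice s z /\ proj_physical L F z = y].

Definition lattice_box (r : R) : set V :=
  Zk `&` [set v | forall j, - r <= lsubmx v 0 j <= r].

Definition r_patch L F s (y : V) (r : R) : set V :=
  [set y' | cut_project L F s y' /\
            lattice_box r (lift_point L F s y' - lift_point L F s y)].

Definition patch_equiv L F s (r : R) (y1 y2 : V) :=
  [set u - y1 | u in r_patch L F s y1 r] = [set u - y2 | u in r_patch L F s y2 r].

(* The equivalence class of the r-patch at y, each r-patch being represented by
   its centre. *)
Definition patch_class L F s (y : V) (r : R) : set V :=
  [set y' | cut_project L F s y' /\ patch_equiv L F s r y y'].

Definition repulsive L F s (phi : R -> R) :=
  \forall r \near +oo, forall y y',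
    cut_project L F s y -> cut_project L F s y' -> y <> y' ->
    patch_class L F s y r = patch_class L F s y' r ->
    phi r < euclidean_dist y y'.

End cut_and_project.

(* Main.v *)
Require Import Defs.
From HB Require Import structures.
From mathcomp Require Import all_boot all_order all_algebra.
From mathcomp Require Import all_classical all_reals all_analysis.
From mathcomp Require Import measurable_realfun.
From mathcomp Require Import cyclic.
From mathcomp Require Import ring lra zify.

Set Implicit Arguments.
Unset Strict Implicit.
Unset Printing Implicit Defensive.

Import Order.TTheory GRing.Theory Num.Theory.
Import numFieldNormedType.Exports.

Local Open Scope classical_set_scope.
Local Open Scope ring_scope.

(** Write m = k - d. The points of Y correspond to h in Z^d, the height of the
    point h in the window being the fractional part of offset - L h, and two
    points have the same r-patch iff none of the values L_i l mod 1, for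
    |l| <= r, separates their i-th heights. A displacement g is therefore a
    repetition as soon as every ||L_i g|| is smaller than a gap between those
    values, and conversely every repetition has all ||L_i g|| at most such a
    gap.

    By pigeonhole there are gaps of length at least (2 r + 1)^(-d), and by the
    divergence half of the Khintchine-Groshev theorem some g of size N has
    max_i ||L_i g||^m as small as a constant times 1 / (N^d ln N); this gives (1).
    The convergence half applied to a single row bounds all gaps by
    r^(-d) (ln r)^(d (1 + e)), and applied to all the rows together it bounds
    max_i ||L_i g||^m below by 1 / (N^d (ln N)^(1 + e)); this gives (2).

    In the divergence half, the sets of L for which L h is close to an integer
    vector are quasi-independent for suitably chosen families of h, so the
    second moment method gives positive measure, and invariance under rational
    translations upgrades this to full measure. *)

(** Origin of the exponents. In (1) a gap is about r^(-d), and ||L_i g||^m, about 1 / (N^d ln N),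
    falls below r^(-m d) once N is about r^m / (ln r)^(1/d). In (2) the m-th power of the gap bound
    is compared with 1 / (N^d (ln N)^(1 + e)), which forces N above r^m / (ln r)^((1/d + m)(1 + e));
    eps absorbs e. The passage from one row to its gaps is a transference: if ||L_i h|| >= delta for
    0 < |h| < X, a packing argument shows that the values at |h| <= 2 n X come within 2 n delta of
    every point modulo 1, for n > 1 / (X^d delta). Replacing X by n X, with n about (ln r)^(1 + e),
    costs the additional (ln r)^m in (2). The obstacle in the divergence half is that events for
    parallel vectors h are correlated. For d >= 2 there are enough pairwise nonparallel vectors; for
    d = 1 there are none, and reduced fractions replace them. A rational translation with
    denominator D turns a solution h into D h and worsens the constant; the set of full measure must
    therefore ask for arbitrarily small constants, which also makes c arbitrary in (1). *)

(** * Half-open boxes with rational corners as a generating class *)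

Section tuple_boxes.
Context {R : realType} (n : nat).
Local Notation T := (measurableTypeR R).

(** Half-open edges, so that a box cut at a coordinate value splits into two disjoint boxes. *)
Definition tuple_box (a b : 'I_n -> R) : set (n.-tuple T) :=
  [set t | forall i, a i < (tnth t i : R) <= b i].

Lemma tuple_boxI a b a' b' :
  tuple_box a b `&` tuple_box a' b' =
  tuple_box (fun i => Num.max (a i) (a' i)) (fun i => Num.min (b i) (b' i)).
Proof.
apply/seteqP; split=> [t [H H'] i|t H].
  have /andP[h1 h2] := H i; have /andP[h3 h4] := H' i.
  by apply/andP; split; [rewrite gt_max; apply/andP | rewrite le_min; apply/andP].
by split=> i; have := H i; rewrite gt_max le_min => /andP[/andP[h1 h2] /andP[h3 h4]];
  apply/andP.
Qed.

Lemma measurable_tuple_pi (A : 'I_n -> set T) :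
  (forall i, measurable (A i)) ->
  measurable [set t : n.-tuple T | forall i, A i (tnth t i)].
Proof.
move=> mA; rewrite (_ : mkset _ = \bigcap_(i in [set: 'I_n])
    ((@tnth n T)^~ i @^-1` A i)); last first.
  by apply/seteqP; split=> [t At i _|t At i] /=; [exact: At|exact: At].
apply: fin_bigcap_measurable => // i _.
by rewrite -[X in measurable X]setTI; exact: measurable_tnth.
Qed.

Lemma tuple_boxE a b : tuple_box a b =
  [set t | forall i, [set` `]a i, b i]] (tnth t i : R)].
Proof.
by apply/seteqP; split=> t /= + i => /(_ i); rewrite in_itv.
Qed.

Lemma measurable_tuple_box a b : measurable (tuple_box a b).
Proof.
by rewrite tuple_boxE; apply: (@measurable_tuple_pi (fun i => [set` `]a i, b i]])) => i; exact: measurable_itv.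
Qed.

(** Rational corners keep the class stable under the rational translations of the zero-one law. *)
Definition rat_boxes : set (set (n.-tuple T)) :=
  [set tuple_box (fun i => ratr (ab.1 i)) (fun i => ratr (ab.2 i)) |
     ab in [set: ('I_n -> rat) * ('I_n -> rat)]].

Lemma ratr_max (x y : rat) :
  ratr (Num.max x y) = Num.max (ratr x) (ratr y) :> R.
Proof. by rewrite !maxEle ler_rat; case: ifP. Qed.

Lemma ratr_min (x y : rat) :
  ratr (Num.min x y) = Num.min (ratr x) (ratr y) :> R.
Proof. by rewrite !minEle ler_rat; case: ifP. Qed.

Lemma rat_boxes_setI_closed : setI_closed rat_boxes.
Proof.
move=> _ _ [[a b] _ <-] [[a' b'] _ <-]; rewrite tuple_boxI /=.
exists (fun i => Num.max (a i) (a' i), fun i => Num.min (b i) (b' i)) => //=.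
by congr tuple_box; apply/funext => i; rewrite (ratr_max, ratr_min).
Qed.

Definition cube (k : R) : set (n.-tuple T) := tuple_box (fun=> - k) (fun=> k).

Lemma cube_rat (k : nat) : rat_boxes (cube k%:R).
Proof.
exists (fun=> - k%:R, fun=> k%:R) => //=.
by rewrite /cube; congr tuple_box; apply/funext => i; rewrite ?rmorphN /= ratr_nat.
Qed.

Lemma in_cube (t : n.-tuple T) : exists k : nat, cube k%:R t.
Proof.
pose k := (Num.truncn (\sum_i `|tnth t i : R|)).+1.
exists k => i; rewrite andbC.
have : `|tnth t i : R| < k%:R.
  apply: le_lt_trans (truncnS_gt (\sum_i `|tnth t i : R|)).
  by rewrite (bigD1 i) //= lerDl sumr_ge0.
by rewrite ltr_norml => /andP[-> /ltW ->].
Qed.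

Lemma cube_cover : \bigcup_k cube k%:R = setT.
Proof.
rewrite -subTset => t _; have [k kt] := in_cube t.
by exists k.
Qed.

Lemma rat_boxes_tnth (i : 'I_n) (B : set T) : measurable B ->
  <<s rat_boxes >> ((fun t : n.-tuple T => tnth t i) @^-1` B).
Proof.
move=> mB.
pose f : g_sigma_algebraType rat_boxes -> T := fun t : n.-tuple T => tnth t i.
have mf : measurable_fun setT f.
  apply: (@measurability _ _ _ _ _ f (@RGenOInfty.G R)).
    exact: RGenOInfty.measurableE.
  move=> _ [_ [x ->] <-]; rewrite setTI.
  (* The ray above x in coordinate i is a countable union of rational boxes: the lower edge in
     coordinate i is a rational q > x, and all other faces lie at distance k from the origin. *)
  rewrite (_ : f @^-1` _ = \bigcup_k \bigcup_(q in [set q : rat | x < ratr q])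
    tuple_box (fun j => if j == i then ratr q else - k%:R) (fun=> k%:R)).
    apply: bigcupT_measurable => k; rewrite bigcup_mkcond; apply: bigcupT_measurable_rat => q; case: ifP => // _.
    apply: sub_sigma_algebra; exists (fun j => if j == i then q else - k%:R, fun=> k%:R) => //=.
    congr tuple_box; apply/funext => j; rewrite ?ratr_nat//.
    by case: ifP => // _; rewrite rmorphN /= ratr_nat.
  apply/seteqP; split=> t.
    rewrite /f/= in_itv/= andbT => xt; have [k kt] := in_cube t.
    have [q] := rat_in_itvoo xt; rewrite in_itv/= => /andP[xq qt].
    exists k => //; exists q => // j; have /andP[h1 h2] := kt j.
    by apply/andP; split => //; case: eqP => // ->.
  move=> [k _ [q /= xq /(_ i)]]; rewrite eqxx => /andP[qt _].
  by rewrite /f/= in_itv/= andbT (lt_trans xq).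
by have := mf measurableT _ mB; rewrite setTI.
Qed.

Lemma rat_boxes_generate : @measurable _ (n.-tuple T) = <<s rat_boxes >>.
Proof.
apply/seteqP; split; last first.
  apply: smallest_sub; first exact: sigma_algebra_measurable.
  by move=> _ [ab _ <-]; exact: measurable_tuple_box.
apply: smallest_sub; first exact: smallest_sigma_algebra.
apply: (big_ind (fun X => X `<=` <<s rat_boxes >>)) => //.
  by move=> X Y XG YG A [/XG|/YG].
by move=> i _ _ [B mB <-]; rewrite setTI; exact: rat_boxes_tnth.
Qed.

Lemma tuple_measure_unique (m1 m2 : {measure set (n.-tuple T) -> \bar R}) :
  (forall a b : 'I_n -> rat,
     m1 (tuple_box (fun i => ratr (a i)) (fun i => ratr (b i))) =
     m2 (tuple_box (fun i => ratr (a i)) (fun i => ratr (b i)))) ->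
  (forall k : nat, m1 (cube k%:R) < +oo)%E ->
  forall A, measurable A -> m1 A = m2 A.
Proof.
move=> m12 m1oo; apply: (measure_unique rat_boxes (fun k => cube k%:R)) => //.
- exact: rat_boxes_generate.
- exact: rat_boxes_setI_closed.
- exact: cube_rat.
- exact: cube_cover.
- by move=> _ [[a b] _ <-]; exact: m12.
Qed.

End tuple_boxes.

(** * Measures invariant under rational translations *)

Section rational_invariance.
Context {R : realType} (n : nat).
Local Notation T := (measurableTypeR R).
Local Notation rbox a b :=
  (@tuple_box R n (fun i => ratr (a i)) (fun i => ratr (b i))).
Variable nu : {measure set (n.-tuple T) -> \bar R}.
Hypothesis nu_shift : forall a b v : 'I_n -> rat,
  nu (rbox (a \+ v) (b \+ v)) = nu (rbox a b).
Hypothesis nu_fin : forall a b : 'I_n -> rat, (nu (rbox a b) < +oo)%E.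

Let upd (a : 'I_n -> rat) (i : 'I_n) (x : rat) : 'I_n -> rat :=
  fun j => if j == i then x else a j.

Let eq_rbox a b a' b' : a =1 a' -> b =1 b' -> nu (rbox a b) = nu (rbox a' b').
Proof. by move=> /funext -> /funext ->. Qed.

Section one_coordinate.
Variables (a b : 'I_n -> rat) (i : 'I_n).

Let F (x y : rat) := nu (rbox (upd a i x) (upd b i y)).

Let F_shift x y v : F (x + v) (y + v) = F x y.
Proof.
rewrite /F -[RHS](nu_shift _ _ (upd (fun=> 0) i v)); apply: eq_rbox => j /=;
  by rewrite /upd; case: ifP; rewrite ?addr0.
Qed.

Let F_split x y z : x <= y -> y <= z -> F x z = (F x y + F y z)%E.
Proof.
move=> xy yz; rewrite /F -measureU; try exact: measurable_tuple_box.
  congr (nu _); apply/seteqP; split => [t H|t [H|H] j].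
  - have [ty|ty] := leP (tnth t i : R) (ratr y); [left|right] => j;
      have /andP[h1 h2] := H j; apply/andP; split; move: h1 h2; rewrite /upd;
      by case: ifP => // /eqP ->.
  - have /andP[h1 h2] := H j; apply/andP; split => //.
    move: h2; rewrite /upd; case: ifP => // _ /le_trans; apply.
    by rewrite ler_rat.
  - have /andP[h1 h2] := H j; apply/andP; split => //.
    move: h1; rewrite /upd; case: ifP => // _; apply: le_lt_trans.
    by rewrite ler_rat.
apply/seteqP; split => // t [/(_ i) /andP[_ +] /(_ i) /andP[+ _]].
by rewrite /upd !eqxx => h1 h2; have := le_lt_trans h1 h2; rewrite ltxx.
Qed.

Let F_mul (p t : nat) : F 0 (p%:R / t%:R) = (p%:R%:E * F 0 (t%:R^-1))%E.
Proof.
elim: p => [|p IH].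
  rewrite mul0r mul0e /F (_ : rbox _ _ = set0) ?measure0//.
  apply/seteqP; split => // s /(_ i) /andP[].
  by rewrite /upd !eqxx => h1 h2; have := lt_le_trans h1 h2; rewrite ltxx.
rewrite (@F_split _ (p%:R / t%:R)) ?divr_ge0//; last first.
  by rewrite ler_wpM2r ?invr_ge0// ler_nat.
have -> : F (p%:R / t%:R) (p.+1%:R / t%:R) = F 0 (t%:R^-1).
  by rewrite -[RHS](F_shift _ _ (p%:R / t%:R)) add0r -natr1 mulrDl mul1r addrC.
rewrite IH -natr1 EFinD ge0_muleDl ?lee_fin// mul1e //.
Qed.

(* Additivity and invariance determine the dependence on one edge of the box. *)
Lemma box_one_coordinate : nu (rbox a b) =
  ((ratr (Num.max 0 (b i - a i)))%:E * nu (rbox (upd a i 0%R) (upd b i 1%R)))%E.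
Proof.
have -> : nu (rbox a b) = F (a i) (b i).
  by apply: eq_rbox => j; rewrite /upd; case: eqP => // ->.
have [ba|ab] := leP (b i) (a i).
  rewrite max_l ?subr_le0// rmorph0 mul0e /F (_ : rbox _ _ = set0) ?measure0//.
  apply/seteqP; split => // s /(_ i) /andP[].
  rewrite /upd !eqxx => h1 h2; have := lt_le_trans h1 h2.
  by rewrite ltr_rat ltNge ba.
rewrite max_r ?subr_ge0 1?ltW//.
rewrite -(F_shift _ _ (- a i)) subrr; set x := b i - a i.
have x0 : 0 <= x by rewrite subr_ge0 ltW.
have -> : x = `|numq x|%:R / `|denq x|%:R.
  rewrite -[LHS]divq_num_den; congr (_ / _).
    by rewrite -[in LHS](gez0_abs (_ : 0 <= numq x)) ?numq_ge0.
  by rewrite -[in LHS](gez0_abs (denq_ge0 x)).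
set p := `|_|%N; set t := `|denq x|%N.
have t0 : (0 < t)%N by rewrite absz_gt0 denq_eq0.
(* The case p = t expresses the unit edge through the edge of length 1 / t, whose unknown measure
   then cancels. *)
have := F_mul t t; rewrite divff ?pnatr_eq0 -?lt0n// => F1.
rewrite F_mul -/(F 0 1) F1 muleA -EFinM; congr (_%:E * _)%E.
by rewrite fmorph_div !rmorph_nat mulfVK// pnatr_eq0 -lt0n.
Qed.

End one_coordinate.

Lemma rat_box_measure (a b : 'I_n -> rat) : nu (rbox a b) =
  ((\prod_i ratr (Num.max 0 (b i - a i)))%:E * nu (rbox (cst 0%R) (cst 1%R)))%E.
Proof.
pose updS (s : seq 'I_n) (x : rat) (f : 'I_n -> rat) : 'I_n -> rat :=
  fun j => if j \in s then x else f j.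
have H (s : seq 'I_n) : uniq s -> nu (rbox a b) =
  ((\prod_(i <- s) ratr (Num.max 0 (b i - a i)))%:E *
    nu (rbox (updS s 0%R a) (updS s 1%R b)))%E.
  elim: s => [_|i s IH /= /andP[si us]].
    by rewrite big_nil mul1e; exact: eq_rbox.
  rewrite IH// big_cons mulrC EFinM -muleA; congr (_ * _)%E.
  rewrite (box_one_coordinate _ _ i) /updS (negbTE si); congr (_ * _)%E;
    by apply: eq_rbox => j; rewrite /upd inE; case: eqP.
rewrite (H (index_enum 'I_n)) ?index_enum_uniq//; congr (_ * _)%E;
  by apply: eq_rbox => j; rewrite /updS mem_index_enum.
Qed.

End rational_invariance.

(** * Translations of R^n and a zero-one law *)

Section tuple_shift.
Context {R : realType} (n : nat).
Local Notation T := (measurableTypeR R).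
Local Notation lambda := (@lebesgue_tuple R n).

Definition tuple_shift (v : 'I_n -> R) (t : n.-tuple T) : n.-tuple T :=
  mktuple (fun i => (tnth t i : R) + v i).

Lemma tnth_shift v t i : tnth (tuple_shift v t) i = (tnth t i : R) + v i :> R.
Proof. by rewrite tnth_mktuple. Qed.

Lemma measurable_tuple_shift v : measurable_fun setT (tuple_shift v).
Proof.
apply/measurable_fun_tnthP => i.
rewrite (_ : _ \o _ = (fun t : n.-tuple T => (tnth t i : R) + v i)).
  by apply: measurable_funD => //; exact: measurable_tnth.
by apply/funext => t /=; rewrite tnth_shift.
Qed.

Lemma preimage_shift_box v a b : tuple_shift v @^-1` tuple_box a b =
  tuple_box (a \- v) (b \- v).
Proof.
apply/seteqP; split=> t H i; have := H i; rewrite tnth_shift /=.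
  by move=> /andP[h1 h2]; apply/andP; split; [rewrite ltrBlDr|rewrite lerBrDr].
by move=> /andP[h1 h2]; apply/andP; split; [rewrite -ltrBlDr|rewrite -lerBrDr].
Qed.

Lemma lebesgue_box a b :
  lambda (tuple_box a b) = (\prod_i Num.max 0 (b i - a i))%:E.
Proof.
rewrite tuple_boxE (@lebesgue_tuple_box _ _ (fun i => [set` `]a i, b i]])) => [|i];
  last exact: measurable_itv.
rewrite -prodEFin; apply: eq_bigr => i _; rewrite lebesgue_measure_itv /= lte_fin.
case: ltP => h; first by rewrite max_r// subr_ge0 ltW.
by rewrite max_l// subr_le0.
Qed.

Lemma lebesgue_shift v A : measurable A ->
  lambda (tuple_shift v @^-1` A) = lambda A.
Proof.
move=> mA; have mf := measurable_tuple_shift v.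
apply/esym; apply: (@tuple_measure_unique _ _ lambda
  (pushforward lambda (tuple_shift v))) => // [a b|k].
  rewrite /= /pushforward preimage_shift_box !lebesgue_box; congr _%:E.
  by apply: eq_bigr => i _; congr Num.max => /=; rewrite opprB addrA subrK.
by rewrite /= /cube lebesgue_box ltry.
Qed.

(* A |-> lambda (W `&` A) is invariant under rational translations, hence a
   multiple of lambda; evaluated at ~` W it vanishes. *)
Theorem rational_zero_one (W A : set (n.-tuple T)) :
  measurable W -> measurable A ->
  (forall (v : 'I_n -> rat) t, W t -> W (tuple_shift (fun i => ratr (v i)) t)) ->
  (0 < lambda (A `&` W))%E -> lambda (~` W) = 0.
Proof.
move=> mW mA Wshift AW_gt0.
pose nu := mrestr lambda mW.
have preW (v : 'I_n -> rat) : tuple_shift (fun i => ratr (v i)) @^-1` W = W.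
  apply/seteqP; split=> t; last exact: Wshift.
  move=> /(Wshift (fun i => - v i)); congr W; apply: eq_from_tnth => i.
  by rewrite !tnth_shift rmorphN addrK.
have nu_shift (a b v : 'I_n -> rat) :
    nu (tuple_box (fun i => ratr ((a \+ v) i)) (fun i => ratr ((b \+ v) i))) =
    nu (tuple_box (fun i => ratr (a i)) (fun i => ratr (b i))).
  rewrite /nu /mrestr -[LHS](lebesgue_shift (fun i => ratr (v i))); last first.
    by apply: measurableI => //; exact: measurable_tuple_box.
  rewrite preimage_setI preW preimage_shift_box; congr (lambda (tuple_box _ _ `&` _));
    by apply/funext => i /=; rewrite rmorphD addrK.
have nu_fin a b : (nu (tuple_box a b) < +oo)%E.
  apply: (@le_lt_trans _ _ (lambda (tuple_box a b))).
    by apply: le_measure; rewrite ?inE//; [apply: measurableI => //|];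
      exact: measurable_tuple_box.
  by rewrite lebesgue_box ltry.
have nuE (a b : 'I_n -> rat) := rat_box_measure nu_shift a b.
set c := nu (tuple_box (fun i => ratr (cst 0 i)) (fun i => ratr (cst 1 i))) in nuE.
have c_fin : c \is a fin_num by rewrite ge0_fin_numE ?measure_ge0 ?nu_fin.
have c0 : 0 <= fine c by rewrite fine_ge0 ?measure_ge0.
have {}nuE B : measurable B -> nu B = mscale (NngNum c0) lambda B.
  move=> mB.  apply: (tuple_measure_unique (m1 := nu) (m2 := mscale (NngNum c0) lambda)) => // [a b|k];
    last exact: nu_fin.
  rewrite /= nuE /mscale /= lebesgue_box muleC /= fineK//; congr (_ * _%:E)%E.
  by apply: eq_bigr => i _; rewrite ratr_max rmorph0 rmorphB.
have := nuE _ (measurableC mW).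
rewrite /mscale /nu /mrestr setICl measure0 => /esym/eqP; rewrite mule_eq0.
case/orP => /eqP // c00; move: AW_gt0.
by have := nuE _ mA; rewrite /mscale /nu /mrestr /= in c00 *; rewrite c00 mul0e => ->; rewrite ltxx.
Qed.

End tuple_shift.

(** * Finite families of events: union bound, disjoint sums, second moment *)

Section finite_families.
Context {d : measure_display} {T : measurableType d} {R : realType}.
Variable mu : {measure set T -> \bar R}.
Context {K : finType} (B : K -> set T).
Hypothesis mB : forall k, measurable (B k).

Lemma measure_finType_cover (D : set T) : measurable D ->
  D `<=` \bigcup_k B k -> (mu D <= \sum_k mu (B k))%E.
Proof.
move=> mD DB; apply: (@le_trans _ _ (mu (\big[setU/set0]_k B k))).
  apply: le_measure; rewrite ?inE//; first exact: bigsetU_measurable.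
  move=> t /DB[k _ Bkt]; rewrite -bigcup_seq; exists k => //=.
  exact: mem_index_enum.
elim: (index_enum K) => [|k s IH]; first by rewrite !big_nil measure0.
rewrite !big_cons; apply: le_trans (leeD2l _ IH).
by apply: measureU2 => //; exact: bigsetU_measurable.
Qed.

Lemma measure_finType_disjoint (D : set T) : measurable D ->
  (forall k, B k `<=` D) -> (forall k l t, B k t -> B l t -> k = l) ->
  (\sum_k mu (B k) <= mu D)%E.
Proof.
move=> mD BD Bdisj.
have mU (s : seq K) : measurable (\big[setU/set0]_(k <- s) B k).
  by apply: bigsetU_measurable.
have H (s : seq K) : uniq s ->
    (\sum_(k <- s) mu (B k))%E = mu (\big[setU/set0]_(k <- s) B k).
  elim: s => [|k s IH /= /andP[ks us]]; first by rewrite !big_nil measure0.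
  rewrite !big_cons IH// measureU//.
  apply/seteqP; split => // t [Bk]; rewrite -bigcup_seq => -[l /= ls Bl].
  by move: ks; rewrite (Bdisj _ _ _ Bk Bl) ls.
rewrite H ?index_enum_uniq//; apply: le_measure; rewrite ?inE//.
by rewrite -bigcup_seq; apply: bigcup_sub => k _.
Qed.

(* Integrate 2 t Z <= 1_U + t^2 Z^2, with Z the number of k such that x is in B k. *)
Lemma second_moment (t : R) : 0 <= t ->
  ((2 * t)%:E * (\sum_k mu (B k)) <=
   mu (\bigcup_k B k) + (t ^+ 2)%:E * (\sum_k \sum_l mu (B k `&` B l)))%E.
Proof.
move=> t0.
pose U := \bigcup_k B k.
have mU : measurable U by apply: fin_bigcup_measurable.
pose Z (x : T) : R := \sum_k \1_(B k) x.
have Z2 x : Z x ^+ 2 = \sum_k \sum_l \1_(B k `&` B l) x.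
  rewrite expr2 /Z mulr_suml; apply: eq_bigr => k _; rewrite mulr_sumr.
  by apply: eq_bigr => l _; rewrite indicI.
have intZ : (\int[mu]_x (Z x)%:E = \sum_k mu (B k))%E.
  rewrite /Z; under eq_integral do rewrite -sumEFin.
  rewrite ge0_integral_sum//.
    by apply: eq_bigr => k _; rewrite integral_indic// setIT.
  by move=> k; apply/measurable_EFinP.
have intZ2 : (\int[mu]_x (Z x ^+ 2)%:E = \sum_k \sum_l mu (B k `&` B l))%E.
  under eq_integral do rewrite Z2 -sumEFin.
  rewrite ge0_integral_sum//; first last.
  - by move=> k x _; rewrite lee_fin sumr_ge0.
  - move=> k; apply/measurable_EFinP; apply: measurable_sum => l.
    by apply: measurable_indic; exact: measurableI.
  apply: eq_bigr => k _.
  under eq_integral do rewrite -sumEFin.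
  rewrite ge0_integral_sum//; first last.
    by move=> l; apply/measurable_EFinP; apply: measurable_indic; exact: measurableI.
  by apply: eq_bigr => l _; rewrite integral_indic ?setIT//; exact: measurableI.
have Z0 x : 0 <= Z x by rewrite sumr_ge0.
have mZ : measurable_fun setT Z by apply: measurable_sum => k; exact: measurable_indic.
have -> : mu (\bigcup_k B k) = (\int[mu]_x (\1_U x)%:E)%E by rewrite integral_indic// setIT.
rewrite -intZ -intZ2 -!ge0_integralZl//; first last.
- by rewrite lee_fin mulr_ge0.
- by move=> x _; rewrite lee_fin.
- exact/measurable_EFinP.
- by rewrite lee_fin sqr_ge0.
- by move=> x _; rewrite lee_fin sqr_ge0.
- by apply/measurable_EFinP; exact: measurable_funX.
rewrite -ge0_integralD//; first last.
- apply: emeasurable_funM => //; apply/measurable_EFinP; exact: measurable_funX.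
- by move=> x _; rewrite -EFinM lee_fin mulr_ge0 ?sqr_ge0.
- by apply/measurable_EFinP; exact: measurable_indic.
apply: ge0_le_integral => //.
- by move=> x _; rewrite -EFinM lee_fin !mulr_ge0.
- by apply: emeasurable_funM => //; exact/measurable_EFinP.
- apply: emeasurable_funD; first by apply/measurable_EFinP; exact: measurable_indic.
  by apply: emeasurable_funM => //; apply/measurable_EFinP; exact: measurable_funX.
move=> x _; rewrite -!EFinM -EFinD lee_fin indicE.
have [xU|xU] := boolP (x \in U).
  have := sqr_ge0 (1 - t * Z x); rewrite sqrrB expr1n mul1r exprMn.
  by rewrite mulr1n; lra.
rewrite (_ : Z x = 0) ?expr0n ?mulr0 ?addr0//.
rewrite /Z big1// => k _; rewrite indicE; case: (boolP (x \in B k)) => // xk.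
by move: xU; rewrite notin_setE => -[]; exists k => //; rewrite inE in xk.
Qed.

End finite_families.

(** * Fractional parts and the division of the circle into M arcs *)

Section fractional_part.
Context {R : realType}.
Implicit Types x y : R.

Definition frac_part x : R := x - (Num.floor x)%:~R.

Lemma frac_ge0 x : 0 <= frac_part x.
Proof. by rewrite subr_ge0 floor_le. Qed.

Lemma frac_lt1 x : frac_part x < 1.
Proof. by rewrite ltrBlDl -[1]/(1%:~R) -intrD floorD1_gt. Qed.

Lemma fracDint x y : y \is a Num.int -> frac_part (x + y) = frac_part x.
Proof.
move=> yint; rewrite /frac_part floorDrz// intrD.
by move: (yint); rewrite intrEfloor => /eqP ->; ring.
Qed.

Lemma frac_int x y : x - y \is a Num.int -> frac_part x = frac_part y.
Proof. by move=> h; rewrite -(subrK y x) addrC fracDint. Qed.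

Lemma int_lt1 x : x \is a Num.int -> `|x| < 1 -> x = 0.
Proof.
move=> /intrP[z ->]; rewrite -intr_norm -[1]/(1%:~R) ltr_int => h.
by have -> : z = 0 by lia.
Qed.

(** M times the difference of the two fractional parts is an integer of absolute value less than 1,
    hence 0, so k and l agree modulo M. *)
Lemma frac_step_inj (M k l : nat) y : (k < M)%N -> (l < M)%N ->
  frac_part (y - k%:R / M%:R) < M%:R^-1 -> frac_part (y - l%:R / M%:R) < M%:R^-1 ->
  k = l.
Proof.
move=> kM lM; set f := frac_part _ => fM; set g := frac_part _ => gM.
have M0 : 0 < M%:R :> R by rewrite ltr0n; lia.
have f0 : 0 <= f := frac_ge0 _. have g0 : 0 <= g := frac_ge0 _.
pose z : int := l%:Z - k%:Z - M%:Z * (Num.floor (y - k%:R / M%:R) - Num.floor (y - l%:R / M%:R)).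
have zE : z%:~R = M%:R * (f - g) :> R.
  rewrite /f /g /frac_part /z !(intrB, intrM) -!pmulrn; field.
  exact: lt0r_neq0.
have : `|z%:~R| < (1 : R).
  rewrite zE normrM (gtr0_norm M0) mulrC -ltr_pdivlMr// mul1r ltr_norml; lra.
move=> /(int_lt1 (intr_int _ _))/eqP; rewrite intr_eq0 => /eqP; rewrite /z.
set w := _ - Num.floor _ => h.
have {}h : k%:Z = l%:Z + M%:Z * (- w) by move: h; lia.
have := congr1 (fun x : int => (x %% M%:Z)%Z) h.
by rewrite addrC mulrC modzMDl !modz_nat => -[]; rewrite !modn_small.
Qed.

Lemma frac_step_cover (M : nat) y : (0 < M)%N ->
  exists k : 'I_M, frac_part (y - k%:R / M%:R) < M%:R^-1.
Proof.
move=> M0; have MR : 0 < M%:R :> R by rewrite ltr0n.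
pose k := Num.truncn (M%:R * frac_part y).
have h0 : 0 <= M%:R * frac_part y by rewrite mulr_ge0// frac_ge0.
have /andP[k1 k2] := truncn_itv h0.
have kM : (k < M)%N.
  rewrite -(ltr_nat R); apply: le_lt_trans k1 _.
  by rewrite -ltr_pdivlMl// mulVf ?gt_eqF// frac_lt1.
exists (Ordinal kM) => /=.
rewrite (@frac_int _ (frac_part y - k%:R / M%:R)); last first.
  rewrite (_ : _ - _ = (Num.floor y)%:~R); last by rewrite /frac_part; ring.
  exact: intr_int.
have f0 : 0 <= frac_part y - k%:R / M%:R by rewrite subr_ge0 ler_pdivrMr// mulrC.
have f1 : frac_part y - k%:R / M%:R < M%:R^-1.
  by rewrite ltrBlDr -[X in X + _]mul1r -mulrDl ltr_pdivlMr// nat1r mulrC.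
rewrite {1}/frac_part (@floor_def _ _ 0) ?subr0// f0 /= (lt_le_trans f1)//.
by rewrite invf_le1// ler1n.
Qed.

End fractional_part.

(** * Measure of the set of matrices whose linear forms fall into short arcs modulo 1 *)

Section slices.
Context {R : realType} (m d : nat).
Local Notation T := (measurableTypeR R).
Local Notation lambda := (@lebesgue_tuple R (m * d)).
Local Notation cube := (@cube R (m * d)).

Definition tuple_mx (t : (m * d).-tuple T) : 'M[R]_(m, d) :=
  vec_mx (\row_i (tnth t i : R)).

Definition mx_shift (V : 'M[R]_(m, d)) : (m * d).-tuple T -> (m * d).-tuple T :=
  tuple_shift (fun i => mxvec V 0 i).

Lemma tuple_mx_shift V t : tuple_mx (mx_shift V t) = tuple_mx t + V.
Proof.
rewrite /tuple_mx -[V in RHS]mxvecK -linearD; congr vec_mx.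
by apply/rowP => i; rewrite !mxE tnth_shift.
Qed.

Lemma tuple_mxE t i j : tuple_mx t i j = tnth t (mxvec_index i j).
Proof. by rewrite /tuple_mx !mxE. Qed.

Lemma cube_tuple_mx c t : cube c t <-> forall i j, - c < tuple_mx t i j <= c.
Proof.
split=> [H i j|H k]; first by rewrite tuple_mxE; exact: H.
by case/mxvec_indexP: k => i j; have := H i j; rewrite tuple_mxE.
Qed.

Lemma measurable_tuple_mx i j : measurable_fun setT (fun t => tuple_mx t i j).
Proof.
rewrite (_ : (fun t => _) = (fun t => tnth t (mxvec_index i j) : R)).
  exact: measurable_tnth.
by apply/funext => t; rewrite tuple_mxE.
Qed.

Lemma measurable_tuple_mxM s (H : 'M[R]_(d, s)) i a :
  measurable_fun setT (fun t => (tuple_mx t *m H) i a).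
Proof.
rewrite (_ : (fun t => _) = (fun t => \sum_j tuple_mx t i j * H j a)).
  apply: measurable_sum => j; apply: measurable_funM => //.
  exact: measurable_tuple_mx.
by apply/funext => t; rewrite mxE.
Qed.

Lemma measurable_frac : measurable_fun setT (@frac_part R).
Proof.
apply: measurable_funB => //; apply: nondecreasing_measurable => // x y xy.
by rewrite ler_int le_floor.
Qed.

Section slice.
Variables (s : nat) (H : 'M[R]_(d, s)) (S : 'M[R]_(m, s)) (M : 'I_m * 'I_s -> nat).

(** The widths are reciprocals of integers so that finitely many translates tile the space; S moves
    the arcs, so that they may contain points on both sides of 0. *)
Definition slice_set : set ((m * d).-tuple T) :=
  [set t | forall i a, frac_part ((tuple_mx t *m H + S) i a) < (M (i, a))%:R^-1].

Lemma measurable_slice_set : measurable slice_set.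
Proof.
rewrite (_ : slice_set = \bigcap_(p in [set: 'I_m * 'I_s])
   (fun t => frac_part ((tuple_mx t *m H + S) p.1 p.2)) @^-1` `]-oo, (M p)%:R^-1[).
  apply: fin_bigcap_measurable => // p _; rewrite -[X in measurable X]setTI.
  apply: measurableT_comp => //; first exact: measurable_frac.
  rewrite (_ : (fun t => _) = (fun t => (tuple_mx t *m H) p.1 p.2 + S p.1 p.2)).
    apply: measurable_funD => //; exact: measurable_tuple_mxM.
  by apply/funext => t; rewrite mxE.
apply/seteqP; split => [t Ht [i a] _ /=|t Ht i a].
  by rewrite in_itv /=; exact: Ht.
by have := Ht (i, a) I; rewrite /= in_itv.
Qed.

Hypothesis M_gt0 : forall p, (0 < M p)%N.

Hypothesis H_onto : forall u : 'rV[R]_s, exists v : 'rV[R]_d,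
  (forall j, 0 <= v 0 j < 1) /\ forall a, (v *m H - u) 0 a \is a Num.int.

Let K : finType := {dffun forall p : 'I_m * 'I_s, 'I_(M p)}.

Let card_K : #|K| = (\prod_p M p)%N.
Proof.
rewrite card_dep_ffun foldrE big_map big_enum.
by apply: eq_bigr => p _; rewrite card_ord.
Qed.

(* The translates of the slice by the matrices V k tile the space, which gives
   its measure up to the boundary of the cube. *)
Let pick_shift : exists V : K -> 'M[R]_(m, d), forall k,
  (forall i j, 0 <= V k i j < 1) /\
  forall i a, (V k *m H) i a - (k (i, a) : nat)%:R / (M (i, a))%:R \is a Num.int.
Proof.
have /choice[v hv] := H_onto.
pose u (k : K) i : 'rV[R]_s := \row_a ((k (i, a) : nat)%:R / (M (i, a))%:R).
exists (fun k => \matrix_(i, j) v (u k i) 0 j) => k; split=> [i j|i a].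
  by rewrite mxE; have [h _] := hv (u k i); exact: h.
have [_ /(_ a)] := hv (u k i); rewrite !mxE; congr (_ - _ \is a Num.int).
by apply: eq_bigr => j _; rewrite mxE.
Qed.

Let slice_shift (V : K -> 'M[R]_(m, d)) (k : K) (t : (m * d).-tuple T) :
  (forall i a, (V k *m H) i a - (k (i, a) : nat)%:R / (M (i, a))%:R \is a Num.int) ->
  slice_set (mx_shift (- V k) t) <-> forall i a,
  frac_part ((tuple_mx t *m H + S) i a - (k (i, a) : nat)%:R / (M (i, a))%:R) < (M (i, a))%:R^-1.
Proof.
move=> hV; have E i a : frac_part ((tuple_mx (mx_shift (- V k) t) *m H + S) i a) =
    frac_part ((tuple_mx t *m H + S) i a - (k (i, a) : nat)%:R / (M (i, a))%:R).
  apply: frac_int; rewrite tuple_mx_shift mulmxBl !mxE -rpredN.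
  by have := hV i a; rewrite !mxE; congr (_ \is a Num.int); ring.
by split=> h i a; have := h i a; rewrite E.
Qed.

(** The translates by the [V k] are disjoint, one for each choice of arcs, and equal in measure. The
    entries of [V k] lie in [0, 1), so all translates stay in the cube enlarged by 1. *)
Lemma slice_upper_bound c :
  ((\prod_p (M p)%:R)%:E * lambda (cube c `&` slice_set) <= lambda (cube (c + 1)))%E.
Proof.
have [V hV] := pick_shift.
pose B k := mx_shift (- V k) @^-1` (cube c `&` slice_set).
have mA : measurable (cube c `&` slice_set).
  by apply: measurableI; [exact: measurable_tuple_box|exact: measurable_slice_set].
have mB k : measurable (B k).
  by rewrite -[X in measurable X]setTI; apply: measurable_tuple_shift.
have -> : ((\prod_p (M p)%:R)%:E * lambda (cube c `&` slice_set) = \sum_k lambda (B k))%E.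
  rewrite (eq_bigr (fun=> lambda (cube c `&` slice_set))); last first.
    by move=> k _; exact: lebesgue_shift.
  by rewrite -natr_prod -card_K mule_natl sumr_const.
apply: measure_finType_disjoint => //.
- exact: measurable_tuple_box.
- move=> k t [/cube_tuple_mx h _]; apply/cube_tuple_mx => i j.
  have := h i j; rewrite tuple_mx_shift !mxE; have [/(_ i j) + _] := hV k.
  by lra.
- move=> k l t [_ +] [_ +]; rewrite !slice_shift; [|exact: (hV _).2..].
  move=> hk hl; apply/ffunP => -[i a]; apply/val_inj => /=.
  exact: (frac_step_inj _ _ (hk i a) (hl i a)).
Qed.

(** Here the translates cover, since each form value lies in one of the arcs. The translated piece
    comes from the enlarged cube because a point of [cube c] is moved back by up to 1. *)
Lemma slice_lower_bound c :
  (lambda (cube c) <= (\prod_p (M p)%:R)%:E * lambda (cube (c + 1) `&` slice_set))%E.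
Proof.
have [V hV] := pick_shift.
pose B k := mx_shift (- V k) @^-1` (cube (c + 1) `&` slice_set).
have mA : measurable (cube (c + 1) `&` slice_set).
  by apply: measurableI; [exact: measurable_tuple_box|exact: measurable_slice_set].
have mB k : measurable (B k).
  by rewrite -[X in measurable X]setTI; apply: measurable_tuple_shift.
have -> : ((\prod_p (M p)%:R)%:E * lambda (cube (c + 1) `&` slice_set) = \sum_k lambda (B k))%E.
  rewrite (eq_bigr (fun=> lambda (cube (c + 1) `&` slice_set))); last first.
    by move=> k _; exact: lebesgue_shift.
  by rewrite -natr_prod -card_K mule_natl sumr_const.
apply: measure_finType_cover => //; first exact: measurable_tuple_box.
move=> t /cube_tuple_mx ht.
have /fin_all_exists[k hk] (p : 'I_m * 'I_s) := frac_step_cover ((tuple_mx t *m H + S) p.1 p.2) (M_gt0 p).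
exists (finfun k) => //; split.
  apply/cube_tuple_mx => i j.
  have := ht i j; rewrite tuple_mx_shift !mxE; have [/(_ i j) + _] := hV (finfun k).
  by lra.
rewrite slice_shift; last exact: (hV _).2.
by move=> i a; rewrite ffunE; exact: (hk (i, a)).
Qed.

End slice.
End slices.

(** * Convergence half of the Khintchine-Groshev theorem *)

Section convergence_part.
Context {R : realType} (m d : nat).
Local Notation T := (measurableTypeR R).
Local Notation lambda := (@lebesgue_tuple R (m * d)).
Local Notation cube := (@cube R (m * d)).
Local Notation tuple_mx := (@tuple_mx R m d).

Definition linear_form (L : 'M[R]_(m, d)) (h : 'cV[int]_d) (i : 'I_m) : R :=
  (L *m map_mx intr h) i 0.

Lemma int_vector_onto (h : 'cV[int]_d) (u : 'rV[R]_1) : h != 0 ->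
  exists v : 'rV[R]_d, (forall j, 0 <= v 0 j < 1) /\
    forall a, (v *m map_mx intr h - u) 0 a \is a Num.int.
Proof.
move=> /matrix0Pn[j0 [a0 hj0]].
(* One nonzero entry of h is enough: solve in that coordinate and reduce modulo 1, which changes
   [v h] by an integer. *)
pose v : 'rV[R]_d := \row_j (if j == j0 then frac_part (u 0 0 / (h j0 0)%:~R) else 0).
exists v; split=> [j|a].
  by rewrite mxE; case: ifP => _; rewrite ?lexx ?ltr01// frac_ge0 frac_lt1.
rewrite !ord1 in hj0 *; rewrite !mxE (bigD1 j0)//= big1 => [|j jj0]; last first.
  by rewrite !mxE (negbTE jj0) mul0r.
rewrite !mxE eqxx addr0 /frac_part mulrBl divfK ?intr_eq0// addrAC subrr add0r.
by rewrite rpredN rpredM// intr_int.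
Qed.

Section near_set.
Variables (P : {set 'I_m}) (N M : nat).

Definition box_vector (f : {ffun 'I_d -> 'I_(2 * N).+1}) : 'cV[int]_d :=
  \col_j ((f j : nat)%:Z - N%:Z).

Lemma box_vectorP (h : 'cV[int]_d) : (forall j, `|h j 0| <= N%:Z) ->
  exists f, h = box_vector f.
Proof.
move=> hN; exists [ffun j => inord (absz (h j 0 + N%:Z))].
apply/colP => j; rewrite mxE ffunE inordK; have := hN j; lia.
Qed.

(* The value 1 imposes no condition on the rows outside P. *)
Let rows (p : 'I_m * 'I_1) : nat := if p.1 \in P then M else 1%N.

(** After adding 1 / (3 M), the arc [0, 1 / M) captures every form value within 1 / (3 M) of an
    integer, on either side. *)
Definition near_set : set ((m * d).-tuple T) :=
  \bigcup_f (if box_vector f == 0 then set0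
             else slice_set (map_mx intr (box_vector f)) (const_mx (3 * M%:R)^-1) rows).

Lemma measurable_near_set : measurable near_set.
Proof.
apply: fin_bigcup_measurable => // f _; case: ifP => // _.
exact: measurable_slice_set.
Qed.

Hypothesis M_gt0 : (0 < M)%N.

(** Union bound over the (2 N + 1)^d vectors of the box; each slice has density about M^(-q), with q
    = #|P|. *)
Lemma near_set_bound c :
  ((M%:R ^+ #|P|)%:E * lambda (cube c `&` near_set) <=
   ((2 * N).+1%:R ^+ d)%:E * lambda (cube (c + 1)))%E.
Proof.
pose F f := cube c `&` (if box_vector f == 0 then set0
  else slice_set (map_mx intr (box_vector f)) (const_mx (3 * M%:R)^-1) rows).
have mc : measurable (cube c) by exact: measurable_tuple_box.
have mF f : measurable (F f).
  by rewrite /F; case: ifP => _; apply: measurableI => //; exact: measurable_slice_set.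
have prodM : (\prod_p (rows p)%:R) = M%:R ^+ #|P| :> R.
  rewrite -(pair_bigA _ (fun i (_ : 'I_1) => (if i \in P then M else 1%N)%:R)) /=.
  under eq_bigr do rewrite big_ord1.
  rewrite -prodr_const [RHS]big_mkcond.
  by apply: eq_bigr => i _; case: ifP.
have Fle f : ((M%:R ^+ #|P|)%:E * lambda (F f) <= lambda (cube (c + 1)))%E.
  rewrite /F; case: ifPn => [_|h0]; first by rewrite setI0 measure0 mule0.
  rewrite -prodM; by apply: slice_upper_bound => u; exact: int_vector_onto.
apply: (@le_trans _ _ ((M%:R ^+ #|P|)%:E * \sum_f lambda (F f))%E).
  apply: lee_wpmul2l; first by rewrite lee_fin exprn_ge0.
  apply: measure_finType_cover => //.
    by apply: measurableI => //; exact: measurable_near_set.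
  by move=> t [ct [f _ ft]]; exists f.
rewrite ge0_sume_distrr; last by move=> f _; exact: measure_ge0.
apply: (@le_trans _ _ (\sum_(f : {ffun 'I_d -> 'I_(2 * N).+1}) lambda (cube (c + 1)))%E).
  by apply: lee_sum => f _; exact: Fle.
by rewrite -natrX mule_natl sumr_const card_ffun !card_ord.
Qed.

Lemma near_setP t (h : 'cV[int]_d) (p : 'I_m -> int) : h != 0 ->
  (forall j, `|h j 0| <= N%:Z) ->
  (forall i, i \in P -> `|linear_form (tuple_mx t) h i - (p i)%:~R| * (3 * M%:R) <= 1) ->
  near_set t.
Proof.
move=> h0 /box_vectorP[f hf] tp; exists f => //; rewrite -hf (negbTE h0) => i a.
rewrite ord1 /rows /=; case: ifPn => iP; last by rewrite invr1 frac_lt1.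
rewrite mxE [const_mx _ _ _]mxE; set x := (_ *m _) _ _.
have M0 : 0 < 3 * M%:R :> R by rewrite mulr_gt0// ltr0n.
have := tp i iP; rewrite -ler_pdivlMr// mul1r ler_norml -/x => /andP[h1 h2].
have M1 : (3 * M%:R)^-1 * 3 = (M%:R)^-1 :> R by rewrite invfM mulrAC mulVf ?mul1r.
have M2 : (M%:R)^-1 <= 1 :> R by rewrite invf_le1 ?ltr0n// ler1n.
have M3 : 0 < (3 * M%:R)^-1 :> R by rewrite invr_gt0.
rewrite /linear_form -/x in h1 h2.
rewrite /frac_part (@floor_def _ _ (p i)); rewrite ?intrD; lra.
Qed.

End near_set.
End convergence_part.

(** Cauchy condensation: the terms with 2^k <= i + 1 < 2^(k + 1) contribute at most x^k, where x = 2
    / 2^a < 1. *)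
Lemma p_series_bounded {R : realType} (a : R) : 1 < a ->
  exists2 C : R, 0 <= C & forall n, \sum_(0 <= i < n) (i.+1%:R `^ a)^-1 <= C.
Proof.
move=> a1; pose x : R := 2 / 2 `^ a.
have x0 : 0 < x by rewrite divr_gt0// powR_gt0.
have x1 : x < 1.
  rewrite ltr_pdivrMr ?powR_gt0// mul1r -[X in X < _]powRr1//.
  by rewrite /powR gt_eqF// ltr_expR ltr_pM2r// ln_gt0// ltr1n.
have S0 i : 0 <= (i.+1%:R `^ a)^-1 :> R by rewrite invr_ge0 powR_ge0.
have geo k : \sum_(0 <= l < k) x ^+ l <= (1 - x)^-1.
  elim: k => [|k IH]; first by rewrite big_nil invr_ge0 subr_ge0 ltW.
  rewrite big_nat_recl// expr0 (eq_bigr (fun i => x * x ^+ i)); last first.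
    by move=> i _; rewrite exprS.
  rewrite -mulr_sumr; apply: (@le_trans _ _ (1 + x * (1 - x)^-1)).
    by rewrite lerD2l ler_pM2l.
  by rewrite le_eqVlt; apply/orP; left; apply/eqP; field; rewrite subr_eq0 gt_eqF.
exists (1 - x)^-1; first by rewrite invr_ge0 subr_ge0 ltW.
have H k : \sum_(0 <= i < (2 ^ k).-1) (i.+1%:R `^ a)^-1 <= \sum_(0 <= l < k) x ^+ l.
  elim: k => [|k IH]; first by rewrite !big_nil.
  have k2 : (0 < 2 ^ k)%N by rewrite expn_gt0.
  rewrite (@big_cat_nat _ _ _ (2 ^ k).-1)//=; last by rewrite expnS; lia.
  rewrite big_nat_recr//=; apply: lerD => //.
  apply: (@le_trans _ _ (\sum_((2 ^ k).-1 <= i < (2 ^ k.+1).-1) ((2 ^ k)%:R `^ a)^-1)).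
    apply: ler_sum_nat => i /andP[ki _]; rewrite lef_pV2 ?posrE ?powR_gt0 ?ltr0n//.
    apply: ge0_ler_powR; rewrite ?nnegrE ?ler0n ?ler_nat//; first by lra.
    by lia.
  rewrite sumr_const_nat (_ : (_ - _)%N = 2 ^ k)%N; last by rewrite expnS; lia.
  have pk : (2 ^+ k) `^ a = (2 `^ a) ^+ k :> R.
    by rewrite -[in LHS]powR_mulrn// -[RHS]powR_mulrn ?powR_ge0// -!powRrM mulrC.
  by rewrite -[leLHS]mulr_natl natrX pk /x expr_div_n.
move=> n; apply: le_trans (geo n); apply: le_trans (H n).
have n2 : (n <= (2 ^ n).-1)%N by have := ltn_expl n (isT : (1 < 2)%N); lia.
by rewrite [leRHS](@big_cat_nat _ _ _ n)//= lerDl sumr_ge0.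
Qed.

(** Halving ln 2 pays for j + 1 in place of j, the form in which the p-series is summed. *)
Lemma ler_ln_pow2 {R : realType} (j N : nat) : (0 < j)%N -> (2 ^ j <= N)%N ->
  j.+1%:R * (ln 2 / 2) <= ln N%:R :> R.
Proof.
move=> j0 jN; apply: (@le_trans _ _ (ln (2 ^ j)%:R)); last first.
  have h : (0 < 2 ^ j)%N by rewrite expn_gt0.
  by rewrite ler_ln ?posrE ?ltr0n ?ler_nat// (leq_trans h).
rewrite natrX lnXn// -mulr_natr -natr1.
have : 1 <= j%:R :> R by rewrite ler1n.
have : 0 < ln 2 :> R by rewrite ln_gt0// ltr1n.
by nra.
Qed.

Section convergence_theorem.
Context {R : realType} (m d : nat).
Local Notation T := (measurableTypeR R).
Local Notation lambda := (@lebesgue_tuple R (m * d)).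
Local Notation cube := (@cube R (m * d)).
Variables (P : {set 'I_m}) (e : R).
Hypotheses (P_gt0 : (0 < #|P|)%N) (e_gt0 : 0 < e).
Local Notation q := #|P|.

(** For j > 0, a lower bound of N^d (ln N)^(1 + e) on the dyadic block 2^j <= N < 2^(j + 1), so that
    one set per block controls all N in it. *)
Let Y (j : nat) : R := (2 ^ j)%:R ^+ d * (j.+1%:R * (ln 2 / 2)) `^ (1 + e).

Let ln2_gt0 : 0 < ln 2 :> R. Proof. by rewrite ln_gt0// ltr1n. Qed.

Let Y_gt0 j : 0 < Y j.
Proof. by rewrite mulr_gt0 ?exprn_gt0 ?ltr0n ?expn_gt0// powR_gt0 // mulr_gt0// divr_gt0. Qed.

Let root j : R := Y j `^ (q%:R^-1).

Let rootX j : root j ^+ q = Y j.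
Proof.
rewrite -powR_mulrn ?powR_ge0// -powRrM mulVf ?powRr1 ?ltW//.
by rewrite pnatr_eq0 -lt0n.
Qed.

(** The 3 matches the constant in [near_setP]; the maximum with 1 takes effect only while
    [root j < 3], that is for finitely many j. *)
Let M (j : nat) : nat := maxn 1 (Num.truncn (root j / 3)).

Let M_ge j : root j <= 6 * (M j)%:R.
Proof.
have := truncnS_gt (root j / 3); rewrite -(natr1 (Num.truncn _)).
have : 1 <= (M j)%:R :> R by rewrite ler1n leq_maxl.
have : (Num.truncn (root j / 3))%:R <= (M j)%:R :> R by rewrite ler_nat leq_maxr.
lra.
Qed.

Let M_le j : 3 <= root j -> 3 * (M j)%:R <= root j.
Proof.
move=> h; have h1 : 1 <= root j / 3 by rewrite ler_pdivlMr// mul1r.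
rewrite /M (maxn_idPr _); last by rewrite truncn_gt0.
have : 0 <= root j / 3 by lra.
by move=> /truncn_itv /andP[+ _]; lra.
Qed.

Let F (c j : nat) := cube c%:R `&` @near_set R m d P (2 ^ j.+1) (M j).

Let mF c j : measurable (F c j).
Proof.
by apply: measurableI; [exact: measurable_tuple_box|exact: measurable_near_set].
Qed.

(** The number of vectors, at most 5^d (2^j)^d, cancels against the factor (2^j)^d of [Y j], and
    only the summable (j + 1)^(-(1 + e)) remains. *)
Let F_bound c : exists2 C : R, 0 <= C &
  forall j, (lambda (F c j) <= (C * (j.+1%:R `^ (1 + e))^-1)%:E)%E.
Proof.
have Moo : (lambda (cube (c%:R + 1)) < +oo)%E by rewrite lebesgue_box ltry.
have Mfin : lambda (cube (c%:R + 1)) \is a fin_num.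
  by rewrite ge0_fin_numE ?measure_ge0.
pose v := fine (lambda (cube (c%:R + 1))).
have v0 : 0 <= v by rewrite fine_ge0 ?measure_ge0.
exists (5 ^+ d * v * 6 ^+ q / ((ln 2 / 2) `^ (1 + e))) => [|j].
  by rewrite !mulr_ge0 ?invr_ge0 ?powR_ge0 ?exprn_ge0.
have M0 : (0 < M j)%N by rewrite leq_max.
have := @near_set_bound R m d P (2 ^ j.+1) (M j) c%:R.
rewrite -/(F c j) -(fineK Mfin) -/v.
have Ffin : lambda (F c j) \is a fin_num.
  rewrite ge0_fin_numE ?measure_ge0//; apply: (@le_lt_trans _ _ (lambda (cube c%:R))).
    by apply: le_measure; rewrite ?inE//; [exact: measurable_tuple_box|exact: subIsetl].
  by rewrite lebesgue_box ltry.
rewrite -(fineK Ffin) -!EFinM !lee_fin => h.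
set w := fine _ in h *.
have w0 : 0 <= w by rewrite fine_ge0 ?measure_ge0.
have h2 : Y j * w <= 6 ^+ q * ((2 * 2 ^ j.+1).+1%:R ^+ d * v).
  apply: le_trans (_ : 6 ^+ q * ((M j)%:R ^+ q * w) <= _); last by rewrite ler_wpM2l ?exprn_ge0.
  rewrite mulrA ler_wpM2r// -exprMn -rootX lerXn2r ?nnegrE ?powR_ge0 ?mulr_ge0//.
have h3 : (2 * 2 ^ j.+1).+1%:R ^+ d <= 5 ^+ d * (2 ^ j)%:R ^+ d :> R.
  rewrite -exprMn lerXn2r ?nnegrE ?mulr_ge0// -natrM ler_nat expnS.
  have : (0 < 2 ^ j)%N by rewrite expn_gt0.
  by lia.
have j2 : 0 < (2 ^ j)%:R ^+ d :> R by rewrite exprn_gt0// ltr0n expn_gt0.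
have h4 : Y j * w <= 6 ^+ q * (5 ^+ d * (2 ^ j)%:R ^+ d * v).
  by apply: le_trans h2 _; rewrite ler_wpM2l ?exprn_ge0// ler_wpM2r.
have l2 : 0 <= ln 2 / 2 :> R by rewrite divr_ge0// ltW.
move: h4; rewrite /Y (powRM _ (ler0n _ _) l2).
set A := _.+1%:R `^ _; set B := (_ / 2) `^ _.
have A0 : 0 < A by apply: powR_gt0; rewrite ltr0n.
have B0 : 0 < B by apply: powR_gt0; exact: divr_gt0.
move=> h4; rewrite !ler_pdivlMr//; rewrite -(ler_pM2l j2).
apply: le_trans (_ : (2 ^ j)%:R ^+ d * (A * B) * w <= _).
  by rewrite le_eqVlt; apply/orP; left; apply/eqP; ring.
by apply: le_trans h4 _; rewrite le_eqVlt; apply/orP; left; apply/eqP; ring.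
Qed.

Let limsup_null c : lambda (lim_sup_set (F c)) = 0%E.
Proof.
apply: lim_sup_set_cvg0; first exact: mF.
have e1 : 1 < 1 + e by rewrite ltrDl.
have [C C0 hC] := F_bound c; have [D D0 hD] := p_series_bounded e1.
apply: (@le_lt_trans _ _ (C * D)%:E); last by rewrite ltry.
apply: lime_le; first by apply: is_cvg_nneseries => n _ _; exact: measure_ge0.
apply: nearW => n; apply: (@le_trans _ _ (\sum_(0 <= j < n) (C * (j.+1%:R `^ (1 + e))^-1)%:E)%E).
  by apply: lee_sum => j _; exact: hC.
by rewrite sumEFin lee_fin -mulr_sumr ler_wpM2l.
Qed.

(** Borel-Cantelli on each cube. A general set P of rows is kept because the gaps require singletons
    and the repetitions require all rows. *)
Theorem khintchine_groshev_convergence :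
  {ae lambda, forall t, exists N0 : nat, forall N, (N0 <= N)%N ->
    forall (h : 'cV[int]_d) (p : 'I_m -> int), h != 0 ->
    (forall j, `|h j 0| <= N%:Z) ->
    exists2 i, i \in P & 1 < `|linear_form (tuple_mx t) h i - (p i)%:~R| ^+ q *
      N%:R ^+ d * ln N%:R `^ (1 + e)}.
Proof.
have : lambda.-negligible (\bigcup_c lim_sup_set (F c)).
  apply: negligible_bigcup => c; apply/negligibleP; last exact: limsup_null.
  apply: bigcap_measurable => [|n _]; first by exists 0%N.
  by apply: bigcup_measurable => j _; exact: mF.
move=> /negligibleS; apply => t /=; apply: contra_notP => tF.
have [c ct] := in_cube t.
have : ~ lim_sup_set (F c) t by move=> h; apply: tF; exists c.
move=> /existsNP[n] /not_implyP[_] hn.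
have hnear j : (n <= j)%N -> ~ @near_set R m d P (2 ^ j.+1) (M j) t.
  by move=> nj h; apply: hn; exists j => //; split.
have [j0 hj0] : exists j0, forall j, (j0 <= j)%N -> 3 <= root j.
  pose j0 := Num.truncn (3 ^+ q / (ln 2 / 2) : R).
  exists j0 => j j0j.
  have h : 3 ^+ q <= j.+1%:R * (ln 2 / 2) :> R.
    rewrite -ler_pdivrMr ?divr_gt0//; apply: ltW.
    by apply: (lt_le_trans (truncnS_gt _)); rewrite ler_nat.
  have h1 : 1 <= 3 ^+ q :> R by rewrite exprn_ege1// ler1n.
  rewrite -(ler_pXn2r P_gt0) ?nnegrE ?powR_ge0// rootX /Y.
  apply: (le_trans h); apply: (le_trans (le1r_powR (le_trans h1 h) (_ : 1 <= 1 + e))).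
    by rewrite lerDl ltW.
  by rewrite ler_peMl ?powR_ge0// exprn_ege1// ler1n expn_gt0.
exists (2 ^ (maxn 1 (maxn n j0)))%N => N hN h p h0 hbox.
pose j := trunc_log 2 N.
have N0 : (0 < N)%N by apply: leq_trans hN; rewrite expn_gt0.
have /andP[jN Nj] := trunc_log_bounds (isT : (1 < 2)%N) N0.
have := trunc_log_max (isT : (1 < 2)%N) hN; rewrite -/j in jN Nj *.
rewrite !geq_max => /and3P[j1 nj j0j].
apply: contrapT => hne; apply: (hnear _ nj).
apply: (@near_setP _ _ _ _ _ _ _ t h p) => //; first by rewrite leq_max.
  by move=> i; have := hbox i; lia.
move=> i iP; set x := `|_|; have x0 : 0 <= x by exact: normr_ge0.
have YN : Y j <= N%:R ^+ d * ln N%:R `^ (1 + e).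
  apply: ler_pM; rewrite ?exprn_ge0 ?powR_ge0//.
    by rewrite lerXn2r ?nnegrE// ler_nat.
  apply: ge0_ler_powR; rewrite ?nnegrE.
  - by rewrite addr_ge0// ltW.
  - by rewrite mulr_ge0// divr_ge0// ltW.
  - by rewrite ln_ge0// ler1n.
  - exact: ler_ln_pow2.
have hx : x ^+ q * Y j <= 1.
  rewrite leNgt; apply/negP => hx; apply: hne; exists i => //.
  apply: (lt_le_trans hx); rewrite -mulrA ler_wpM2l// exprn_ge0//.
suff : (x * (3 * (M j)%:R)) ^+ q <= 1 by rewrite expr_le1 ?mulr_ge0.
rewrite exprMn; apply: le_trans hx.
rewrite ler_wpM2l ?exprn_ge0// -rootX lerXn2r ?nnegrE ?mulr_ge0 ?powR_ge0//.
exact/M_le/hj0.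
Qed.

End convergence_theorem.

(** * Totients and close fractions *)

Section totient_average.
Local Open Scope nat_scope.

Lemma totient_leq n : totient n <= n.
Proof.
rewrite totient_count_coprime -[leqRHS]muln1 -[n in leqRHS]subn0 -sum_nat_const_nat.
by apply: leq_sum => d _; exact: leq_b1.
Qed.

(* Gauss' identity sum_{n <= N} n = sum_{d <= N} totient d * floor (N / d), in
   which floor (N / d) <= 3 as soon as d > D. *)
Lemma totient_sum_lower_bound D : D ^ 2 <= \sum_(1 <= q < (4 * D).+1) totient q.
Proof.
set N := 4 * D.
have gauss : \sum_(1 <= n < N.+1) n = \sum_(1 <= d < N.+1) totient d * (N %/ d).
  transitivity (\sum_(1 <= n < N.+1) \sum_(1 <= d < N.+1) (d %| n) * totient d).
    apply: eq_big_nat => n /andP[n0 nN].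
    rewrite -[LHS]sum_totient_dvd -(big_mkord (fun d => d %| n) totient).
    rewrite big_mkcond big_ltn//= dvd0n gtn_eqF// add0n.
    rewrite [RHS](@big_cat_nat _ _ _ n.+1)//= [X in _ + X]big_nat_cond [X in _ + X]big1 ?addn0.
      by apply: eq_bigr => d _; case: ifP; rewrite ?mul1n.
    by move=> d /andP[/andP[nd _] _]; rewrite gtnNdvd.
  rewrite exchange_big_nat/=; apply: eq_bigr => d _.
  by rewrite -big_distrl/= -divn_count_dvd mulnC.
have triangle k : (\sum_(1 <= n < k.+1) n) * 2 = k * k.+1.
  elim: k => [|k IH]; first by rewrite big_nil.
  by rewrite big_nat_recr//= mulnDl IH; lia.
have bound : \sum_(1 <= d < N.+1) totient d * (N %/ d) <=
    \sum_(1 <= d < N.+1) ((d <= D) * N + 3 * totient d).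
  rewrite big_nat_cond [leqRHS]big_nat_cond; apply: leq_sum => d /andP[/andP[d0 _] _].
  have [dD|Dd] := leqP d D.
    rewrite mul1n; apply: leq_trans (leq_addr _ _).
    by apply: leq_trans (leq_divM N d); rewrite mulnC leq_mul2l totient_leq orbT.
  rewrite mul0n add0n mulnC leq_mul2r; apply/orP; right.
  by rewrite -ltnS ltn_divLR// /N ltn_mul2l.
have small : \sum_(1 <= d < N.+1) (d <= D) * N = D * N.
  rewrite (@big_cat_nat _ _ _ D.+1)//=; last by rewrite ltnS /N; lia.
  rewrite (eq_big_nat _ _ (F2 := fun=> N)); last first.
    by move=> d /andP[_]; rewrite ltnS => ->; rewrite mul1n.
  rewrite sum_nat_const_nat subSS subn0 big_nat_cond big1 ?addn0// => d.
  by move=> /andP[/andP[+ _] _]; rewrite ltnNge => /negbTE ->.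
move: bound; rewrite -gauss big_split/= small -big_distrr/=.
move: (triangle N); rewrite /N; set X := \sum_(1 <= n < _) n; set Z := \sum_(1 <= n < _) totient n.
nia.
Qed.

(** With N = 4 D, 32 times the totient sum is at least 2 N^2. The q with 32 [totient q] < N account
    for at most N^2 of it, and each remaining q for at most 32 N. *)
Lemma totient_large_count D : 0 < D ->
  4 * D <= 32 * #|[set q : 'I_(4 * D).+1 | 4 * D <= 32 * totient q]%SET|.
Proof.
move=> D0; set N := 4 * D; set Q := [set q | _]%SET.
have := totient_sum_lower_bound D; rewrite -/N => h.
have : 32 * (D ^ 2) <= 32 * #|Q| * N + N * N; last first.
  by rewrite /N; nia.
apply: (@leq_trans (\sum_(q < N.+1) 32 * totient q)).
  by rewrite -big_distrr leq_mul2l/= -(big_mkord xpredT totient) big_ltn//.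
rewrite (bigID (fun q : 'I_N.+1 => q \in Q))/=; apply: leq_add.
  rewrite -mulnA -sum_nat_const big_distrr /=; apply: leq_sum => q _.
  by rewrite leq_mul2l /= (leq_trans (totient_leq _))// -ltnS.
rewrite big_mkcond big_ord_recl/= muln0 if_same add0n.
rewrite -[X in _ <= X * _]card_ord -sum_nat_const.
apply: leq_sum => q _; case: ifPn => [|//]; rewrite /Q finset.inE -ltnNge => /ltnW.
exact.
Qed.

End totient_average.

(** Write q = a g and q' = b g with g the gcd. The difference is s g with 1 <= |s| <= X / g; each s
    fixes z.1 modulo a, which leaves g choices of z.1, and z.1 determines z.2. *)
Lemma card_close_fractions (q q' X : nat) : (0 < q)%N -> (0 < q')%N ->
  (#|[set z : 'I_q * 'I_q' | (z.1 * q' != z.2 * q)%N &&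
     (`|(z.1 * q')%:Z - (z.2 * q)%:Z| <= X%:Z)%R]%SET| <= 2 * X)%N.
Proof.
move=> q0 q'0; set S := [set z | _]%SET.
pose g := gcdn q q'; have g0 : (0 < g)%N by rewrite gcdn_gt0 q0.
have [a qE] : exists a, q = (a * g)%N by exists (q %/ g)%N; rewrite divnK// dvdn_gcdl.
have [b q'E] : exists b, q' = (b * g)%N by exists (q' %/ g)%N; rewrite divnK// dvdn_gcdr.
have ab : coprime a b.
  by rewrite /coprime -(eqn_pmul2r g0) mul1n muln_gcdl -qE -q'E.
have a0 : (0 < a)%N by move: q0; rewrite qE muln_gt0 => /andP[].
pose s (z : 'I_q * 'I_q') : int := (z.1 * b)%:Z - (z.2 * a)%:Z.
have sE (z : 'I_q * 'I_q') : (z.1 * q')%:Z - (z.2 * q)%:Z = s z * g%:Z.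
  have e1 (n : nat) : (n * q' = n * b * g)%N by rewrite q'E mulnA.
  have e2 (n : nat) : (n * q = n * a * g)%N by rewrite qE mulnA.
  by rewrite /s e1 e2 mulrBl -!PoszM.
(* Mixed-radix code of (|s| - 1, sign of s, [z.1 %/ a]), a number below 2 |s| g <= 2 X. *)
pose f z : nat := (((absz (s z)).-1 * 2 + (0 < s z)%R) * g + z.1 %/ a)%N.
have zS (z : 'I_q * 'I_q') : z \in S -> s z != 0 /\ (absz (s z) * g <= X)%N.
  rewrite finset.inE sE => /andP[h1 h2]; split; last by move: h2; lia.
  apply: contraNneq h1 => h; have := sE z; rewrite h mul0r => /eqP.
  by rewrite subr_eq0 => /eqP[->].
have ca (z : 'I_q * 'I_q') : (z.1 %/ a < g)%N by rewrite ltn_divLR// mulnC -qE.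
rewrite cardE -(size_map f) -[leqRHS](size_iota 0).
apply: uniq_leq_size; last first.
  move=> _ /mapP[z + ->]; rewrite mem_enum mem_iota add0n => /zS[h1 h2].
  apply: leq_trans (_ : (absz (s z) * 2 * g <= _)%N); last by rewrite mulnAC mulnC leq_mul2l.
  apply: leq_trans (_ : ((absz (s z)).-1 * 2 + (0 < s z)%R).+1 * g <= _)%N.
    by rewrite mulSn [ltnRHS]addnC ltn_add2l.
  by rewrite leq_mul2r; apply/orP; right; move: h1; lia.
rewrite map_inj_in_uniq ?enum_uniq// => z w; rewrite !mem_enum => /zS[z0 _] /zS[w0 _] fzw.
have hdiv : (z.1 %/ a = w.1 %/ a)%N.
  by have := congr1 (modn^~ g) fzw; rewrite /f !modnMDl !modn_small.
have hs : s z = s w.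
  have := congr1 (divn^~ g) fzw; rewrite /f !divnMDl// !(divn_small (ca _)).
  by move: z0 w0; lia.
(* Equal s gives a | (x - y) b, hence a | x - y; with equal quotients by a this leaves x = y. *)
have key (x y u v : nat) : (y <= x)%N -> (x * b + v * a = y * b + u * a)%N ->
    (x %/ a = y %/ a)%N -> x = y.
  move=> yx E xy; have : (a %| (x - y) * b)%N.
    rewrite (_ : _ * b = (u - v) * a)%N ?dvdn_mull// !mulnBl.
    by move: E; move: (x * b)%N (y * b)%N (u * a)%N (v * a)%N => A B C D; lia.
  rewrite Gauss_dvdl// => /dvdnP[[|c]] h; first by lia.
  have := divn_eq x a; have := divn_eq y a; have := ltn_pmod x a0; have := ltn_pmod y a0.
  by rewrite xy; nia.
have h1 : (val z.1 = val w.1)%N.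
  have E : (z.1 * b + w.2 * a = w.1 * b + z.2 * a)%N.
    move: hs; rewrite /s.
    by move: (z.1 * b)%N (z.2 * a)%N (w.1 * b)%N (w.2 * a)%N => A B C D; lia.
  have [zw|/ltnW wz] := leqP w.1 z.1; first exact: (key _ _ _ _ zw E).
  by apply/esym; apply: (key _ _ _ _ wz (esym E)).
have h2 : (val z.2 = val w.2)%N.
  apply/eqP; rewrite -(eqn_pmul2r a0); apply/eqP.
  move: hs; rewrite /s h1.
  by move: (w.1 * b)%N (z.2 * a)%N (w.2 * a)%N => A B C; lia.
by case: z w h1 h2 {fzw z0 w0 hdiv hs} => [z1 z2] [w1 w2] /= /val_inj -> /val_inj ->.
Qed.

(** * Sets of reals close to reduced fractions *)

Section farey.
Context {R : realType}.
Local Notation T := (measurableTypeR R).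
Local Notation mu := (@lebesgue_measure R).

(** The condition p <= q x < p + 1 / M, one-sided as for the slices. *)
Definition farey_interval (q M p : nat) : set T :=
  [set` `[p%:R / q%:R : R, p%:R / q%:R + (q%:R * M%:R)^-1[].

Definition farey_set (q M : nat) : set T :=
  \bigcup_(p in [set p : 'I_q | coprime q p]) farey_interval q M p.

Lemma farey_intervalP q M p (x : R) : farey_interval q M p x <->
  p%:R / q%:R <= x < p%:R / q%:R + (q%:R * M%:R)^-1.
Proof. by rewrite /farey_interval /= in_itv. Qed.

Lemma measurable_farey_interval q M p : measurable (farey_interval q M p).
Proof. exact: measurable_itv. Qed.

Lemma measurable_farey_set q M : measurable (farey_set q M).
Proof.
by apply: fin_bigcup_measurable => // p _; exact: measurable_farey_interval.
Qed.

Section bounds.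
Variables (q M : nat).
Hypotheses (q_gt0 : (0 < q)%N) (M_gt0 : (0 < M)%N).

Let qR : 0 < q%:R :> R. Proof. by rewrite ltr0n. Qed.
Let MR : 0 < M%:R :> R. Proof. by rewrite ltr0n. Qed.

Lemma farey_interval_measure p :
  mu (farey_interval q M p) = ((q%:R * M%:R)^-1)%:E.
Proof.
rewrite lebesgue_measure_itv /= lte_fin ltrDl invr_gt0 mulr_gt0//.
by rewrite -EFinB addrAC subrr add0r.
Qed.

Lemma farey_interval_sub p (x : R) : farey_interval q M p x ->
  p%:R <= q%:R * x < p.+1%:R.
Proof.
move=> /farey_intervalP /andP[h1 h2].
rewrite mulrC -ler_pdivrMr// h1 /= -ltr_pdivlMr//; apply: (lt_le_trans h2).
rewrite -natr1 mulrDl lerD2l mul1r lef_pV2 ?posrE ?mulr_gt0//.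
by rewrite ler_peMr ?ler1n// ltW.
Qed.

Lemma farey_set_lower_bound :
  (((totient q)%:R / (q%:R * M%:R))%:E <= mu (farey_set q M))%E.
Proof.
pose B (p : 'I_q) := if coprime q p then farey_interval q M p else set0.
have mB p : measurable (B p).
  by rewrite /B; case: ifP => // _; exact: measurable_farey_interval.
have -> : (((totient q)%:R / (q%:R * M%:R))%:E = \sum_p mu (B p))%E.
  rewrite totient_count_coprime big_mkord natr_sum mulr_suml -sumEFin.
  apply: eq_bigr => p _; rewrite /B; case: ifP => _; last by rewrite mul0r measure0.
  by rewrite mul1r farey_interval_measure.
apply: measure_finType_disjoint => //; first exact: measurable_farey_set.
  by move=> p x; rewrite /B; case: ifP => // cp Ix; exists p.
move=> p p' x; rewrite /B; case: ifP => // _ /farey_interval_sub /andP[h1 h2].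
case: ifP => // _ /farey_interval_sub /andP[h3 h4].
have := le_lt_trans h1 h4; have := le_lt_trans h3 h2; rewrite !ltr_nat !ltnS => h5 h6.
by apply/val_inj/eqP; rewrite /= eqn_leq h5 h6.
Qed.

Lemma farey_set_unit (x : R) : farey_set q M x -> 0 <= x < 1.
Proof.
move=> [p _ /farey_interval_sub /andP[h1 h2]]; apply/andP; split.
  by rewrite -(pmulr_rge0 _ qR); apply: le_trans h1.
rewrite -(ltr_pM2l qR) mulr1; apply: (lt_le_trans h2).
by rewrite ler_nat.
Qed.

End bounds.

(** Put u = q' / M and v = q / M'. Intervals that meet have |p q' - p' q| <= max(u, v), and their
    intersection has measure at most min(u, v) / (q q'). Reducedness and q != q' exclude p q' = p'
    q, so at most 2 max(u, v) pairs meet; max times min is u v, which gives 2 / (M M'). *)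
Lemma farey_set_overlap (q M q' M' : nat) :
  (0 < q)%N -> (0 < M)%N -> (0 < q')%N -> (0 < M')%N -> q != q' ->
  (mu (farey_set q M `&` farey_set q' M') <= (2 / (M%:R * M'%:R))%:E)%E.
Proof.
move=> q0 M0 q'0 M'0 qq'.
have [qR MR q'R M'R] : [/\ 0 < q%:R :> R, 0 < M%:R :> R, 0 < q'%:R :> R & 0 < M'%:R :> R].
  by rewrite !ltr0n.
pose u : R := q'%:R / M%:R; pose v : R := q%:R / M'%:R.
have u0 : 0 < u by rewrite divr_gt0.
have v0 : 0 < v by rewrite divr_gt0.
pose X := Num.truncn (Num.max u v).
have X0 : 0 <= Num.max u v by rewrite le_max ltW.
have /andP[X1 X2] := truncn_itv X0.
pose S := [set z : 'I_q * 'I_q' | (z.1 * q' != z.2 * q)%N &&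
     (`|(z.1 * q')%:Z - (z.2 * q)%:Z| <= X%:Z)%R]%SET.
have cS := card_close_fractions X q0 q'0.
pose B (z : 'I_q * 'I_q') := if z \in S then
  farey_interval q M z.1 `&` farey_interval q' M' z.2 else set0.
have mB z : measurable (B z).
  rewrite /B; case: ifP => // _.
  by apply: measurableI; exact: measurable_farey_interval.
pose w : R := Num.min u v / (q%:R * q'%:R).
have w0 : 0 <= w by rewrite divr_ge0 ?mulr_ge0// ?ltW// lt_min u0.
have Bw z : z \in S -> (mu (B z) <= w%:E)%E.
  rewrite /B => ->; rewrite /w minEle; case: ifP => _.
    apply: (@le_trans _ _ (mu (farey_interval q M z.1))).
      by apply: le_measure; rewrite ?inE; [apply: measurableI| |exact: subIsetl];
        exact: measurable_farey_interval.
    rewrite farey_interval_measure// lee_fin /u le_eqVlt; apply/orP; left; apply/eqP.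
    by field; rewrite !gt_eqF.
  apply: (@le_trans _ _ (mu (farey_interval q' M' z.2))).
    by apply: le_measure; rewrite ?inE; [apply: measurableI| |exact: subIsetr];
      exact: measurable_farey_interval.
  rewrite farey_interval_measure// lee_fin /v le_eqVlt; apply/orP; left; apply/eqP.
  by field; rewrite !gt_eqF.
have cov : farey_set q M `&` farey_set q' M' `<=` \bigcup_z B z.
  move=> x [[p cp Ip] [p' cp' Ip']]; exists (p, p') => //; rewrite /B.
  suff -> : (p, p') \in S by [].
  rewrite finset.inE /=; apply/andP; split.
    apply: contraNneq qq' => E; apply/eqP.
    have h1 : (q %| q')%N.
      by rewrite -(Gauss_dvdr _ cp) E dvdn_mull.
    have h2 : (q' %| q)%N.
      by rewrite -(Gauss_dvdr _ cp') -E dvdn_mull.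
    by apply/eqP; rewrite eqn_dvd h1.
  move: Ip Ip' => /farey_intervalP/andP[h1 h2] /farey_intervalP/andP[h3 h4].
  have h5 := le_lt_trans h1 h4; have h6 := le_lt_trans h3 h2.
  have qq0 : 0 < q%:R * q'%:R :> R by rewrite mulr_gt0.
  have h7 : p%:R * q'%:R - p'%:R * q%:R < v.
    rewrite -(ltr_pM2r qq0) in h5.
    have -> : p%:R * q'%:R = p%:R / q%:R * (q%:R * q'%:R) :> R by field; rewrite gt_eqF.
    have -> : p'%:R * q%:R = p'%:R / q'%:R * (q%:R * q'%:R) :> R by field; rewrite gt_eqF.
    rewrite ltrBlDl; apply: (lt_le_trans h5); rewrite mulrDl lerD2l /v.
    by rewrite le_eqVlt; apply/orP; left; apply/eqP; field; rewrite !gt_eqF.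
  have h8 : p'%:R * q%:R - p%:R * q'%:R < u.
    rewrite -(ltr_pM2r qq0) in h6.
    have -> : p%:R * q'%:R = p%:R / q%:R * (q%:R * q'%:R) :> R by field; rewrite gt_eqF.
    have -> : p'%:R * q%:R = p'%:R / q'%:R * (q%:R * q'%:R) :> R by field; rewrite gt_eqF.
    rewrite ltrBlDl; apply: (lt_le_trans h6); rewrite mulrDl lerD2l /u.
    by rewrite le_eqVlt; apply/orP; left; apply/eqP; field; rewrite !gt_eqF.
  have : `|(p * q')%:Z - (p' * q)%:Z|%:~R < (X.+1%:Z)%:~R :> R.
    apply: le_lt_trans (X2 : Num.max u v < (X.+1%:Z)%:~R); rewrite intr_norm intrB -!pmulrn !natrM ler_norml.
    rewrite le_max lerNl le_max opprB.
    by rewrite (ltW h7) (ltW h8) orbT.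
  by rewrite ltr_int -addn1 PoszD ltzD1.
apply: (@le_trans _ _ (\sum_z mu (B z))%E).
  apply: measure_finType_cover => //.
  by apply: measurableI; exact: measurable_farey_set.
apply: (@le_trans _ _ (\sum_(z in S) w%:E)%E).
  rewrite [leRHS]big_mkcond; apply: lee_sum => z _; case: ifPn => zS; first exact: Bw.
  by rewrite /B (negbTE zS) measure0.
rewrite sumEFin lee_fin sumr_const -[w *+ _]mulr_natr.
apply: (@le_trans _ _ (w * (2 * Num.max u v))).
  rewrite ler_wpM2l//; apply: (@le_trans _ _ (2 * X)%:R); first by rewrite ler_nat.
  by rewrite natrM ler_wpM2l.
have -> : w * (2 * Num.max u v) = 2 * (Num.min u v * Num.max u v) / (q%:R * q'%:R).
  by rewrite /w; ring.
rewrite (_ : Num.min u v * Num.max u v = u * v); last first.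
  by rewrite minEle maxEle; case: ifP => _; rewrite // mulrC.
by rewrite /u /v le_eqVlt; apply/orP; left; apply/eqP; field; rewrite !gt_eqF.
Qed.

End farey.

(* The second moment inequality at t = 1 / ((C + 1) S), S being the sum of the measures. *)
Lemma kochen_stone {dsp : measure_display} {T : measurableType dsp} {R : realType}
    (mu : {measure set T -> \bar R}) {K : finType} (B : K -> set T) (C : R) :
  0 <= C -> (forall k, measurable (B k)) -> (forall k, mu (B k) < +oo)%E ->
  (1 <= \sum_k mu (B k))%E ->
  (forall k l, k != l -> (mu (B k `&` B l) <= C%:E * (mu (B k) * mu (B l)))%E) ->
  (((C + 1)^-1)%:E <= mu (\bigcup_k B k))%E.
Proof.
move=> C0 mB Bfin S1 BC.
pose b k := fine (mu (B k)).
have bE k : mu (B k) = (b k)%:E by rewrite fineK// ge0_fin_numE ?measure_ge0.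
have b0 k : 0 <= b k by rewrite fine_ge0 ?measure_ge0.
pose S := \sum_k b k.
have SE : (\sum_k mu (B k) = S%:E)%E by rewrite -sumEFin; apply: eq_bigr.
have {}S1 : 1 <= S by rewrite -lee_fin -SE.
have S0 : 0 < S by apply: lt_le_trans S1.
have C1 : 0 < C + 1 by rewrite ltr_wpDl.
have SS : (\sum_k \sum_l mu (B k `&` B l) <= ((C + 1) * S ^+ 2)%:E)%E.
  apply: (@le_trans _ _ (\sum_k \sum_l (C * (b k * b l) + (k == l)%:R * b k)%:E)%E).
    apply: lee_sum => k _; apply: lee_sum => l _; have [<-|kl] := eqVneq k l.
      by rewrite setIid bE lee_fin mul1r lerDr !mulr_ge0.
    by rewrite mul0r addr0 !EFinM -!bE; exact: BC.
  under eq_bigr do rewrite sumEFin.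
  rewrite sumEFin lee_fin.
  have -> : \sum_k \sum_l (C * (b k * b l) + (k == l)%:R * b k) = C * S ^+ 2 + S.
    rewrite expr2 /S mulr_suml mulr_sumr -big_split/=; apply: eq_bigr => k _.
    rewrite big_split/= -mulr_sumr -mulr_sumr; congr (_ + _).
    rewrite (bigD1 k)//= eqxx mul1r big1 ?addr0// => l.
    by rewrite eq_sym => /negbTE ->; rewrite mul0r.
  by rewrite mulrDl mul1r lerD2l expr2 ler_peMr// ltW.
have t0 : 0 <= ((C + 1) * S)^-1 by rewrite invr_ge0 mulr_ge0// ltW.
have := second_moment mu mB t0; rewrite SE => h.
have {h} := le_trans h (leeD2l _ (lee_wpmul2l (_ : 0 <= _)%E SS)).
rewrite lee_fin sqr_ge0 => /(_ isT); rewrite -!EFinM.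
have -> : ((C + 1) * S)^-1 ^+ 2 * ((C + 1) * S ^+ 2) = (C + 1)^-1.
  by field; rewrite !gt_eqF.
have -> : 2 * ((C + 1) * S)^-1 * S = (C + 1)^-1 + (C + 1)^-1.
  by field; rewrite !gt_eqF.
by rewrite EFinD leeD2rE.
Qed.

(** * Well approximable matrices form a null or co-null set *)

Section well_approximable.
Context {R : realType} (m d : nat).
Hypothesis m_gt0 : (0 < m)%N.
Local Notation T := (measurableTypeR R).
Local Notation lambda := (@lebesgue_tuple R (m * d)).
Local Notation cube := (@cube R (m * d)).
Local Notation tuple_mx := (@tuple_mx R m d).

Definition approximation (L : 'M[R]_(m, d)) (N : nat) (h : 'cV[int]_d) (p : 'cV[int]_m) (x : R) :=
  [/\ h != 0, forall j, `|h j 0| <= N%:Z &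
    forall i, `|linear_form L h i - (p i 0)%:~R| ^+ m * N%:R ^+ d * ln N%:R <= x].

Definition approximable L N x := exists h p, approximation L N h p x.

(** All constants 1 / (k + 1) are required at once: a rational translation multiplies the constant
    by a fixed factor, so only this version is invariant. *)
Definition well_approximable (L : 'M[R]_(m, d)) :=
  forall k n0 : nat, exists2 N, (n0 <= N)%N & approximable L N k.+1%:R^-1.

Lemma measurable_linear_form h i :
  measurable_fun setT (fun t => linear_form (tuple_mx t) h i).
Proof. exact: measurable_tuple_mxM. Qed.

Lemma measurable_approximable N x :
  measurable [set t : (m * d).-tuple T | approximable (tuple_mx t) N x].
Proof.
rewrite (_ : [set _ | _] = \bigcup_(h : 'cV[int]_d) \bigcup_(p : 'cV[int]_m)
    [set t | approximation (tuple_mx t) N h p x]); last first.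
  apply/seteqP; split => [t [h [p H]]|t [h _ [p _ H]]]; last by exists h, p.
  by exists h => //; exists p.
apply: countable_bigcupT_measurable; first exact: countableP.
move=> h; apply: countable_bigcupT_measurable; first exact: countableP.
move=> p; have [h0|h0] := eqVneq h 0.
  by rewrite (_ : [set _ | _] = set0)// -subset0 => t []; rewrite h0 eqxx.
have [hN|hN] := pselect (forall j, `|h j 0| <= N%:Z); last first.
  by rewrite (_ : [set _ | _] = set0)// -subset0 => t [].
rewrite (_ : [set _ | _] = \bigcap_(i in [set: 'I_m])
    (fun t => `|linear_form (tuple_mx t) h i - (p i 0)%:~R| ^+ m * N%:R ^+ d * ln N%:R)
      @^-1` `]-oo, x]).
  apply: fin_bigcap_measurable => // i _; rewrite -[X in measurable X]setTI.
  suff mf : measurable_fun setT (fun t => `|linear_form (tuple_mx t) h i - (p i 0)%:~R| ^+ m * N%:R ^+ d * ln N%:R).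
    exact: mf.
  apply: measurable_funM => //; apply: measurable_funM => //.
  apply: measurable_funX; apply: measurableT_comp => //.
  by apply: measurable_funB => //; exact: measurable_linear_form.
apply/seteqP; split => [t [_ _ H] i _ /=|t H]; first by rewrite in_itv/= H.
by split => // i; have := H i I; rewrite /= in_itv.
Qed.

Lemma measurable_well_approximable :
  measurable [set t : (m * d).-tuple T | well_approximable (tuple_mx t)].
Proof.
rewrite (_ : [set _ | _] = \bigcap_k \bigcap_n0 \bigcup_(N in [set N | (n0 <= N)%N])
    [set t | approximable (tuple_mx t) N k.+1%:R^-1]).
  apply: bigcapT_measurable => k; apply: bigcapT_measurable => n0.
  by apply: bigcup_measurable => N _; exact: measurable_approximable.
apply/seteqP; split => [t H k _ n0 _|t H k n0].
  by have [N n0N HN] := H k n0; exists N.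
by have [N n0N HN] := H k I n0 I; exists N.
Qed.

Lemma rat_common_denominator (I : finType) (v : I -> rat) :
  exists2 D : nat, (0 < D)%N & forall i, exists z : int, D%:R * ratr (v i) = z%:~R :> R.
Proof.
exists (\prod_i absz (denq (v i)))%N.
  by rewrite prodn_gt0// => i; rewrite absz_gt0 denq_neq0.
move=> i; rewrite (bigD1 i)//= natrM.
exists (numq (v i) * (\prod_(j | j != i) absz (denq (v j)))%N%:Z).
have E : (absz (denq (v i)))%:R = (denq (v i))%:~R :> R.
  by rewrite pmulrn absz_denq.
rewrite E mulrAC intrM -pmulrn; congr (_ * _).
by rewrite /ratr mulrC divfK// intr_eq0 denq_neq0.
Qed.

(** If D clears the denominators of v, then D h, with D p corrected by the integers D v h,
    approximates the translated matrix with D times the error. *)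
Lemma well_approximable_rat_shift (v : 'I_(m * d) -> rat) t :
  well_approximable (tuple_mx t) ->
  well_approximable (tuple_mx (tuple_shift (fun i => ratr (v i)) t)).
Proof.
move=> Wt k n0.
have [D D0 hD] := rat_common_denominator v.
have /choice[z zE] := hD.
(* The total loss: D^m from the errors, D^d from the size D N, and 2 from ln (D N) <= 2 ln N, for
   which N >= D. *)
pose k' := (2 * D ^ (m + d) * k.+1)%N.
have [N hN [h [p [h0 hbox hp]]]] := Wt k' (maxn n0 (maxn D 1)).
move: hN; rewrite !geq_max => /and3P[n0N DN N0].
exists (D * N)%N; first by apply: leq_trans n0N _; rewrite leq_pmull.
pose p' : 'cV[int]_m := \col_i (D%:Z * p i 0 + \sum_j z (mxvec_index i j) * h j 0).
exists (D%:Z *: h), p'; split => [|j|i].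
- apply: contraNneq h0 => /colP H; apply/eqP/colP => j; have := H j.
  by rewrite !mxE => /eqP; rewrite mulf_eq0 => /orP[|/eqP //]; move: D0; lia.
- rewrite mxE normrM; have := hbox j.
  by rewrite -[`|D%:Z|]/(D%:Z) PoszM; move=> H; rewrite ler_wpM2l.
have E : linear_form (tuple_mx (tuple_shift (fun i0 : 'I_(m * d) => ratr (v i0)) t)) (D%:Z *: h) i
    - (p' i 0)%:~R = D%:R * (linear_form (tuple_mx t) h i - (p i 0)%:~R).
  rewrite /linear_form !mxE intrD intrM -pmulrn.
  rewrite [X in _ - (_ + X)](_ : _ = \sum_j D%:R * ratr (v (mxvec_index i j)) * (h j 0)%:~R); last first.
    by rewrite rmorph_sum /=; apply: eq_bigr => j _; rewrite intrM -zE.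
  rewrite mulrBr opprD addrCA [RHS]addrC; congr (_ + _).
  apply/eqP; rewrite subr_eq; apply/eqP.
  rewrite mulr_sumr -big_split; apply: eq_bigr => j _ /=.
  rewrite !mxE tnth_shift intrM -pmulrn; ring.
rewrite E normrM exprMn (ger0_norm (ler0n _ _)) natrM exprMn.
have N1 : 1 <= N%:R :> R by rewrite ler1n.
have lnN0 : 0 <= ln N%:R :> R by rewrite ln_ge0.
have ln2 : ln (D%:R * N%:R) <= 2 * ln N%:R :> R.
  rewrite lnM ?posrE ?ltr0n// mulr_natl mulr2n lerD2r.
  by rewrite ler_ln ?posrE ?ltr0n// ler_nat.
set x := `|_| in hp *; have x0 : 0 <= x by exact: normr_ge0.
have DR : 0 < D%:R :> R by rewrite ltr0n.
apply: (@le_trans _ _ (D%:R ^+ m * x ^+ m * (D%:R ^+ d * N%:R ^+ d) * (2 * ln N%:R))).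
  by rewrite ler_wpM2l// !mulr_ge0 ?exprn_ge0.
apply: (@le_trans _ _ (2 * D%:R ^+ (m + d) * (x ^+ m * N%:R ^+ d * ln N%:R))).
  by rewrite le_eqVlt; apply/orP; left; apply/eqP; rewrite exprD; ring.
have D2 : 0 < 2 * D%:R ^+ (m + d) :> R by rewrite mulr_gt0// exprn_gt0.
rewrite mulrC -ler_pdivlMr//; apply: (le_trans (hp i)).
rewrite -invfM lef_pV2 ?posrE ?ltr0n// ?mulr_gt0 ?ltr0n ?exprn_gt0//.
rewrite -natrX -!natrM ler_nat /k'; move: (D ^ _)%N => A; lia.
Qed.

(** The sets in the hypothesis decrease in k and c0 is uniform, so their intersection still has
    measure at least c0; it consists of well approximable matrices, and [rational_zero_one]
    applies. *)
Theorem well_approximable_full (c : R) (c0 : R) : 0 < c0 ->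
  (forall k, (c0%:E <= lambda (cube c `&`
     \bigcup_(N in [set N | (k <= N)%N]) [set t | approximable (tuple_mx t) N k.+1%:R^-1]))%E) ->
  {ae lambda, forall t, well_approximable (tuple_mx t)}.
Proof.
move=> c00 hV.
pose V k := cube c `&` \bigcup_(N in [set N | (k <= N)%N])
  [set t | approximable (tuple_mx t) N k.+1%:R^-1].
have mc : measurable (cube c) by exact: measurable_tuple_box.
have mV k : measurable (V k).
  apply: measurableI => //; apply: bigcup_measurable => N _.
  exact: measurable_approximable.
have V_dec : {homo V : n k / (n <= k)%N >-> k <= n}%O.
  move=> n k nk; apply/subsetPset => t [ct [N /= kN [h [p [h0 hb hp]]]]].
  split => //; exists N; first exact: leq_trans kN.
  exists h, p; split => // i; apply: (le_trans (hp i)).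
  by rewrite lef_pV2 ?posrE ?ltr0n// ler_nat.
have VW : \bigcap_k V k `<=` cube c `&` [set t | well_approximable (tuple_mx t)].
  move=> t Vt; split; first by have [] := Vt 0%N I.
  move=> k n0; have [_ [N /= kN [h [p [h0 hb hp]]]]] := Vt (maxn k n0) I.
  exists N; first by apply: leq_trans kN; rewrite leq_maxr.
  exists h, p; split => // i; apply: (le_trans (hp i)).
  by rewrite lef_pV2 ?posrE ?ltr0n// ler_nat ltnS leq_maxl.
have mcapV : measurable (\bigcap_k V k) by exact: bigcapT_measurable.
have capV : (c0%:E <= lambda (\bigcap_k V k))%E.
  have cv : lambda (V k) @[k --> \oo] --> lambda (\bigcap_k V k).
    apply: nonincreasing_cvg_mu => //.
    apply: (@le_lt_trans _ _ (lambda (cube c))).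
      by apply: le_measure; rewrite ?inE//; exact: subIsetl.
    by rewrite lebesgue_box ltry.
  rewrite -(cvg_lim _ cv)//; apply: lime_ge; first by apply/cvg_ex; eexists; exact: cv.
  exact: nearW.
have : lambda (~` [set t | well_approximable (tuple_mx t)]) = 0%E.
  apply: (rational_zero_one _ mc); first exact: measurable_well_approximable.
    by move=> v t; exact: well_approximable_rat_shift.
  apply: (@lt_le_trans _ _ c0%:E); first by rewrite lte_fin.
  apply: (le_trans capV); apply: le_measure; rewrite ?inE//.
  by apply: measurableI => //; exact: measurable_well_approximable.
move=> W0; exists (~` [set t | well_approximable (tuple_mx t)]); split => //.
by apply: measurableC; exact: measurable_well_approximable.
Qed.

End well_approximable.

(** Dyadic blocks starting at n + 1 contribute at least c / 2 each. *)
Lemma harmonic_tail {R : realType} (c : R) (n : nat) : 0 < c ->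
  exists J : nat, 1 <= \sum_(j < J | (n < j)%N) c / j%:R.
Proof.
move=> c0; pose a r := (n.+1 * 2 ^ r)%N.
have H r : r%:R / 2 * c <= \sum_(a 0%N <= j < a r) c / j%:R.
  elim: r => [|r IH]; first by rewrite mul0r mul0r sumr_ge0// => j _; rewrite divr_ge0// ltW.
  have a2 : a r.+1 = (a r + a r)%N by rewrite /a expnS; lia.
  have a0 : (0 < a r)%N by rewrite muln_gt0 expn_gt0.
  have ar : (a 0%N <= a r)%N by rewrite leq_mul2l leq_exp2l.
  rewrite (@big_cat_nat _ _ _ (a r))//=; last by rewrite a2 leq_addr.
  rewrite -natr1 mulrDl mulrDl lerD//.
  apply: (@le_trans _ _ (\sum_(a r <= j < a r.+1) c / (a r.+1)%:R)).
    rewrite sumr_const_nat (_ : (_ - _)%N = a r); last by rewrite a2 addnK.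
    rewrite -[leRHS]mulr_natr a2 natrD le_eqVlt; apply/orP; left; apply/eqP; field.
    by rewrite -natrD pnatr_eq0 -lt0n addn_gt0 a0.
  apply: ler_sum_nat => j /andP[j1 j2]; rewrite ler_pM2l// lef_pV2 ?posrE ?ltr0n//.
  - by rewrite ler_nat ltnW.
  - exact: leq_trans j2.
  - exact: leq_trans j1.
pose r := (Num.truncn (2 / c)).+1.
exists (a r); rewrite -(big_mkord (fun j => n < j)%N (fun j => c / j%:R)).
have ar : (a 0%N <= a r)%N by rewrite leq_mul2l leq_exp2l.
rewrite (@big_cat_nat _ _ _ (a 0%N))//= -[leLHS]add0r lerD//.
  by rewrite sumr_ge0// => j _; rewrite divr_ge0// ltW.
rewrite big_mkcond (eq_big_nat _ _ (F2 := fun j => c / j%:R)); last first.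
  by move=> j /andP[+ _]; rewrite /a muln1 => ->.
apply: le_trans (H r).
have := truncnS_gt (2 / c); rewrite -/r ltr_pdivrMr// => h.
by rewrite mulrAC ler_pdivlMr// mul1r ltW.
Qed.

(** An integer substitute for the m-th root of j, since the arc numbers [M j] must be integers. *)
Lemma power_between (m j : nat) : (0 < m)%N ->
  exists u, (j <= u ^ m)%N /\ (u ^ m <= 2 ^ m * j)%N.
Proof.
move=> m0; have [->|j0] := posnP j; first by exists 0%N; rewrite exp0n.
have ex : exists u, (j <= u ^ m)%N.
  by exists j; rewrite -{1}(expn1 j) leq_pexp2l.
case: (ex_minnP ex) => u ju umin; exists u; split => //.
case: u => [|[|u]] in ju umin *.
- by rewrite exp0n.
- by rewrite exp1n muln_gt0 expn_gt0.
apply: (@leq_trans ((2 * u.+1) ^ m)); first by rewrite leq_exp2r//; lia.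
rewrite expnMn leq_mul2l; apply/orP; right; apply: ltnW; rewrite ltnNge.
by apply/negP => /umin; rewrite ltnn.
Qed.

(** * Divergence half: scales, and what a family of events must satisfy *)

Section divergence.
Context {R : realType} (m d : nat).
Hypothesis m_gt0 : (0 < m)%N.
Local Notation T := (measurableTypeR R).
Local Notation lambda := (@lebesgue_tuple R (m * d)).
Local Notation cube := (@cube R (m * d)).
Local Notation tuple_mx := (@tuple_mx R m d).
Variable k : nat.

(** An m-th power, so that its d-th power has an integer m-th root; divisible by 4 for j > 0, as the
    totient count demands; growing by more than 32, which separates good denominators of different
    scales; and with logarithm linear in j. *)
Definition scale (j : nat) : nat := 64 ^ (m * j).

Lemma scale_gt0 j : (0 < scale j)%N. Proof. by rewrite expn_gt0. Qed.

Lemma leq_scale j : (j <= scale j)%N.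
Proof.
apply: (@leq_trans (m * j)); first by rewrite leq_pmull.
by rewrite ltnW// ltn_expl.
Qed.

Lemma scale_sep j j' : (j < j')%N -> (32 * scale j < scale j')%N.
Proof.
move=> jj'; apply: (@leq_trans (scale j.+1)); last by rewrite leq_exp2l// leq_mul2l jj' orbT.
rewrite /scale mulnS expnD ltn_mul2r expn_gt0/=.
by apply: (@leq_trans (64 ^ 1)) => //; rewrite leq_exp2l.
Qed.

(** The factor 64 m comes from ln ([scale j]) = m j ln 64 <= 64 m j, and k + 1 from the constant to
    be reached. *)
Let kappa := (64 * m * k.+1)%N.

(** With N = [scale j], M^m is N^d j up to constants, hence of order N^d ln N: arcs this short are
    good enough for the approximation, while N^d vectors still contribute about 1 / j. *)
Lemma gap_scales : exists2 c : R, 0 < c & exists M : nat -> nat,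
  forall j, (0 < j)%N -> [/\ (0 < M j)%N,
   k.+1%:R * (scale j)%:R ^+ d * ln (scale j)%:R <= (M j)%:R ^+ m :> R &
   c * (M j)%:R ^+ m <= (scale j)%:R ^+ d * j%:R].
Proof.
have /choice[u hu] := fun j => power_between j m_gt0.
have kappa0 : (0 < kappa)%N by rewrite !muln_gt0 m_gt0.
have ck : 0 < (kappa ^ m * 2 ^ m)%:R :> R by rewrite ltr0n muln_gt0 !expn_gt0 kappa0.
exists (kappa ^ m * 2 ^ m)%:R^-1; first by rewrite invr_gt0.
exists (fun j => kappa * 64 ^ (j * d) * u j)%N => j j0.
have [ju uj] := hu j.
have u0 : (0 < u j)%N.
  by case: (u j) ju => //; rewrite exp0n// leqNgt j0.
have ME : ((kappa * 64 ^ (j * d) * u j) ^ m = kappa ^ m * scale j ^ d * u j ^ m)%N.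
  by rewrite !expnMn /scale -!expnM; congr (_ * 64 ^ _ * _)%N; lia.
split; first by rewrite muln_gt0 muln_gt0 kappa0 u0 expn_gt0.
  rewrite -[leRHS]natrX ME.
  have lns : ln (scale j)%:R <= (64 * m * j)%:R :> R.
    rewrite natrX lnXn// -[leLHS]mulr_natr -mulnA [leRHS]natrM ler_wpM2r//.
    by apply: ltW; exact: ln_sublinear.
  apply: (@le_trans _ _ (k.+1%:R * (scale j)%:R ^+ d * (64 * m * j)%:R)).
    by rewrite ler_wpM2l// mulr_ge0 ?exprn_ge0.
  rewrite -natrX -!natrM ler_nat.
  have k1 : (kappa <= kappa ^ m)%N by rewrite -{1}(expn1 kappa) leq_pexp2l.
  apply: (@leq_trans (kappa * scale j ^ d * j)); last by rewrite leq_mul// leq_mul2r k1 orbT.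
  by rewrite /kappa leq_eqVlt; apply/orP; left; apply/eqP; ring.
rewrite -!natrX ME ler_pdivrMl// -!natrM ler_nat.
apply: (@leq_trans (kappa ^ m * scale j ^ d * (2 ^ m * j))); first by rewrite leq_mul2l uj orbT.
by rewrite leq_eqVlt; apply/orP; left; apply/eqP; ring.
Qed.

Let V := \bigcup_(N in [set N | (k <= N)%N])
  [set t : (m * d).-tuple T | approximable (tuple_mx t) N k.+1%:R^-1].

Lemma scale_approximable (M j : nat) (h : 'cV[int]_d) (p : 'cV[int]_m) t :
  (k < j)%N -> (0 < M)%N ->
  k.+1%:R * (scale j)%:R ^+ d * ln (scale j)%:R <= M%:R ^+ m :> R ->
  h != 0 -> (forall l, `|h l 0| <= (scale j)%:Z) ->
  (forall i, `|linear_form (tuple_mx t) h i - (p i 0)%:~R| <= M%:R^-1) -> V t.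
Proof.
move=> kj M0 hM h0 hb hp; exists (scale j) => /=.
  by apply: leq_trans (leq_scale j); exact: ltnW.
exists h, p; split => // i.
have MR : 0 < M%:R ^+ m :> R by rewrite exprn_gt0// ltr0n.
have s0 : 0 <= (scale j)%:R ^+ d * ln (scale j)%:R :> R.
  by rewrite mulr_ge0 ?exprn_ge0// ln_ge0// ler1n scale_gt0.
rewrite -mulrA; apply: (@le_trans _ _ ((M%:R ^+ m)^-1 * ((scale j)%:R ^+ d * ln (scale j)%:R))).
  by rewrite ler_wpM2r// -exprVn lerXn2r ?nnegrE// invr_ge0.
by rewrite ler_pdivrMl// ler_pdivlMr ?ltr0n// mulrC mulrA.
Qed.

(** The common interface of d = 1 and d >= 2. The constant c may depend on k, since the harmonic
    series diverges for every c; C is a parameter because the resulting measure bound has to be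
    uniform in k. *)
Definition good_families (C : R) := exists2 c : R, 0 < c & forall J : nat,
  exists (X : finType) (A : 'I_J -> X -> set ((m * d).-tuple T)),
  [/\ forall j x, measurable (A j x),
      forall j x, A j x `<=` cube 2 `&` V,
      forall j : 'I_J, (k < j)%N -> ((c / (j : nat)%:R)%:E <= \sum_x lambda (A j x))%E &
      forall j x j' x', (j, x) != (j', x') ->
        (lambda (A j x `&` A j' x') <= C%:E * (lambda (A j x) * lambda (A j' x')))%E].

(** [harmonic_tail] supplies J such that the scales between k and J carry total measure at least 1,
    the threshold of [kochen_stone]. *)
Lemma good_families_measure C : 0 <= C -> good_families C ->
  (((C + 1)^-1)%:E <= lambda (cube 2 `&` V))%E.
Proof.
move=> C0 [c c0 hJ]; have [J J1] := harmonic_tail k c0.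
have [X [A [mA AV Asum Aov]]] := hJ J.
have cubefin : (lambda (cube 2) < +oo)%E by rewrite lebesgue_box ltry.
have mc : measurable (cube 2) by exact: measurable_tuple_box.
have mV : measurable (cube 2 `&` V).
  apply: measurableI => //; apply: bigcup_measurable => N _.
  exact: measurable_approximable.
pose B (p : 'I_J * X) := A p.1 p.2.
apply: (@le_trans _ _ (lambda (\bigcup_p B p))); last first.
  apply: le_measure; rewrite ?inE//; first by apply: fin_bigcup_measurable => // p _; exact: mA.
  by move=> t [p _]; exact: AV.
apply: kochen_stone => //.
- by move=> p; exact: mA.
- move=> p; apply: le_lt_trans cubefin; apply: le_measure; rewrite ?inE//; first exact: mA.
  by apply: subset_trans (AV _ _) _; exact: subIsetl.
- rewrite -(pair_bigA _ (fun j x => lambda (A j x)))/=.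
  apply: (@le_trans _ _ (\sum_(j < J | (k < j)%N) (c / (j : nat)%:R)%:E)%E).
    by rewrite sumEFin lee_fin.
  rewrite big_mkcond; apply: lee_sum => j _; case: ifP => [|_]; first exact: Asum.
  by apply: sume_ge0 => x _; exact: measure_ge0.
- by move=> [j x] [j' x']; exact: Aov.
Qed.

End divergence.

(** * Quasi-independence for nonparallel integer vectors *)

Section two_forms.
Context {R : realType} (m d : nat).
Local Notation T := (measurableTypeR R).
Local Notation lambda := (@lebesgue_tuple R (m * d)).
Local Notation cube := (@cube R (m * d)).
Local Notation tuple_mx := (@tuple_mx R m d).

Definition nonparallel (h h' : 'cV[int]_d) :=
  exists j j', h j 0 * h' j' 0 != h j' 0 * h' j 0.

Definition small_set (M : nat) (h : 'cV[int]_d) : set ((m * d).-tuple T) :=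
  cube 2 `&` slice_set (map_mx intr h) 0 (fun=> M).

Let H2 (h h' : 'cV[int]_d) : 'M[R]_(d, 2) :=
  \matrix_(j, a) (if a == 0 then h j 0 else h' j 0)%:~R.

(** Cramer's rule on a nonzero 2 by 2 minor gives two coordinates of v; reducing them modulo 1
    changes [v H2] by integers. *)
Let H2_onto h h' : nonparallel h h' -> forall u : 'rV[R]_2,
  exists v : 'rV[R]_d, (forall j, 0 <= v 0 j < 1) /\
    forall a, (v *m H2 h h' - u) 0 a \is a Num.int.
Proof.
move=> [j [j' hjj']] u.
have D0 : (h j 0 * h' j' 0 - h j' 0 * h' j 0)%:~R != 0 :> R.
  by rewrite intr_eq0 subr_eq0.
rewrite intrB !intrM in D0.
set D := _ - _ in D0.
have jj' : j' != j by apply: contraNneq hjj' => ->; rewrite mulrC.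
pose x : R := (u 0 0 * (h' j' 0)%:~R - u 0 1 * (h j' 0)%:~R) / D.
pose y : R := (u 0 1 * (h j 0)%:~R - u 0 0 * (h' j 0)%:~R) / D.
pose v : 'rV[R]_d := \row_l (if l == j then frac_part x else if l == j' then frac_part y else 0).
exists v; split=> [l|a].
  by rewrite mxE; do 2?case: ifP => _; rewrite ?lexx ?ltr01// frac_ge0 frac_lt1.
have vE : (v *m H2 h h') 0 a = frac_part x * H2 h h' j a + frac_part y * H2 h h' j' a.
  rewrite mxE (bigD1 j)//= (bigD1 j')//= big1 => [|l /andP[lj lj']]; last first.
    by rewrite mxE (negbTE lj) (negbTE lj') mul0r.
  by rewrite addr0; congr (_ * _ + _ * _); rewrite mxE ?eqxx ?(negbTE jj').
rewrite mxE vE [(- u) 0 a]mxE /frac_part.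
rewrite (_ : _ - _ = - ((Num.floor x)%:~R * H2 h h' j a + (Num.floor y)%:~R * H2 h h' j' a)).
  by rewrite rpredN rpredD// rpredM// ?mxE intr_int.
rewrite !mxE; have [a0|a1] : a = 0 \/ a = 1.
  by case: a {vE} => [[|[|]]]// i; [left|right]; exact/val_inj.
- rewrite a0 eqxx.
  have -> : u 0 0 = x * (h j 0)%:~R + y * (h j' 0)%:~R by rewrite /x /y /D; field; exact: D0.
  ring.
- rewrite a1 /=.
  have -> : u 0 1 = x * (h' j 0)%:~R + y * (h' j' 0)%:~R by rewrite /x /y /D; field; exact: D0.
  ring.
Qed.

Lemma measurable_small_set M h : measurable (small_set M h).
Proof.
by apply: measurableI; [exact: measurable_tuple_box|exact: measurable_slice_set].
Qed.

Lemma lebesgue_cube (c : R) : 0 <= c -> lambda (cube c) = ((2 * c) ^+ (m * d))%:E.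
Proof.
move=> c0; rewrite lebesgue_box prodr_const card_ord opprK max_r ?addr_ge0//.
by rewrite mulr2n mulrDl !mul1r.
Qed.

Lemma small_set_ge M h : (0 < M)%N -> h != 0 ->
  (1 <= (M%:R ^+ m)%:E * lambda (small_set M h))%E.
Proof.
move=> M0 h0; apply: (@le_trans _ _ (lambda (cube 1))).
  by rewrite lebesgue_cube// lee_fin mulr1 exprn_ege1// ler1n.
apply: le_trans (@slice_lower_bound R m d 1 (map_mx intr h) 0 (fun=> M) _ _ 1) _ => //.
  by move=> u; exact: int_vector_onto.
rewrite (_ : 1 + 1 = 2)//; first by rewrite prodr_const card_prod !card_ord muln1.
Qed.

(** Both conditions together form a single slice for the matrix with columns h and h', to which the
    tiling bound applies. *)
Lemma small_set_overlap M M' h h' : nonparallel h h' ->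
  ((M%:R ^+ m * M'%:R ^+ m)%:E * lambda (small_set M h `&` small_set M' h') <=
   (6 ^+ (m * d))%:E)%E.
Proof.
move=> hh'.
pose MM (p : 'I_m * 'I_2) := if p.2 == 0 then M else M'.
have -> : M%:R ^+ m * M'%:R ^+ m = \prod_p (MM p)%:R :> R.
  rewrite -(pair_bigA _ (fun i (a : 'I_2) => (MM (i, a))%:R))/=.
  under eq_bigr do rewrite !big_ord_recl big_ord0 /MM /= mulr1.
  by rewrite prodr_const card_ord exprMn.
have -> : (6 ^+ (m * d))%:E = lambda (cube (2 + 1)).
  by rewrite lebesgue_cube ?addr_ge0//; congr (_ ^+ _)%:E; ring.
apply: le_trans (@slice_upper_bound R m d 2 (H2 h h') 0 MM (H2_onto hh') 2).
apply: lee_wpmul2l; first by rewrite lee_fin prodr_ge0.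
apply: le_measure; rewrite ?inE.
- by apply: measurableI; exact: measurable_small_set.
- by apply: measurableI; [exact: measurable_tuple_box|exact: measurable_slice_set].
move=> t [[ct ht] [_ ht']]; split => // i a; rewrite /MM /=.
have E (g : 'cV[int]_d) : (forall j, H2 h h' j a = (g j 0)%:~R) ->
    (tuple_mx t *m H2 h h' + 0) i a = (tuple_mx t *m map_mx intr g + 0) i 0.
  by move=> hg; rewrite !mxE; congr (_ + _); apply: eq_bigr => j _; rewrite hg [map_mx _ _ _ _]mxE.
case: ifP => a0.
  by rewrite (E h); [exact: ht|move=> j; rewrite mxE a0].
by rewrite (E h'); [exact: ht'|move=> j; rewrite mxE a0].
Qed.

(** Each set has measure at least M^(-m), resp. M'^(-m), and the intersection at most 6^(m d) times
    the product of these two; 6^(m d) is the volume of [cube 3], the enlargement of [cube 2]. *)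
Lemma small_set_quasi_independent M M' h h' :
  (0 < M)%N -> (0 < M')%N -> h != 0 -> h' != 0 -> nonparallel h h' ->
  (lambda (small_set M h `&` small_set M' h') <=
   (6 ^+ (m * d))%:E * (lambda (small_set M h) * lambda (small_set M' h')))%E.
Proof.
move=> M0 M'0 h0 h'0 hh'.
have fin (B : set _) : measurable B -> B `<=` cube 2 -> lambda B = (fine (lambda B))%:E.
  move=> mB Bc; rewrite fineK// ge0_fin_numE ?measure_ge0//.
  apply: (@le_lt_trans _ _ (lambda (cube 2))); last by rewrite lebesgue_box ltry.
  by apply: le_measure; rewrite ?inE//; exact: measurable_tuple_box.
have mS := measurable_small_set.
have Fa := fin _ (mS M h) (@subIsetl _ _ _).
have Fb := fin _ (mS M' h') (@subIsetl _ _ _).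
have Fc := fin _ (measurableI _ _ (mS M h) (mS M' h')) (subset_trans (@subIsetl _ _ _) (@subIsetl _ _ _)).
have := small_set_ge M0 h0; have := small_set_ge M'0 h'0.
have := small_set_overlap M M' hh'.
rewrite {}Fa {}Fb {}Fc -!EFinM !lee_fin; set a := fine _; set b := fine _; set c := fine _.
have : 0 < M%:R ^+ m :> R by rewrite exprn_gt0// ltr0n.
have : 0 < M'%:R ^+ m :> R by rewrite exprn_gt0// ltr0n.
have : 0 < 6 ^+ (m * d) :> R by rewrite exprn_gt0.
move: (6 ^+ _) (M%:R ^+ _) (M'%:R ^+ _) => w x y w0 y0 x0 h1 h2 h3.
have h4 : 1 <= (x * c) * (y * b) by rewrite -[leLHS]mul1r; apply: ler_pM.
rewrite -(ler_pM2l (mulr_gt0 x0 y0)); apply: (le_trans h1).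
rewrite -[leLHS]mulr1 (_ : _ * (_ * _) = w * ((x * c) * (y * b))); last by ring.
by rewrite ler_pM2l.
Qed.

End two_forms.

(** * Counting good denominators and coprime pairs *)

Section good_pairs.
Variables (N n : nat).
Hypothesis Nn : (N <= n)%N.

(* The average order of the totient makes a positive proportion of q <= N good. *)
Definition good_denominator (q : nat) :=
  [&& (0 < q)%N, (q <= N)%N & (N <= 32 * totient q)%N].

Definition good_pair (q p : nat) := [&& good_denominator q, (p < q)%N & coprime q p].

Lemma card_good_denominator : (0 < N)%N -> (4 %| N)%N ->
  (N <= 32 * #|[set q : 'I_n.+1 | good_denominator q]%SET|)%N.
Proof.
move=> N0 /dvdnP[D ND].
have D0 : (0 < D)%N by move: N0; rewrite ND muln_gt0 => /andP[].
have := totient_large_count D0; rewrite -[(4 * D)%N]mulnC -ND => h; apply: (leq_trans h).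
rewrite leq_mul2l/=.
have NN : (N.+1 <= n.+1)%N by rewrite ltnS.
have winj : injective (widen_ord NN) by move=> x y /(congr1 val) /= /val_inj.
rewrite -(card_imset _ winj); apply: subset_leq_card.
apply/fintype.subsetP => _ /imsetP[q + ->]; rewrite !finset.inE /good_denominator /= => hq.
rewrite leq_ord hq andbT; case: (posnP q) => // q0.
by move: hq; rewrite q0 muln0 leqn0 eqn0Ngt N0.
Qed.

(** 1024 is 32 squared: at least N / 32 good denominators q, each with [totient q] >= N / 32
    numerators. *)
Lemma card_good_pair : (0 < N)%N -> (4 %| N)%N ->
  (N ^ 2 <= 1024 * #|[set z : 'I_n.+1 * 'I_n.+1 | good_pair z.1 z.2]%SET|)%N.
Proof.
move=> N0 N4; have h := card_good_denominator N0 N4.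
apply: (@leq_trans (32 * (#|[set q : 'I_n.+1 | good_denominator q]%SET| * N))).
  by rewrite mulnA expnS expn1 leq_mul2r h orbT.
rewrite (_ : 1024 = 32 * 32)%N// -mulnA leq_mul2l/= -[X in (_ <= 32 * X)%N]sum1_card.
rewrite (eq_bigl (fun z : 'I_n.+1 * 'I_n.+1 => good_denominator z.1 &&
  (((z.2 : nat) < z.1)%N && coprime z.1 z.2))); last by move=> z; rewrite finset.inE.
rewrite -(pair_big_dep (fun q : 'I_n.+1 => good_denominator q)
  (fun q p : 'I_n.+1 => ((p : nat) < q)%N && coprime q p) (fun _ _ => 1%N))/=.
rewrite -sum_nat_const big_distrr /= [leqRHS](eq_bigl (fun q => q \in [set q : 'I_n.+1 | good_denominator q]%SET)); last first.
  by move=> q; rewrite finset.inE.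
apply: leq_sum => q; rewrite finset.inE => /and3P[_ qN /leq_trans]; apply.
rewrite leq_mul2l /= totient_count_coprime big_mkord.
rewrite (big_ord_widen n.+1 (fun p => nat_of_bool (coprime q p))); last exact: ltnW.
rewrite big_mkcond/= [leqRHS]big_mkcond/=; apply: leq_sum => p _.
by case: ifP => //= _; case: ifP.
Qed.

Lemma card_leq_ord : #|[pred y : 'I_n.+1 | (y <= N)%N]| = N.+1.
Proof.
rewrite -sum1_card (eq_bigl (fun i : 'I_n.+1 => (i < N.+1)%N))//.
rewrite -(big_ord_widen n.+1 (fun=> 1%N)); last by rewrite ltnS.
by rewrite sum1_card card_ord.
Qed.

End good_pairs.

(** A good denominator satisfies N / 32 <= q <= N, and successive scales differ by a factor above
    32. *)
Lemma good_denominator_scale m j j' q : (0 < m)%N ->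
  good_denominator (scale m j) q -> good_denominator (scale m j') q -> j = j'.
Proof.
move=> m0; have H i i' : good_denominator (scale m i) q ->
    good_denominator (scale m i') q -> (i < i')%N -> False.
  move=> /and3P[_ qi _] /and3P[_ _ hi'] /(scale_sep m0).
  apply/negP; rewrite -leqNgt; apply: (leq_trans hi'); rewrite leq_mul2l/=.
  exact: leq_trans (totient_leq q) qi.
move=> g g'; case: (ltngtP j j') => // jj'; first by have := H _ _ g g' jj'.
by have := H _ _ g' g jj'.
Qed.

(** * Families of vectors for d >= 2 *)

Section two_columns.
Context {R : realType} (m e k : nat).
Hypothesis m_gt0 : (0 < m)%N.
Let d := (2 + e)%N.
Local Notation T := (measurableTypeR R).
Local Notation lambda := (@lebesgue_tuple R (m * d)).
Local Notation cube := (@cube R (m * d)).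

(* The vectors (q, p, h_3, ..., h_d) with q good, p < q and q, p coprime are
   pairwise nonparallel. *)
Let X n : finType := ('I_n.+1 * 'I_n.+1 * {ffun 'I_e -> 'I_n.+1})%type.

Let vec n (x : X n) : 'cV[int]_d :=
  \col_l match fintype.split l with
         | inl a => if a == 0 then (x.1.1 : nat)%:Z else (x.1.2 : nat)%:Z
         | inr b => (x.2 b : nat)%:Z end.

Let sel n N (x : X n) := good_pair N x.1.1 x.1.2 && [forall b, (x.2 b <= N)%N].

Let card_sel n N : (N <= n)%N -> (0 < N)%N -> (4 %| N)%N ->
  (N ^ d <= 1024 * #|[set x : X n | sel N x]%SET|)%N.
Proof.
move=> Nn N0 N4.
have -> : [set x : X n | sel N x]%SET = finset.setX [set z : 'I_n.+1 * 'I_n.+1 | good_pair N z.1 z.2]%SET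
    [set f : {ffun 'I_e -> 'I_n.+1} | f \in ffun_on [pred y : 'I_n.+1 | (y <= N)%N]]%SET.
  apply/setP => -[z f]; rewrite !finset.inE /sel /=; congr (_ && _).
rewrite cardsX mulnA /d expnD leq_mul ?card_good_pair// cardsE card_ffun_on card_ord.
rewrite card_leq_ord//; case: (posnP e) => [->|e0]; first by rewrite !expn0.
by rewrite leq_exp2r.
Qed.

Let vec_bound n N (x : X n) : sel N x -> forall l, `|vec x l 0| <= N%:Z.
Proof.
move=> /andP[/and3P[/and3P[_ qN _] pq _] /forallP hf] l; rewrite mxE.
case: (fintype.split l) => [a|b]; last by have := hf b.
by case: ifP => _ //; apply: leq_trans (ltnW pq) qN.
Qed.

Let vec0 n (x : X n) : vec x (lshift e 0) 0 = (x.1.1 : nat)%:Z.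
Proof. by rewrite mxE -[lshift e 0]/(unsplit (inl _ 0)) unsplitK. Qed.

Let vec1 n (x : X n) : vec x (lshift e 1) 0 = (x.1.2 : nat)%:Z.
Proof. by rewrite mxE -[lshift e 1]/(unsplit (inl _ 1)) unsplitK. Qed.

Let vec2 n (x : X n) b : vec x (rshift 2 b) 0 = (x.2 b : nat)%:Z.
Proof. by rewrite mxE -[rshift 2 b]/(unsplit (inr _ b)) unsplitK. Qed.

Let vec_neq0 n N (x : X n) : sel N x -> vec x != 0.
Proof.
move=> /andP[/and3P[/and3P[q0 _ _] _ _] _]; apply/eqP => /colP /(_ (lshift e 0)).
by rewrite vec0 mxE => -[] h; rewrite h in q0.
Qed.

Let coprime_prop (q p q' p' : nat) : (0 < q)%N -> (0 < q')%N ->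
  coprime q p -> coprime q' p' -> (q * p' = p * q')%N -> q = q'.
Proof.
move=> q0 q'0 cp cp' E; apply/eqP; rewrite eqn_dvd; apply/andP; split.
  by rewrite -(Gauss_dvdr _ cp) -E dvdn_mulr.
by rewrite -(Gauss_dvdl _ cp') E dvdn_mull.
Qed.

(** If all 2 by 2 minors vanish, coprimality forces equal pairs (q, p); the common q > 0 then forces
    the remaining coordinates to agree. *)
Let vec_nonparallel n N N' (x x' : X n) : sel N x -> sel N' x' -> x != x' ->
  nonparallel (vec x) (vec x').
Proof.
move=> /andP[/and3P[/and3P[q0 _ _] _ cp] _] /andP[/and3P[/and3P[q'0 _ _] _ cp'] _] xx'.
have [qq'|qq'] := eqVneq (nat_of_ord x.1.1) (nat_of_ord x'.1.1); last first.
  exists (lshift e 0), (lshift e 1); rewrite !vec0 !vec1; apply: contraNneq qq' => -[E].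
  by apply/eqP; apply: (coprime_prop q0 q'0 cp cp' E).
have [pp'|pp'] := eqVneq (nat_of_ord x.1.2) (nat_of_ord x'.1.2); last first.
  exists (lshift e 0), (lshift e 1); rewrite !vec0 !vec1; apply: contraNneq pp' => -[].
  by rewrite -qq' [RHS]mulnC => /eqP; rewrite eqn_pmul2l// => /eqP ->.
have [b fb] : exists b, x.2 b != x'.2 b.
  apply/existsP; apply: contraNT xx'; rewrite negb_exists => /forallP h.
  move: x x' qq' pp' h {q0 cp q'0 cp'} => [[q p] f] [[q' p'] f'] /= /val_inj -> /val_inj -> h.
  apply/eqP; congr (_, _, _); apply/ffunP => b; apply/eqP; have := h b.
  by rewrite negbK.
exists (lshift e 0), (rshift 2 b); rewrite !vec0 !vec2; apply: contraNneq fb => -[].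
rewrite -qq' [RHS]mulnC => /eqP; rewrite eqn_pmul2l// => /eqP h.
by apply/eqP/val_inj.
Qed.

Lemma good_families_two_columns : @good_families R m d k (6 ^+ (m * d)).
Proof.
have [c c0 [M hM]] := @gap_scales R m d m_gt0 k.
have K0 : 0 < 1024%:R :> R by rewrite ltr0n.
exists (c / 1024%:R); first exact: divr_gt0.
move=> J; pose n := scale m J; exists (X n).
(* One index type, large enough for scale J, serves all scales; vectors not selected at scale j
   carry the empty set. *)
pose A (j : 'I_J) (x : X n) := if (k < j)%N && sel (scale m j) x
  then small_set (R := R) (m := m) (M j) (vec x) else set0.
have scale4 (j : nat) : (0 < j)%N -> (4 %| scale m j)%N.
  move=> j0; rewrite /scale (_ : 64 = 4 * 16)%N// expnMn dvdn_mulr//.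
  by rewrite dvdn_exp// muln_gt0 m_gt0.
exists A; split.
- by move=> j x; rewrite /A; case: ifP => // _; exact: measurable_small_set.
- move=> j x; rewrite /A; case: ifP => [/andP[kj sx] t [ct ht]|_]; last exact: sub0set.
  split => //; have [M0 hM1 _] := hM j (leq_trans (ltn0Sn k) kj).
  apply: (@scale_approximable R m d m_gt0 k (M j) j (vec x)
    (\col_i Num.floor (linear_form (tuple_mx t) (vec x) i))) => //.
  + exact: vec_neq0 sx.
  + exact: vec_bound.
  move=> i; rewrite mxE; have := ht i 0; rewrite addr0 -/(linear_form _ _ _) => /ltW.
  by rewrite -/(frac_part _) ger0_norm// frac_ge0.
- move=> j kj; have [M0 _ hM2] := hM j (leq_trans (ltn0Sn k) kj).
  have Mm : 0 < (M j)%:R ^+ m :> R by rewrite exprn_gt0// ltr0n.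
  (* At least N^d / 1024 vectors are selected, each set has measure at least M^(-m), and
     [gap_scales] bounds N^d / M^m below by c / j. *)
  apply: (@le_trans _ _ (\sum_(x : X n | sel (scale m j) x) (((M j)%:R ^+ m)^-1)%:E)%E); last first.
    rewrite big_mkcond; apply: lee_sum => x _; rewrite /A kj /=; case: ifP => [sx|_]; last exact: measure_ge0.
    have := @small_set_ge R m d (M j) (vec x) M0 (vec_neq0 sx).
    by rewrite -lee_pdivrMl// mule1.
  have cs := @card_sel n (scale m j) _ (scale_gt0 m j) (scale4 _ (leq_trans (ltn0Sn k) kj)).
  rewrite sumEFin lee_fin sumr_const -[leRHS]mulr_natr.
  have jR : 0 < (j : nat)%:R :> R by rewrite ltr0n (leq_trans _ kj).
  rewrite ler_pdivrMr// ler_pdivrMr// -mulrA -mulrA -[leLHS](mulKf (lt0r_neq0 Mm)).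
  rewrite ler_pM2l ?invr_gt0// mulrC; apply: (le_trans hM2).
  have {}cs : (scale m j)%:R ^+ d <= 1024%:R * #|[pred x : X n | sel (scale m j) x]|%:R :> R.
    rewrite -natrX -natrM ler_nat -cardsE; apply: cs.
    by rewrite /n /scale leq_exp2l// leq_mul2l (ltnW (ltn_ord j)) orbT.
  apply: le_trans (ler_wpM2r (ltW jR) cs) _.
  by rewrite le_eqVlt; apply/orP; left; apply/eqP; rewrite -!mulrA mulrCA [j%:R * _]mulrC.
- move=> j x j' x' jx; rewrite /A.
  case: ifPn => [/andP[kj sx]|_]; last by rewrite set0I measure0 mul0e mule0.
  case: ifPn => [/andP[kj' sx']|_]; last by rewrite setI0 measure0 mule0 mule0.
  have [M0 _ _] := hM j (leq_trans (ltn0Sn k) kj).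
  have [M'0 _ _] := hM j' (leq_trans (ltn0Sn k) kj').
  apply: small_set_quasi_independent => //; [exact: vec_neq0 sx|exact: vec_neq0 sx'|].
  apply: (vec_nonparallel sx sx'); apply: contraNneq jx => xx'; rewrite xx' xpair_eqE eqxx andbT.
  rewrite -xx' in sx'; move: sx sx' => /andP[/and3P[g _ _] _] /andP[/and3P[g' _ _] _].
  by apply/eqP/val_inj; exact: good_denominator_scale m_gt0 g g'.
Qed.

End two_columns.

(** * Families of denominators for d = 1 *)

Section one_column.
Context {R : realType} (m k : nat).
Hypothesis m_gt0 : (0 < m)%N.
Local Notation T := (measurableTypeR R).
Local Notation lambda := (@lebesgue_tuple R (m * 1)).
Local Notation cube := (@cube R (m * 1)).

Local Notation mu := (@lebesgue_measure R).

(* For d = 1 any two h are parallel; restricting to reduced fractions restores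
   the quasi-independence. *)
Let F (q M : nat) : set ((m * 1).-tuple T) :=
  [set t | forall i, farey_set q M (tnth t i)].

Let measurable_F q M : measurable (F q M).
Proof. by apply: (@measurable_tuple_pi _ _ (fun=> farey_set q M)) => i; exact: measurable_farey_set. Qed.

Let F_measure (B : set T) (r : R) : measurable B -> mu B = r%:E ->
  lambda [set t | forall i, B (tnth t i)] = (r ^+ m)%:E.
Proof.
move=> mB Br; rewrite (@lebesgue_tuple_box _ _ (fun=> B))//.
by rewrite (eq_bigr (fun=> r%:E))// prodEFin prodr_const card_ord muln1.
Qed.

Let farey_fin (q M : nat) (B : set T) : (0 < q)%N -> (0 < M)%N -> measurable B ->
  B `<=` farey_set q M -> exists2 r, 0 <= r & mu B = r%:E.
Proof.
move=> q0 M0 mB Bq; exists (fine (mu B)); first by rewrite fine_ge0 ?measure_ge0.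
rewrite fineK// ge0_fin_numE ?measure_ge0//.
apply: (@le_lt_trans _ _ (mu [set` `[0 : R, 1[])).
  apply: le_measure; rewrite ?inE//.
  by move=> x /Bq /(farey_set_unit q0 M0); rewrite /= in_itv.
by rewrite lebesgue_measure_itv /= lte_fin ltr01 -EFinB ltry.
Qed.

Let F_lower_bound q M : (0 < q)%N -> (0 < M)%N -> (q <= 32 * totient q)%N ->
  (((32%:R * M%:R) ^- m)%:E <= lambda (F q M))%E.
Proof.
move=> q0 M0 q32; have mF := @measurable_farey_set R q M.
have [r r0 Fr] := farey_fin q0 M0 mF (@subset_refl _ _).
rewrite (F_measure mF Fr) lee_fin -exprVn.
have := @farey_set_lower_bound R q M q0 M0; rewrite Fr lee_fin => h.
rewrite lerXn2r ?nnegrE ?invr_ge0 ?mulr_ge0//.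
apply: le_trans h; have qR : 0 < q%:R :> R by rewrite ltr0n.
have MR : 0 < M%:R :> R by rewrite ltr0n.
rewrite ler_pdivlMr ?mulr_gt0// ler_pdivrMl ?mulr_gt0 ?ltr0n// mulrAC.
by rewrite ler_pM2r// -natrM ler_nat.
Qed.

Let F_overlap q M q' M' : (0 < q)%N -> (0 < M)%N -> (0 < q')%N -> (0 < M')%N ->
  q != q' ->
  (lambda (F q M `&` F q' M') <= ((2 / (M%:R * M'%:R)) ^+ m)%:E)%E.
Proof.
move=> q0 M0 q'0 M'0 qq'.
have mF := measurableI _ _ (@measurable_farey_set R q M) (@measurable_farey_set R q' M').
have [r r0 Fr] := farey_fin q0 M0 mF (@subIsetl _ _ _).
rewrite (_ : _ `&` _ = [set t : (m * 1).-tuple T | forall i,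
    (farey_set q M `&` farey_set q' M') (tnth t i)]); last first.
  by apply/seteqP; split => [t [h h'] i|t h]; [|split => i; have [] := h i].
rewrite (F_measure mF Fr) lee_fin.
have := @farey_set_overlap R q M q' M' q0 M0 q'0 M'0 qq'; rewrite Fr lee_fin => h.
by rewrite lerXn2r ?nnegrE ?divr_ge0 ?mulr_ge0.
Qed.

Let vec (q : nat) : 'cV[int]_1 := const_mx q%:Z.

(** The constant compares the overlap (2 / (M M'))^m with the product of the lower bounds (32
    M)^(-m) and (32 M')^(-m), where 32 comes from q <= 32 [totient q]. *)
Lemma good_families_one_column : @good_families R m 1 k ((2 * 32 * 32) ^+ m).
Proof.
have [c c0 [M hM]] := @gap_scales R m 1 m_gt0 k.
have K0 : 0 < (32 ^+ m * 32%:R) :> R by rewrite mulr_gt0 ?exprn_gt0.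
exists (c / (32 ^+ m * 32%:R)); first exact: divr_gt0.
move=> J; pose n := scale m J; exists 'I_n.+1.
pose A (j : 'I_J) (q : 'I_n.+1) := if (k < j)%N && good_denominator (scale m j) q
  then F q (M j) else set0.
have scale4 (j : nat) : (0 < j)%N -> (4 %| scale m j)%N.
  move=> j0; rewrite /scale (_ : 64 = 4 * 16)%N// expnMn dvdn_mulr//.
  by rewrite dvdn_exp// muln_gt0 m_gt0.
have gd j q : good_denominator (scale m j) q -> (0 < q)%N /\ (q <= 32 * totient q)%N.
  by move=> /and3P[q0 qN Nq]; split => //; exact: leq_trans Nq.
exists A; split.
- by move=> j q; rewrite /A; case: ifP.
- move=> j q; rewrite /A; case: ifP => [/andP[kj gq] t Ft|_]; last exact: sub0set.
  have [M0 hM1 _] := hM j (leq_trans (ltn0Sn k) kj).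
  have [q0 _] := gd _ _ gq.
  split.
    move=> i; have /andP[h1 h2] := farey_set_unit q0 M0 (Ft i).
    by apply/andP; split; lra.
  have /choice[p hp] : forall i, exists p : 'I_q, farey_interval q (M j) p (tuple_mx t i 0).
    by move=> i; rewrite tuple_mxE; have [p _ Ip] := Ft (mxvec_index i 0); exists p.
  apply: (@scale_approximable R m 1 m_gt0 k (M j) j (vec q) (\col_i (p i : nat)%:Z)) => //.
  + by apply/eqP => /colP/(_ 0); rewrite !mxE => -[h]; rewrite h in q0.
  + by move=> l; rewrite mxE; move: gq => /and3P[].
  move=> i; have -> : linear_form (tuple_mx t) (vec q) i = tuple_mx t i 0 * q%:R.
    by rewrite /linear_form mxE big_ord1 [map_mx _ _ _ _]mxE [vec _ _ _]mxE.
  rewrite mxE.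
  have qR : 0 < q%:R :> R by rewrite ltr0n.
  have MR : 0 < (M j)%:R :> R by rewrite ltr0n.
  have /farey_intervalP /andP[h1 h2] := hp i.
  set x := tuple_mx t i 0 in h1 h2 *.
  have h3 : (p i)%:R <= x * q%:R by rewrite -ler_pdivrMr.
  have h4 : x * q%:R < (p i)%:R + (M j)%:R^-1.
    rewrite -ltr_pdivlMr//; apply: (lt_le_trans h2); rewrite mulrDl lerD2l.
    by rewrite invfM mulrC.
  change (`|x * q%:R - (p i : nat)%:R| <= (M j)%:R^-1).
  by rewrite ger0_norm ?subr_ge0// lerBlDl ltW.
- move=> j kj; have [M0 _ hM2] := hM j (leq_trans (ltn0Sn k) kj).
  have Mm : 0 < (M j)%:R ^+ m :> R by rewrite exprn_gt0// ltr0n.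
  apply: (@le_trans _ _ (\sum_(q : 'I_n.+1 | good_denominator (scale m j) q) ((32%:R * (M j)%:R) ^- m)%:E)%E); last first.
    rewrite big_mkcond; apply: lee_sum => q _; rewrite /A kj /=; case: ifP => [gq|_]; last exact: measure_ge0.
    by have [q0 q32] := gd _ _ gq; exact: F_lower_bound.
  rewrite sumEFin lee_fin sumr_const -[leRHS]mulr_natr.
  have jR : 0 < (j : nat)%:R :> R by rewrite ltr0n (leq_trans _ kj).
  have cs : (scale m j)%:R <= 32%:R * #|[pred q : 'I_n.+1 | good_denominator (scale m j) q]|%:R :> R.
    rewrite -natrM ler_nat -cardsE; apply: card_good_denominator; rewrite ?scale_gt0 ?scale4 ?(leq_trans _ kj)//.
    by rewrite /n /scale leq_exp2l// leq_mul2l (ltnW (ltn_ord j)) orbT.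
  rewrite exprMn; set w := #|_|%:R in cs *.
  have K1 : 0 < 32%:R ^+ m :> R by rewrite exprn_gt0// ltr0n.
  rewrite ler_pdivrMr// ler_pdivrMr// -[leLHS](mulKf (lt0r_neq0 Mm)).
  rewrite [leRHS](_ : _ = ((M j)%:R ^+ m)^-1 * (32%:R * w * j%:R)); last first.
    by field; rewrite !lt0r_neq0.
  rewrite ler_pM2l ?invr_gt0// mulrC; apply: (le_trans hM2).
  by rewrite expr1 ler_pM2r.
- move=> j q j' q' jq; rewrite /A.
  case: ifPn => [/andP[kj gq]|_]; last by rewrite set0I measure0 mul0e mule0.
  case: ifPn => [/andP[kj' gq']|_]; last by rewrite setI0 measure0 mule0 mule0.
  have [M0 _ _] := hM j (leq_trans (ltn0Sn k) kj).
  have [M'0 _ _] := hM j' (leq_trans (ltn0Sn k) kj').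
  have [q0 q32] := gd _ _ gq; have [q'0 q'32] := gd _ _ gq'.
  have qq' : (q : nat) != q'.
    apply: contraNneq jq => /val_inj qq'; rewrite -qq' in gq' *.
    by rewrite xpair_eqE eqxx andbT; apply/eqP/val_inj; exact: good_denominator_scale m_gt0 gq gq'.
  apply: le_trans (F_overlap q0 M0 q'0 M'0 qq') _.
  apply: (@le_trans _ _ (((2 * 32 * 32) ^+ m)%:E * (((32%:R * (M j)%:R) ^- m)%:E * ((32%:R * (M j')%:R) ^- m)%:E))%E).
    rewrite -!EFinM lee_fin -!exprVn -!exprMn lerXn2r ?nnegrE ?mulr_ge0 ?invr_ge0 ?mulr_ge0//.
    have MR : 0 < (M j)%:R :> R by rewrite ltr0n.
    have M'R : 0 < (M j')%:R :> R by rewrite ltr0n.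
    by rewrite le_eqVlt; apply/orP; left; apply/eqP; field; rewrite !lt0r_neq0.
  apply: lee_wpmul2l; first by rewrite lee_fin exprn_ge0.
  by apply: lee_pmul; rewrite ?lee_fin ?invr_ge0 ?exprn_ge0 ?mulr_ge0//; exact: F_lower_bound.
Qed.

End one_column.

Theorem khintchine_groshev_divergence (R : realType) (m d : nat) :
  (0 < m)%N -> (0 < d)%N ->
  {ae @lebesgue_tuple R (m * d),
    forall t : (m * d).-tuple (measurableTypeR R), well_approximable (tuple_mx t)}.
Proof.
move=> m0; case: d => [//|[_|e _]].
  apply: (@well_approximable_full R m 1 m0 2 ((2 * 32 * 32) ^+ m + 1)^-1).
    by rewrite invr_gt0 ltr_wpDl// exprn_ge0.
  by move=> k; apply: good_families_measure; rewrite ?exprn_ge0//; exact: good_families_one_column.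
apply: (@well_approximable_full R m e.+2 m0 2 (6 ^+ (m * e.+2) + 1)^-1).
  by rewrite invr_gt0 ltr_wpDl// exprn_ge0.
move=> k; apply: good_families_measure; rewrite ?exprn_ge0//.
exact: (good_families_two_columns e k m0).
Qed.

(** * Gaps and coverings on the circle *)

(** There are as many open cells as points, and the point at 0 lies in none of them, so some cell
    contains no point. *)
Lemma free_interval {R : realType} (K : finType) (tau : K -> R) (k0 : K) :
  tau k0 = 0 -> exists j : 'I_#|K|, forall k,
    ~ ((j : nat)%:R / #|K|%:R < tau k < j.+1%:R / #|K|%:R).
Proof.
move=> tau0; apply: contrapT => /forallNP H.
have /fin_all_exists[f hf] (j : 'I_#|K|) : exists k,
    (j : nat)%:R / #|K|%:R < tau k < j.+1%:R / #|K|%:R.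
  by apply: contrapT => h; apply: (H j) => k hk; apply: h; exists k.
have K0 : (0 < #|K|)%N by apply/card_gt0P; exists k0.
have KR : 0 < #|K|%:R :> R by rewrite ltr0n.
have finj : injective f.
  move=> i j fij; have /andP[h1 h2] := hf i; have /andP[h3 h4] := hf j.
  rewrite -fij in h3 h4; have := lt_trans h1 h4; have := lt_trans h3 h2.
  rewrite !ltr_pM2r ?invr_gt0// !ltr_nat !ltnS => h5 h6.
  by apply/val_inj/eqP; rewrite /= eqn_leq h5 h6.
have fbij : bijective f by apply: inj_card_bij; rewrite // card_ord.
have [g _ fg] := fbij; have /andP[h _] := hf (g k0).
by move: h; rewrite fg tau0 pmulr_llt0 ?invr_gt0// ltNge ler0n.
Qed.

Lemma circle_packing {R : realType} (K : finType) (y : K -> R) (n : nat) (delta : R) :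
  (n < #|K|)%N -> 1 < n%:R * delta ->
  exists k l (p : int), k != l /\ `|y k - y l - p%:~R| < delta.
Proof.
move=> nK ndelta.
have n0 : (0 < n)%N by case: n nK ndelta => // _; rewrite mul0r ltr10.
have nR : 0 < n%:R :> R by rewrite ltr0n.
have /choice[b hb] k : exists b : 'I_n, (b : nat)%:R <= n%:R * frac_part (y k) < b.+1%:R.
  have h0 : 0 <= n%:R * frac_part (y k) by rewrite mulr_ge0// frac_ge0.
  have /andP[h1 h2] := truncn_itv h0.
  have bn : (Num.truncn (n%:R * frac_part (y k)) < n)%N.
    by rewrite -(ltr_nat R); apply: (le_lt_trans h1); rewrite gtr_pMr// frac_lt1.
  by exists (Ordinal bn); rewrite h1.
have /injectivePn[k [l kl bkl]] : ~~ injectiveb b.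
  by apply/injectiveP => /leq_card; rewrite card_ord leqNgt nK.
exists k, l, (Num.floor (y k) - Num.floor (y l)); split => //.
rewrite (_ : _ - _ = frac_part (y k) - frac_part (y l)); last by rewrite /frac_part intrB; ring.
have /andP[h1 h2] := hb k; have /andP[h3 h4] := hb l.
rewrite -bkl in h3 h4.
rewrite -(ltr_pM2l nR) -[X in X * `|_|](ger0_norm (ler0n _ _)) -normrM.
apply: le_lt_trans ndelta; rewrite mulrBr ler_norml.
by move: h1 h2 h3 h4; rewrite -!natr1; move: (_ * _) (_ * _) (_%:R) => A B C; lra.
Qed.

Section gap_cover.
Context {R : realType} (d : nat) (f : 'cV[int]_d -> R).
Hypothesis fB : forall h h' : 'cV[int]_d, f (h - h') = f h - f h'.
Variables (X : nat) (delta : R).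
Hypotheses (X_gt0 : (0 < X)%N) (delta_gt0 : 0 < delta).
Hypothesis sep : forall (h : 'cV[int]_d) (p : int), h != 0 -> (forall j, `|h j 0| < X%:Z) ->
  delta <= `|f h - p%:~R|.

Let f0 : f 0 = 0. Proof. by rewrite -(subrr 0) fB subrr. Qed.
Let fN h : f (- h) = - f h. Proof. by rewrite -sub0r fB f0 sub0r. Qed.
Let fD h h' : f (h + h') = f h + f h'. Proof. by rewrite -[h']opprK fB !fN opprK. Qed.

(** Box and tolerance both scale with n, so that covered points at n and n' add up to a covered
    point at n + n'. *)
Let covered (n : nat) (w : R) := exists (h : 'cV[int]_d) (p : int),
  (forall j, `|h j 0| <= (n * X)%:Z) /\ `|f h - p%:~R - w| <= n%:R * delta.

Let coveredD n n' w w' : covered n w -> covered n' w' -> covered (n + n') (w + w').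
Proof.
move=> [h [p [hn hw]]] [h' [p' [hn' hw']]]; exists (h + h'), (p + p'); split.
  by move=> j; rewrite mxE mulnDl PoszD (le_trans (ler_normD _ _))// lerD.
rewrite fD intrD natrD mulrDl.
rewrite (_ : _ - _ - _ = (f h - p%:~R - w) + (f h' - p'%:~R - w')); last by ring.
by apply: (le_trans (ler_normD _ _)); rewrite lerD.
Qed.

Let covered0 n : covered n 0.
Proof.
exists 0, 0; split => [j|]; first by rewrite mxE.
by rewrite f0 !subr0 normr0 mulr_ge0// ltW.
Qed.

Let coveredW n n' w : (n <= n')%N -> covered n w -> covered n' w.
Proof.
by move=> nn' h; rewrite -(subnKC nn') -[w]addr0; exact: coveredD h (covered0 _).
Qed.

Let covered1 w : `|w| <= delta -> covered 1 w.
Proof.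
by move=> h; exists 0, 0; split => [j|]; rewrite ?mxE// f0 subr0 sub0r normrN mul1r.
Qed.

(** If radius i + 1 added nothing to radius i, the set at radius i would be stable under every step
    of size at most delta and would reach w0 in finitely many steps. *)
Let covered_step n w0 : ~ covered n w0 -> forall i, (i < n)%N ->
  exists2 w, covered i.+1 w & ~ covered i w.
Proof.
move=> nw0 i ilt; apply: contrapT => h.
have sub w : covered i.+1 w -> covered i w.
  by move=> cw; apply: contrapT => ncw; apply: h; exists w.
apply: nw0; apply: coveredW (ltnW ilt) _.
pose k := (Num.truncn (`|w0| / delta)).+1.
have kR : 0 < k%:R :> R by rewrite ltr0n.
have small : `|w0 / k%:R| <= delta.
  rewrite normrM [`|k%:R^-1|]ger0_norm ?invr_ge0// ler_pdivrMr// mulrC -ler_pdivrMr//.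
  by rewrite ltW// truncnS_gt.
suff H l : covered i (l%:R * (w0 / k%:R)).
  by have := H k; rewrite mulrC divfK// lt0r_neq0.
elim: l => [|l IH]; first by rewrite mul0r.
by apply: sub; rewrite -(addn1 i) -(natr1 l) mulrDl mul1r; exact: coveredD IH (covered1 small).
Qed.

(* If w0 is not covered, each radius adds new points; those first covered at
   the radii 2 l, translated by f on the box [0, X)^d, are too many to be
   delta-separated modulo 1. *)
Lemma gap_cover (n : nat) : 1 < (n * X ^ d)%:R * delta -> forall w,
  exists (h : 'cV[int]_d) (p : int), (forall j, `|h j 0| <= (2 * n * X)%:Z) /\
    `|f h - p%:~R - w| <= (2 * n)%:R * delta.
Proof.
move=> ndelta w0; apply: contrapT => nw0.
have step := covered_step (nw0 : ~ covered (2 * n) w0).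
have /fin_all_exists[w hw] (l : 'I_n.+1) : exists w, covered (2 * l) w /\
    ((0 < l)%N -> ~ covered (2 * l).-1 w).
  have [l0|l0] := posnP l; first by exists 0; split; [exact: covered0|rewrite l0].
  have hl : ((2 * l).-1 < 2 * n)%N by have := ltn_ord l; lia.
  have [w c1 c2] := step _ hl; exists w; split => //.
  by move: c1; rewrite prednK// muln_gt0.
pose K : finType := ('I_n.+1 * {ffun 'I_d -> 'I_X})%type.
pose vec (g : {ffun 'I_d -> 'I_X}) : 'cV[int]_d := \col_j (g j : nat)%:Z.
pose y (k : K) := w k.1 + f (vec k.2).
have cK : (n * X ^ d < #|K|)%N.
  by rewrite card_prod card_ffun !card_ord ltn_mul2r expn_gt0 X_gt0 ltnS leqnn.
have vlt g g' j : `|(vec g - vec g') j 0| < X%:Z.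
  by rewrite !mxE; have := ltn_ord (g j); have := ltn_ord (g' j); lia.
(* The factor 2 in the radii leaves room for one more unit: otherwise [w l'] would be covered at
   radius 2 l + 1 <= 2 l' - 1, where by its choice it is not. *)
have wsep (l l' : 'I_n.+1) (h : 'cV[int]_d) (p : int) : (l < l')%N -> (forall j, `|h j 0| <= X%:Z) ->
    ~ (`|f h - p%:~R - (w l' - w l)| <= delta).
  move=> ll' hX hle; have [_ /(_ (leq_ltn_trans (leq0n _) ll'))] := hw l'; apply.
  apply: (@coveredW (2 * l + 1)); first by lia.
  rewrite -(subrK (w l) (w l')) addrC; apply: coveredD (hw l).1 _.
  by exists h, p; split; rewrite ?mul1n ?mul1r.
have [[l g] [[l' g'] [p [kl hp]]]] := circle_packing y cK ndelta.
rewrite /y /= in hp.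
have [ll'|ll'|/val_inj ll'] := ltngtP l l'.
- apply: (@wsep l l' (vec g - vec g') p ll') => [j|]; first exact: ltW.
  by rewrite fB ltW//; apply: le_lt_trans hp; rewrite le_eqVlt; apply/orP; left; apply/eqP; congr `|_|; ring.
- apply: (@wsep l' l (vec g' - vec g) (- p) ll') => [j|]; first exact: ltW.
  rewrite fB ltW//; apply: le_lt_trans hp; rewrite -normrN rmorphN /= le_eqVlt; apply/orP; left; apply/eqP; congr `|_|; ring.
move: hp; rewrite ltNge => /negP; apply.
rewrite (_ : _ - _ = f (vec g - vec g') - p%:~R); last by rewrite fB ll'; ring.
apply: sep => [|j]; last exact: vlt.
apply: contra_neq kl; rewrite ll' => /eqP; rewrite subr_eq0 => /eqP /colP gg'.
by congr (_, _); apply/ffunP => j; have := gg' j; rewrite !mxE => -[] /val_inj.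
Qed.

End gap_cover.

(** * Coordinates on cut and project sets *)

Section cut_project_geometry.
Context {R : realType} (d m : nat).
Local Notation V := 'rV[R]_(d + m).
Variables (L : 'M[R]_(m, d)) (F : {vspace V}) (s : V).

(* The displacement of v from E in the last m coordinates. *)
Definition vertical (v : V) : 'rV[R]_m := rsubmx v - lsubmx v *m L^T.

Lemma verticalD v w : vertical (v + w) = vertical v + vertical w.
Proof. by rewrite /vertical !linearD /= mulmxDl opprD addrACA. Qed.

Lemma verticalZ a v : vertical (a *: v) = a *: vertical v.
Proof. by rewrite /vertical !linearZ /= -scalemxAl scalerBr. Qed.

Lemma verticalN v : vertical (- v) = - vertical v.
Proof. by rewrite -scaleN1r verticalZ scaleN1r. Qed.

Lemma vertical_row_mx x y : vertical (row_mx x y) = y - x *m L^T.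
Proof. by rewrite /vertical row_mxKl row_mxKr. Qed.

Lemma physical_spaceP v : v \in physical_space L <-> vertical v = 0.
Proof.
have E := physical_spaceE L; split.
  move=> vE; have : [set` physical_space L] v by [].
  by rewrite E => -[x _ <-]; rewrite vertical_row_mx subrr.
move=> /eqP; rewrite subr_eq0 => /eqP v0.
suff : [set` physical_space L] v by [].
by rewrite E; exists (lsubmx v) => //; rewrite -v0 hsubmxK.
Qed.

Lemma vertical_decomposition v :
  v = row_mx (lsubmx v) (lsubmx v *m L^T) + row_mx 0 (vertical v).
Proof. by rewrite add_row_mx addr0 /vertical addrC subrK hsubmxK. Qed.

Lemma vertical_continuous i : continuous (fun v : V => vertical v 0 i).
Proof.
have sum_cont (r : seq 'I_d) :
    continuous (fun v : V => \sum_(j <- r) v 0 (lshift m j) * L i j).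
  elim: r => [|j r IH]; first by under eq_fun do rewrite big_nil; exact: cst_continuous.
  under eq_fun do rewrite big_cons.
  have cM : continuous (fun v : V => v 0 (lshift m j) * L i j).
    move=> v; apply: (@continuousM _ _ (fun v : V => v 0 (lshift m j)) (cst (L i j))).
      exact: coord_continuous.
    exact: cst_continuous.
  by move=> v; exact: (@continuousD _ _ _ _ _ v (cM v) (IH v)).
have -> : (fun v : V => vertical v 0 i) =
    (fun v : V => v 0 (rshift d i) - \sum_j v 0 (lshift m j) * L i j).
  by apply/funext => v; rewrite !mxE; congr (_ - _); apply: eq_bigr => j _; rewrite !mxE.
have cV : continuous (fun v : V => v 0 (rshift d i)) by exact: coord_continuous.
by move=> v; exact: (@continuousB _ _ _ _ _ v (cV v) (sum_cont _ v)).
Qed.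

(** [vertical] kills E, so density of E + Z^k says that integer points have dense image in R^m; all
    rows can be prescribed simultaneously. *)
Lemma vertical_dense (a b : 'I_m -> R) : totally_irrational L ->
  (forall i, a i < b i) ->
  exists (h : 'cV[int]_d) (p : 'I_m -> int),
    forall i, a i < (p i)%:~R - linear_form L h i < b i.
Proof.
move=> irr ab.
pose O := [set v : V | forall i, a i < vertical v 0 i < b i].
have oO : open O.
  rewrite openE => v Ov; suff H : \forall w \near v, forall i, a i < vertical w 0 i < b i by exact: H.
  apply: (@filter_forall V 'I_m (fun i w => a i < vertical w 0 i < b i) (nbhs v) _) => i.
  have : open ((fun v : V => vertical v 0 i) @^-1` [set` `]a i, b i[]).
    apply: open_comp; last exact: itv_open.
    by move=> w _; exact: vertical_continuous.
  rewrite openE => /(_ v); rewrite /= in_itv /= => /(_ (Ov i)).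
  by apply: filterS => w; rewrite /= in_itv.
have O0 : O !=set0.
  exists (row_mx 0 (\row_i ((a i + b i) / 2))) => i.
  rewrite vertical_row_mx mul0mx subr0 mxE; have := ab i; lra.
have [v [Ov [e eE [z zZ ev]]]] := irr O O0 oO.
exists (\col_j Num.floor (z 0 (lshift m j))), (fun i => Num.floor (z 0 (rshift d i))) => i.
have := Ov i; rewrite -ev verticalD (physical_spaceP e).1// add0r.
have fl l : (Num.floor (z 0 l))%:~R = z 0 l by apply/eqP; rewrite -intrEfloor; exact: zZ.
set x := _ - _; suff -> : vertical z 0 i = x by [].
rewrite /x /vertical /linear_form !mxE fl; congr (_ - _).
by apply: eq_bigr => j _; rewrite !mxE fl mulrC.
Qed.

Hypotheses (adm : admissible L F) (reg : regular L F s).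

Local Notation E := (physical_space L).
Local Notation proj := (proj_physical L F).

Let EF : (E + F = fullv)%VS. Proof. by have [] := adm. Qed.
Let EF0 : (E :&: F = 0)%VS. Proof. by have [] := adm. Qed.
Let proj_inj : set_inj (@integer_points R (d + m)) proj. Proof. by have [] := adm. Qed.

Lemma proj_physicalD v w : proj (v + w) = proj v + proj w.
Proof. exact: linearD. Qed.

Lemma proj_physicalB v w : proj (v - w) = proj v - proj w.
Proof. exact: linearB. Qed.

Lemma proj_physical_id v : vertical v = 0 -> proj v = v.
Proof. by move=> /physical_spaceP vE; exact: daddv_pi_id. Qed.

Lemma vertical_proj_internal v : vertical (proj_internal L F v) = vertical v.
Proof.
have h : proj v + proj_internal L F v = v by apply: daddv_pi_add => //; rewrite EF memvf.
rewrite -[in RHS]h verticalD (_ : vertical (proj v) = 0) ?add0r//.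
by apply/physical_spaceP; exact: memv_pi.
Qed.

(** [vertical] is unchanged by adding vectors of E and by projecting along E, so only the
    coordinates of the cube survive. *)
Lemma sliceP v : slice L F v <-> forall i, 0 <= vertical v 0 i <= 1.
Proof.
split.
  move=> [w [u [u0 u1] <-] [e /physical_spaceP e0 <-]] i.
  rewrite verticalD e0 addr0 vertical_proj_internal /vertical u0 mul0mx subr0.
  exact: u1.
move=> v01; pose u : V := row_mx 0 (vertical v).
have uE : vertical u = vertical v by rewrite vertical_row_mx mul0mx subr0.
exists (proj_internal L F u).
  by exists u => //; split=> [|i]; rewrite ?row_mxKl// row_mxKr.
exists (v - proj_internal L F u); last by rewrite addrC subrK.
by apply/physical_spaceP; rewrite verticalD verticalN vertical_proj_internal uE subrr.
Qed.

(** Regularity makes v an interior point, which can be pushed both up and down in row i without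
    leaving the slice. *)
Lemma slice_interior v : slice L F v -> shifted_lattice s v ->
  forall i, 0 < vertical v 0 i < 1.
Proof.
move=> Sv sv i; have v01 := (sliceP v).1 Sv i.
have : interior (slice L F) v.
  apply: contrapT => nint; have : (boundary (slice L F) `&` shifted_lattice s) v.
    by split=> //; split=> //; exact: subset_closure.
  by rewrite reg.
move=> /nbhs_ballP[e /= e0 eS].
pose u : V := row_mx 0 (delta_mx 0 i).
have vu a : vertical (v + a *: u) 0 i = vertical v 0 i + a.
  by rewrite verticalD verticalZ vertical_row_mx mul0mx subr0 !mxE !eqxx mulr1.
have near a : `|a| < e -> slice L F (v + a *: u).
  move=> ae; apply: eS; split=> // k l; rewrite /ball/= !mxE opprD addrA subrr add0r normrN.
  rewrite normrM; case: (fintype.split l) => j; rewrite mxE ?normr0 ?mulr0//.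
  by apply: le_lt_trans ae; rewrite ler_piMr// normr_nat; case: (_ && _).
have e2 : `|e / 2| < e by rewrite gtr0_norm ?divr_gt0// gtr_pMr// invf_lt1// ltr1n.
have := (sliceP _).1 (near (e / 2) e2) i; have := (sliceP _).1 (near (- (e / 2)) _) i.
rewrite normrN => /(_ e2); rewrite !vu; lra.
Qed.

Implicit Types h l : 'cV[int]_d.

Definition offset i : R := vertical s 0 i.

(** The integer that brings the point over h to a height in [0, 1). *)
Definition ceiling h i : int := - Num.floor (offset i - linear_form L h i).

Definition height h i : R := frac_part (offset i - linear_form L h i).

Definition int_row h (c : 'I_m -> int) : V :=
  row_mx (\row_j (h j 0)%:~R) (\row_i (c i)%:~R).

Definition lattice_point h : V := int_row h (ceiling h) + s.

(* The lift of a point of Y is determined by its first d coordinates h, up to s. *)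
Definition model_point h : V := proj (lattice_point h).

Lemma vertical_int_row h c i :
  vertical (int_row h c) 0 i = (c i)%:~R - linear_form L h i.
Proof.
rewrite vertical_row_mx !mxE; congr (_ - _).
by rewrite /linear_form !mxE; apply: eq_bigr => j _; rewrite !mxE mulrC.
Qed.

Lemma int_row_integer h c : integer_points (int_row h c).
Proof. by move=> l; rewrite mxE; case: (fintype.split l) => j; rewrite mxE intr_int. Qed.

Lemma int_row_inj h h' c c' : int_row h c = int_row h' c' -> h = h' /\ c =1 c'.
Proof.
move=> /eq_row_mx[/rowP hh' /rowP cc']; split.
  by apply/colP => j; have := hh' j; rewrite !mxE => /intr_inj.
by move=> i; have := cc' i; rewrite !mxE => /intr_inj.
Qed.

Lemma integer_pointsP (z : V) : integer_points z ->
  exists h c, z = int_row h c.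
Proof.
move=> zZ; exists (\col_j Num.floor (z 0 (lshift m j))), (fun i => Num.floor (z 0 (rshift d i))).
have fl (k : 'I_(d + m)) : (Num.floor (z 0 k))%:~R = z 0 k by apply/eqP; rewrite -intrEfloor; exact: zZ.
rewrite -[LHS]hsubmxK; congr row_mx; apply/rowP => j; by rewrite !mxE fl.
Qed.

Lemma vertical_lattice_point h i : vertical (lattice_point h) 0 i = height h i.
Proof.
by rewrite verticalD mxE vertical_int_row /height /frac_part /ceiling rmorphN /= /offset; ring.
Qed.

Lemma shifted_lattice_point h : shifted_lattice s (lattice_point h).
Proof. by exists (int_row h (ceiling h)) => //; exact: int_row_integer. Qed.

Lemma slice_lattice_point h : slice L F (lattice_point h).
Proof.
apply/sliceP => i; rewrite vertical_lattice_point frac_ge0 ltW//.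
exact: frac_lt1.
Qed.

Lemma height_gt0 h i : 0 < height h i.
Proof.
rewrite -vertical_lattice_point.
by have /andP[] := slice_interior (slice_lattice_point h) (shifted_lattice_point h) i.
Qed.

(** Heights are strictly between 0 and 1, so the last coordinates over h are forced; a height of
    exactly 1 would allow a second integer. *)
Lemma slice_shifted_lattice z : slice L F z -> shifted_lattice s z ->
  exists h, z = lattice_point h.
Proof.
move=> Sz zs; have z01 := slice_interior Sz zs.
case: zs z01 {Sz} => [n nZ <-] z01; have [h [c nE]] := integer_pointsP nZ.
exists h; rewrite nE /lattice_point; congr (_ + _); congr row_mx.
apply/rowP => i; rewrite !mxE; congr (_%:~R); have := z01 i.
rewrite nE verticalD mxE vertical_int_row -/(offset i) => hi.
apply/eqP; rewrite -eqr_oppLR eq_sym floor_eq rmorphN intrD rmorphN /=.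
by apply/andP; split; lra.
Qed.

Lemma cut_projectP y : cut_project L F s y <-> exists h, y = model_point h.
Proof.
split=> [[z [Sz zs] <-]|[h ->]].
  by have [h ->] := slice_shifted_lattice Sz zs; exists h.
by exists (lattice_point h) => //; split; [exact: slice_lattice_point|exact: shifted_lattice_point].
Qed.

Lemma proj_shifted_inj z z' : shifted_lattice s z -> shifted_lattice s z' ->
  proj z = proj z' -> z = z'.
Proof.
move=> [n nZ <-] [n' n'Z <-]; rewrite !proj_physicalD => /addIr nn'.
by rewrite (proj_inj _ _ nn') ?inE.
Qed.

Lemma lift_point_point h : lift_point L F s (model_point h) = lattice_point h.
Proof.
rewrite /lift_point; case: xgetP => [z _ [zs zE]|/(_ (lattice_point h))].
  by apply: proj_shifted_inj => //; exact: shifted_lattice_point.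
by case; split => //; exact: shifted_lattice_point.
Qed.

Lemma lattice_pointB h h' : lattice_point h' - lattice_point h =
  int_row (h' - h) (fun i => ceiling h' i - ceiling h i).
Proof.
rewrite /lattice_point opprD addrACA subrr addr0 /int_row opp_row_mx add_row_mx.
by congr row_mx; apply/rowP => j; rewrite !mxE intrB.
Qed.

Definition bounded_by (r : R) l := forall j, `|(l j 0)%:~R| <= r.

Lemma r_patch_point h r :
  r_patch L F s (model_point h) r = [set model_point (h + l) | l in [set l | bounded_by r l]].
Proof.
apply/seteqP; split=> [y [/cut_projectP[h' ->]]|_ [l lr <-]].
  rewrite !lift_point_point lattice_pointB => -[_ hb].
  exists (h' - h); last by rewrite addrC subrK.
  by move=> j; have := hb j; rewrite /int_row row_mxKl mxE ler_norml.
split; first by apply/cut_projectP; exists (h + l).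
rewrite !lift_point_point lattice_pointB; split; first exact: int_row_integer.
by move=> j; rewrite /int_row row_mxKl mxE addrAC subrr add0r -ler_norml; exact: lr.
Qed.

(** Over each l the patch has exactly one point, so the patch seen from its centre is the function
    sending l to the increments of [ceiling]. *)
Definition same_pattern (r : R) h h' := forall l, bounded_by r l ->
  forall i, ceiling (h + l) i - ceiling h i = ceiling (h' + l) i - ceiling h' i.

Lemma pointB h h' : model_point h' - model_point h =
  proj (int_row (h' - h) (fun i => ceiling h' i - ceiling h i)).
Proof. by rewrite /model_point -proj_physicalB lattice_pointB. Qed.

(** Displacements within Y are projections of integer vectors, and injectivity on Z^k recovers both
    l and the increments from them. *)
Lemma patch_equivP r h h' :
  patch_equiv L F s r (model_point h) (model_point h') <-> same_pattern r h h'.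
Proof.
have E g : [set u - model_point g | u in r_patch L F s (model_point g) r] =
    [set proj (int_row l (fun i => ceiling (g + l) i - ceiling g i)) |
       l in [set l | bounded_by r l]].
  rewrite r_patch_point; apply/seteqP; split=> [_ [_ [l lr <-] <-]|_ [l lr <-]].
    by exists l => //; rewrite pointB addrAC subrr add0r.
  by exists (model_point (g + l)); [exists l|rewrite pointB addrAC subrr add0r].
rewrite /patch_equiv !E; split=> [hh' l lr i|hh'].
  have : [set proj (int_row l (fun i => ceiling (h' + l) i - ceiling h' i)) |
       l in [set l | bounded_by r l]] (proj (int_row l (fun i => ceiling (h + l) i - ceiling h i))).
    by rewrite -hh'; exists l.
  move=> [l' l'r] /proj_inj; rewrite !inE => /(_ (int_row_integer _ _) (int_row_integer _ _)).
  by move=> /int_row_inj[-> /(_ i) ->].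
apply/seteqP; split=> [_ [l lr <-]|_ [l lr <-]]; exists l => //;
  by congr (proj (row_mx _ _)); apply/rowP => i; rewrite !mxE hh'.
Qed.

Lemma patch_class_point r h h' :
  patch_class L F s (model_point h) r = patch_class L F s (model_point h') r <-> same_pattern r h h'.
Proof.
have cp g : cut_project L F s (model_point g) by apply/cut_projectP; exists g.
split=> [hh'|/patch_equivP hh'].
  apply/patch_equivP; have : patch_class L F s (model_point h') r (model_point h') by [].
  by rewrite -hh' => -[].
apply/seteqP; split=> y [cy hy]; split=> //; first exact: etrans (esym hh') hy.
exact: etrans hh' hy.
Qed.

Lemma ceiling_floor h l i : ceiling (h + l) i - ceiling h i =
  - Num.floor (height h i - linear_form L l i).
Proof.
have lfD : linear_form L (h + l) i = linear_form L h i + linear_form L l i.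
  by rewrite /linear_form map_mxD mulmxDr mxE.
rewrite /ceiling /height /frac_part lfD opprK addrC.
rewrite (_ : _ - _ - _ = offset i - (linear_form L h i + linear_form L l i) + (- Num.floor (offset i - linear_form L h i))%:~R); last by rewrite rmorphN /=; ring.
by rewrite [in RHS]floorDrz ?intr_int// intrKfloor opprB.
Qed.

End cut_project_geometry.

(** * Equal patches: construction, separation and distance *)

Section patterns.
Context {R : realType} (d m : nat).
Local Notation V := 'rV[R]_(d + m).
Variables (L : 'M[R]_(m, d)) (F : {vspace V}) (s : V).
Hypotheses (adm : admissible L F) (reg : regular L F s).
Implicit Types h l g : 'cV[int]_d.
Local Notation height := (height L s).
Local Notation model_point := (model_point L F s).

Lemma linear_formB h h' i :
  linear_form L (h - h') i = linear_form L h i - linear_form L h' i.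
Proof. by rewrite /linear_form map_mxB mulmxBr !mxE. Qed.

Lemma linear_formD h h' i :
  linear_form L (h + h') i = linear_form L h i + linear_form L h' i.
Proof. by rewrite /linear_form map_mxD mulmxDr !mxE. Qed.

Lemma point_inj h h' : model_point h = model_point h' -> h = h'.
Proof.
move=> /(proj_shifted_inj adm (shifted_lattice_point L s h) (shifted_lattice_point L s h')).
by move=> /addIr /int_row_inj[].
Qed.

Lemma same_patternP r h h' : same_pattern L s r h h' <->
  forall l, bounded_by r l -> forall i,
    Num.floor (height h i - linear_form L l i) = Num.floor (height h' i - linear_form L l i).
Proof.
split=> H l lr i; have := H l lr i; rewrite !ceiling_floor; first by move=> /oppr_inj.
by move=> ->.
Qed.

Lemma heightB h h' i : exists p : int,
  height h i - height h' i = linear_form L (h' - h) i - p%:~R.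
Proof.
exists (Num.floor (offset L s i - linear_form L h i) - Num.floor (offset L s i - linear_form L h' i)).
by rewrite /height /frac_part linear_formB intrB; ring.
Qed.

Lemma floorB_frac (x y : R) : Num.floor (x - y) = Num.floor (x - frac_part y) - Num.floor y.
Proof.
rewrite (_ : x - y = x - frac_part y + (- Num.floor y)%:~R); last first.
  by rewrite /frac_part rmorphN /=; ring.
by rewrite floorDrz ?intr_int// intrKfloor.
Qed.

Lemma floor_same_side (a b x y t : R) : 0 <= a -> b <= 1 -> 0 <= t < 1 ->
  ~ (a < t < b) -> a < x < b -> a < y < b -> Num.floor (x - t) = Num.floor (y - t).
Proof.
move=> a0 b1 /andP[t0 t1] tab /andP[ax xb] /andP[ay yb].
have [ta|ta] := leP t a.
  by rewrite !(@floor_def _ _ 0)//; apply/andP; split; rewrite ?intrD; lra.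
have [bt|bt] := leP b t; last by case: tab; rewrite ta.
by rewrite !(@floor_def _ _ (- 1))//; apply/andP; split; rewrite ?intrD ?rmorphN /=; lra.
Qed.

(** With n = (2 N + 1)^d values L_i l modulo 1, some cell of length 1 / n is free in each row.
    Heights of h and h + g differ by less than 1 / n, so density lets both be placed in that cell,
    for all rows at once. *)
Lemma repetition (r delta : R) (g : 'cV[int]_d) (p : 'I_m -> int) :
  totally_irrational L -> 0 <= r -> g != 0 ->
  (forall i, `|linear_form L g i - (p i)%:~R| < delta) ->
  (2 * r + 1) ^+ d * delta <= 1 ->
  exists h h', [/\ h' - h = g, model_point h <> model_point h' & same_pattern L s r h h'].
Proof.
move=> irr r0 g0 gp rdelta.
pose N := Num.truncn r; have /andP[Nr rN] := truncn_itv r0.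
pose K : finType := {ffun 'I_d -> 'I_(2 * N).+1}.
have cK : #|K| = ((2 * N).+1 ^ d)%N by rewrite card_ffun !card_ord.
have KR : 0 < #|K|%:R :> R by rewrite ltr0n cK expn_gt0.
have [k0 k0E] : exists k0 : K, 0 = box_vector k0.
  by apply: box_vectorP => j; rewrite mxE.
pose tau i (k : K) := frac_part (linear_form L (box_vector k) i).
have tau0 i : tau i k0 = 0.
  by rewrite /tau -k0E /linear_form map_mx0 mulmx0 mxE /frac_part floor0 subrr.
have /choice[J hJ] := fun i => free_interval (tau0 i).
pose theta i := linear_form L g i - (p i)%:~R.
pose n := #|K|.
have thetan i : `|theta i| < n%:R^-1.
  have := gp i; rewrite -/(theta i) => h; rewrite -[_^-1]mul1r ltr_pdivlMr// mulrC.
  apply: lt_le_trans rdelta; apply: (@le_lt_trans _ _ ((2 * r + 1) ^+ d * `|theta i|)).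
    rewrite ler_wpM2r// /n cK natrX lerXn2r ?nnegrE ?addr_ge0 ?mulr_ge0//.
    by rewrite -natr1 natrM lerD2r ler_wpM2l.
  by rewrite ltr_pM2l// exprn_gt0// ltr_wpDl// mulr_ge0.
(* Both w and w - theta must lie in the free cell; the maximum and the minimum treat the two signs
   of theta together. *)
pose a i := (J i : nat)%:R / n%:R + Num.max (theta i) 0.
pose b i := (J i).+1%:R / n%:R + Num.min (theta i) 0.
have nR : 0 < n%:R :> R by [].
have Jn i : (J i).+1%:R / n%:R = (J i : nat)%:R / n%:R + n%:R^-1 :> R.
  by rewrite -natr1 mulrDl mul1r.
have a0 i : 0 <= (J i : nat)%:R / n%:R :> R by rewrite divr_ge0// ltW.
have b1 i : (J i).+1%:R / n%:R <= 1 :> R.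
  by rewrite ler_pdivrMr// mul1r ler_nat.
have ab i : a i - offset L s i < b i - offset L s i.
  rewrite ltrD2r /a /b Jn; have := thetan i; rewrite ltr_norml => /andP[h1 h2].
  by rewrite maxEle minEle; case: ifP => _; lra.
have [h [p' hp']] := vertical_dense irr ab.
pose w i := offset L s i - linear_form L h i + (p' i)%:~R.
have wab i : a i < w i < b i by have := hp' i; rewrite /w => /andP[h1 h2]; apply/andP; split; lra.
have win i : (J i : nat)%:R / n%:R < w i < (J i).+1%:R / n%:R /\
    (J i : nat)%:R / n%:R < w i - theta i < (J i).+1%:R / n%:R.
  have := wab i; rewrite /a /b maxEle minEle => /andP[].
  by case: (leP (theta i) 0) => ht h1 h2; split; apply/andP; split; lra.
have frac_id (x : R) : 0 < x < 1 -> frac_part x = x.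
  move=> /andP[x0 x1]; rewrite /frac_part (@floor_def _ _ 0) ?subr0//.
  by rewrite intrD add0r (ltW x0).
have hE i : height h i = w i.
  rewrite /height (@frac_int _ _ (w i)); last by rewrite /w opprD addrA subrr sub0r rpredN intr_int.
  apply: frac_id; have [/andP[h1 h2] _] := win i.
  by rewrite (le_lt_trans (a0 i) h1) (lt_le_trans h2 (b1 i)).
have h'E i : height (h + g) i = w i - theta i.
  rewrite /height (@frac_int _ _ (w i - theta i)); last first.
    rewrite linear_formD (_ : _ - _ = - (p' i)%:~R - (p i)%:~R).
      by rewrite rpredB ?rpredN ?intr_int.
    by rewrite /w /theta; ring.
  apply: frac_id; have [_ /andP[h1 h2]] := win i.
  by rewrite (le_lt_trans (a0 i) h1) (lt_le_trans h2 (b1 i)).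
exists h, (h + g); split; first by rewrite addrAC subrr add0r.
  move=> /point_inj /eqP; rewrite eq_sym -subr_eq0 addrAC subrr add0r.
  exact/negP.
apply/same_patternP => l lr i; rewrite hE h'E !(floorB_frac _ (linear_form L l i)).
congr (_ - _).
have [k lk] : exists k : K, l = box_vector k.
  apply: box_vectorP => j; have := lr j; rewrite -intr_norm => h1.
  have := le_lt_trans h1 rN; rewrite -[_.+1%:R]/((N.+1%:Z)%:~R) ltr_int.
  by rewrite -(addn1 N) PoszD ltzD1.
have [w1 w2] := win i; rewrite lk.
apply: (@floor_same_side ((J i : nat)%:R / n%:R) ((J i).+1%:R / n%:R)) => //.
  by rewrite frac_ge0 frac_lt1.
exact: hJ.
Qed.

(** If two heights differed by more than 2 eta, a value of L_i l within eta of their midpoint would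
    separate them and the two floors would differ. *)
Lemma separation (r eta : R) h h' : same_pattern L s r h h' ->
  (forall i w, exists l (p : int), bounded_by r l /\
     `|linear_form L l i - p%:~R - w| <= eta) ->
  forall i, `|height h i - height h' i| <= 2 * eta.
Proof.
move=> /same_patternP hh' cover i.
have key (x y : R) : 0 < x < 1 -> 0 < y < 1 ->
    (forall l, bounded_by r l -> Num.floor (x - linear_form L l i) = Num.floor (y - linear_form L l i)) ->
    y - x <= 2 * eta.
  move=> /andP[x0 x1] /andP[y0 y1] H; rewrite leNgt; apply/negP => xy.
  have [l [p [lr hl]]] := cover i ((x + y) / 2).
  have := H l lr; move: hl; rewrite ler_norml => /andP[h1 h2].
  set t := linear_form L l i - p%:~R in h1 h2.
  have E z : Num.floor (z - linear_form L l i) = Num.floor (z - t) - p.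
    rewrite (_ : z - _ = z - t + (- p)%:~R); last by rewrite /t rmorphN /=; ring.
    by rewrite floorDrz ?intr_int// intrKfloor.
  rewrite !E => /addIr.
  rewrite (@floor_def _ (x - t) (- 1)); last by rewrite ?intrD ?rmorphN /=; apply/andP; split; lra.
  by rewrite (@floor_def _ (y - t) 0)//; rewrite ?intrD; apply/andP; split; lra.
have h01 g : 0 < height g i < 1 by rewrite (height_gt0 adm reg) frac_lt1.
rewrite ler_norml; apply/andP; split.
  rewrite lerNl opprB; apply: key => // l lr; exact: hh'.
by apply: key => // l lr; rewrite hh'.
Qed.

(** The difference of two points is the vector of E over h' - h plus the projection of a height
    difference, which is bounded because heights lie in (0, 1). *)
Lemma distance_bounds : exists2 C : R, 0 < C & forall h h',
  (forall j, `|((h' - h) j 0)%:~R| <= euclidean_dist (model_point h) (model_point h') + C) /\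
  forall N : R, 0 <= N -> bounded_by N (h' - h) ->
    euclidean_dist (model_point h) (model_point h') <= C * (N + 1).
Proof.
pose e i : V := proj_physical L F (row_mx 0 (delta_mx 0 i)).
pose C0 := \sum_i \sum_j `|e i 0 j|.
pose C1 := \sum_i \sum_j `|L i j|.
have C00 : 0 <= C0 by rewrite sumr_ge0// => i _; rewrite sumr_ge0.
have C10 : 0 <= C1 by rewrite sumr_ge0// => i _; rewrite sumr_ge0.
have diff h h' : exists u : V, (forall j, `|u 0 j| <= C0) /\
    model_point h' - model_point h = row_mx (\row_j ((h' - h) j 0)%:~R) (\row_i linear_form L (h' - h) i) + u.
  pose u : 'rV[R]_m := \row_i (height h' i - height h i).
  exists (proj_physical L F (row_mx 0 u)); split=> [j|].
    have -> : row_mx 0 u = \sum_i u 0 i *: row_mx 0 (delta_mx 0 i) :> V.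
      rewrite {1}[u]row_sum_delta (big_morph (row_mx 0) (id1 := 0) (op1 := +%R)).
      - by apply: eq_bigr => i _; rewrite scale_row_mx scaler0.
      - by move=> x y; rewrite add_row_mx addr0.
      - by rewrite row_mx0.
    rewrite /proj_physical linear_sum summxE; apply: (le_trans (ler_norm_sum _ _ _)).
    apply: ler_sum => i _; rewrite linearZ mxE normrM.
    apply: (@le_trans _ _ `|e i 0 j|); last by rewrite (bigD1 j)//= lerDl sumr_ge0.
    rewrite ler_piMl// mxE ler_norml.
    have := height_gt0 adm reg h i; have := height_gt0 adm reg h' i.
    have := frac_lt1 (offset L s i - linear_form L h i).
    have := frac_lt1 (offset L s i - linear_form L h' i).
    rewrite -/(height h i) -/(height h' i); lra.
  rewrite pointB (vertical_decomposition L (int_row _ _)) proj_physicalD.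
  rewrite proj_physical_id//; last by rewrite vertical_row_mx subrr.
  rewrite /int_row row_mxKl -/(int_row _ _); congr (row_mx _ _ + proj_physical L F (row_mx _ _)).
    apply/rowP => i; rewrite /linear_form !mxE; apply: eq_bigr => j _.
    by rewrite !mxE mulrC.
  apply/rowP => i; rewrite vertical_int_row mxE /height /frac_part /ceiling linear_formB.
  by rewrite intrB !rmorphN /=; ring.
exists (1 + C0 + (d + m)%:R * (1 + C1 + C0)) => [|h h'].
  by rewrite ltr_pwDl// ?mulr_ge0// ?addr_ge0// ltr_pwDl.
have [u [uC hu]] := diff h h'.
have coordE k : model_point h' 0 k - model_point h 0 k = (model_point h' - model_point h) 0 k by rewrite !mxE.
split=> [j|N N0 hN].
  have h1 : `|(model_point h' - model_point h) 0 (lshift m j)| <= euclidean_dist (model_point h) (model_point h').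
    rewrite -sqrtr_sqr /euclidean_dist ler_wsqrtr// (bigD1 (lshift m j))//=.
    rewrite -coordE -sqrrN opprB lerDl sumr_ge0// => k _.
    exact: sqr_ge0.
  have h2 : `|((h' - h) j 0)%:~R| <= `|(model_point h' - model_point h) 0 (lshift m j)| + C0 :> R.
    have tri (x y : R) : `|x| <= `|x + y| + `|y| by rewrite -{1}(addrK y x) ler_normB.
    apply: (le_trans (tri _ (u 0 (lshift m j)))); apply: lerD => //.
    by rewrite hu [(_ + u) _ _]mxE row_mxEl [(\row__ _) _ _]mxE.
  apply: (le_trans h2); apply: lerD => //.
  rewrite -addrA addrCA lerDl addr_ge0// mulr_ge0// !addr_ge0//.
have coord k : `|model_point h 0 k - model_point h' 0 k| <= (1 + C1) * N + C0.
  rewrite distrC coordE hu mxE; apply: (le_trans (ler_normD _ _)); apply: lerD => //.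
  rewrite mulrDl mul1r mxE; case: (fintype.split k) => j; rewrite mxE.
    by apply: (le_trans (hN j)); rewrite lerDl mulr_ge0.
  apply: (@le_trans _ _ (C1 * N)); last by rewrite lerDr.
  rewrite /linear_form mxE; apply: (le_trans (ler_norm_sum _ _ _)).
  apply: (@le_trans _ _ (\sum_l `|L j l| * N)).
    apply: ler_sum => l _; rewrite normrM ler_wpM2l// mxE; exact: hN.
  rewrite -mulr_suml ler_wpM2r// /C1 (bigD1 j)//= lerDl sumr_ge0// => i _.
  by rewrite sumr_ge0.
apply: (@le_trans _ _ (\sum_k `|model_point h 0 k - model_point h' 0 k|)).
  set A := \sum_k _; have A0 : 0 <= A by rewrite sumr_ge0.
  rewrite -[A]ger0_norm// -sqrtr_sqr /euclidean_dist ler_wsqrtr//.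
  rewrite expr2 mulr_suml; apply: ler_sum => k _.
  rewrite -real_normK ?num_real// expr2 ler_wpM2l//.
  by rewrite /A (bigD1 k)//= lerDl sumr_ge0.
apply: (@le_trans _ _ (\sum_(k < d + m) ((1 + C1) * N + C0))).
  by apply: ler_sum => k _; exact: coord.
rewrite sumr_const card_ord -[leLHS]mulr_natl.
have D0 : 0 <= (d + m)%:R :> R by [].
apply: (@le_trans _ _ ((d + m)%:R * ((1 + C1 + C0) * (N + 1)))).
  by apply: ler_wpM2l => //; nra.
by rewrite mulrA mulrDl lerDr mulr_ge0// addr_ge0.
Qed.

End patterns.

(** With s = 1 / (2 a), ln r <= r^s / s bounds the left side by B r^(1/2), and B <= r^(1/2)
    eventually. *)
Lemma ln_powR_little {R : realType} (a K : R) : 0 < a ->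
  \forall r \near +oo, K * ln r `^ a <= r.
Proof.
move=> a0; pose s := (2 * a)^-1; have s0 : 0 < s by rewrite invr_gt0 mulr_gt0.
pose B := `|K| * s^-1 `^ a.
have B0 : 0 <= B by rewrite mulr_ge0 ?powR_ge0.
near=> r; have r1 : 1 < r by near: r; exact: nbhs_pinfty_gt.
have r0 : 0 < r by exact: lt_trans r1.
have rB : B ^+ 2 <= r by near: r; apply: nbhs_pinfty_ge; rewrite num_real.
have lnr : ln r <= s^-1 * r `^ s.
  rewrite mulrC ler_pdivlMr// mulrC -ln_powR; apply/ltW/ln_sublinear.
  exact: powR_gt0.
apply: (@le_trans _ _ (B * r `^ 2^-1)).
  apply: (@le_trans _ _ (`|K| * ln r `^ a)).
    by rewrite ler_wpM2r ?powR_ge0// ler_norm.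
  apply: (@le_trans _ _ (`|K| * (s^-1 * r `^ s) `^ a)).
    apply: ler_wpM2l => //; apply: ge0_ler_powR => //; first exact: ltW.
      by rewrite nnegrE ln_ge0// ltW.
    by rewrite nnegrE mulr_ge0 ?powR_ge0// invr_ge0 ltW.
  rewrite powRM ?powR_ge0//; last by rewrite invr_ge0 ltW.
  rewrite mulrA -[in leLHS]powRrM.
  by rewrite (_ : s * a = 2^-1)// /s; field; rewrite lt0r_neq0.
have h : B <= r `^ 2^-1.
  rewrite -(@ler_pXn2r _ 2) ?nnegrE ?powR_ge0// -[leRHS]powR_mulrn ?powR_ge0//.
  by rewrite -powRrM mulVf// powRr1// ltW.
apply: (@le_trans _ _ (r `^ 2^-1 * r `^ 2^-1)); first by rewrite ler_wpM2r ?powR_ge0.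
by rewrite -expr2 -powR_mulrn ?powR_ge0// -powRrM mulVf// powRr1// ltW.
Unshelve. all: by end_near.
Qed.

Lemma powR_invX {R : realType} (x : R) (n : nat) : (0 < n)%N -> 0 <= x ->
  (x `^ n%:R^-1) ^+ n = x.
Proof.
move=> n0 x0; rewrite -powR_mulrn ?powR_ge0// -powRrM mulVf ?powRr1//.
by rewrite pnatr_eq0 -lt0n.
Qed.

(** * The two repulsivity statements for a fixed matrix *)

Section repulsivity.
Context {R : realType} (d m : nat).
Hypotheses (m_gt0 : (0 < m)%N) (d_gt0 : (0 < d)%N).
Local Notation V := 'rV[R]_(d + m).
Variables (L : 'M[R]_(m, d)) (F : {vspace V}) (s : V).
Hypotheses (adm : admissible L F) (reg : regular L F s).
Variables (c : R) (phi : R -> R).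
Hypothesis c_gt0 : 0 < c.

(** Good approximations exist only at certain sizes N, so r is fitted to N through r^(m d) = A Q N^d
    ln N. *)
Lemma not_repulsive : totally_irrational L -> well_approximable L ->
  (\forall r \near +oo, c * r ^+ m / (ln r `^ (d%:R^-1)) <= phi r) ->
  ~ repulsive L F s phi.
Proof.
move=> irr wa phi_ge rep.
have [r1 [_ hr1]] := filterI phi_ge rep.
have [C C0 distC] := distance_bounds adm reg.
have md0 : (0 < m * d)%N by rewrite muln_gt0 m_gt0.
(* 3^(m d) comes from 2 r + 1 <= 3 r, and the 2 turns the weak inequality of the approximation into
   the strict one of [repetition]. *)
pose A : R := (3 ^+ (m * d) * 2)^-1.
have A0 : 0 < A by rewrite invr_gt0 mulr_gt0 ?exprn_gt0.
have A1 : A <= 1.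
  by rewrite invf_le1 ?mulr_gt0 ?exprn_gt0// mulr_ege1 ?exprn_ege1// ler1n.
(* The size of Q that makes the distance bound 2 C N at most c r^m / (ln r)^(1/d), given ln r <= (d
   + 2) ln N. *)
pose K0 : R := (2 * C) ^+ d * d.+2%:R / (c ^+ d * A).
have K00 : 0 <= K0.
  by rewrite divr_ge0 ?mulr_ge0 ?exprn_ge0// ltW// mulr_gt0 ?exprn_gt0.
pose k := Num.truncn K0; pose Q : R := k.+1%:R.
have Q0 : 0 < Q by rewrite ltr0n.
have QK : (2 * C) ^+ d * d.+2%:R <= c ^+ d * A * Q.
  rewrite [leRHS]mulrC -ler_pdivrMr ?mulr_gt0 ?exprn_gt0// ltW//.
  by have /andP[] := truncn_itv K00.
pose b := Num.max r1 1.
pose x0 := b ^+ (m * d) / A.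
have b1 : 1 <= b by rewrite le_max lexx orbT.
have x00 : 0 < x0 by rewrite divr_gt0 ?exprn_gt0// (lt_le_trans _ b1).
(* N > exp x0 pushes r beyond the threshold r1 and above 1; N >= k + 1 = Q enters the bound of ln r
   by (d + 2) ln N. *)
have [N nN [h [p [h0 hN hp]]]] := wa k (maxn (Num.truncn (expR x0)).+1 k.+1).
move: nN; rewrite geq_max => /andP[nN kN].
have N0 : (0 < N)%N by exact: leq_trans kN.
have NR : 1 <= N%:R :> R by rewrite ler1n.
have NR0 : 0 < N%:R :> R by rewrite ltr0n.
have QN : Q <= N%:R by rewrite ler_nat.
have lnN : x0 < ln N%:R.
  rewrite -[x0]expRK ltr_ln ?posrE ?expR_gt0//.
  have /andP[_ /lt_le_trans] := truncn_itv (expR_ge0 x0); apply.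
  by rewrite ler_nat.
have lnN0 : 0 < ln N%:R :> R by exact: lt_trans lnN.
have Nd0 : 0 < N%:R ^+ d :> R by rewrite exprn_gt0.
pose Z := A * (N%:R ^+ d * ln N%:R * Q).
have Z0 : 0 < Z by rewrite !mulr_gt0.
pose r := Z `^ (m * d)%:R^-1.
have rX : r ^+ (m * d) = Z by rewrite powR_invX// ltW.
have rge0 : 0 <= r by exact: powR_ge0.
have br : b < r.
  rewrite -(@ltr_pXn2r _ (m * d)) ?nnegrE//; last exact: le_trans b1.
  rewrite rX; have : x0 * A < ln N%:R * A by rewrite ltr_pM2r.
  rewrite divfK ?lt0r_neq0// => /lt_le_trans; apply.
  rewrite (_ : Z = N%:R ^+ d * Q * (ln N%:R * A)); last by rewrite /Z; ring.
  by rewrite ler_peMl ?mulr_ege1 ?exprn_ege1 ?ler1n// ltW// mulr_gt0.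
have r_gt1 : 1 < r by exact: le_lt_trans br.
have r0 : 0 < r by exact: lt_trans r_gt1.
have lnr0 : 0 < ln r by exact: ln_gt0.
have lnr : ln r <= d.+2%:R * ln N%:R.
  have : ln (r ^+ (m * d)) <= ln (N%:R ^+ d.+2).
    rewrite ler_ln ?posrE ?exprn_gt0// rX /Z -[leRHS]mul1r.
    apply: ler_pM => //; first exact: ltW.
      by rewrite !mulr_ge0// ltW.
    rewrite -addn2 exprD expr2 -mulrA ler_pM2l//.
    by apply: ler_pM => //; rewrite ltW// ln_sublinear.
  rewrite !lnXn// => /(le_trans _) h1.
  by rewrite mulr_natl; apply: h1; rewrite -[leLHS]mulr1n ler_wpMn2l// ltW.
pose delta := ((3 * r) ^+ d)^-1.
have delta0 : 0 < delta by rewrite invr_gt0 exprn_gt0// mulr_gt0.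
have deltaX : delta ^+ m = 2 * (N%:R ^+ d * ln N%:R * Q)^-1.
  rewrite /delta exprVn -exprM mulnC exprMn rX /Z /A invfM.
  by rewrite !invfM !invrK; field; rewrite !lt0r_neq0 ?exprn_gt0.
have hdelta i : `|linear_form L h i - (p i 0)%:~R| < delta.
  rewrite -(@ltr_pXn2r _ m) ?nnegrE ?(ltW delta0)// deltaX.
  have := hp i; rewrite -/Q -mulrA -ler_pdivlMr ?mulr_gt0// => /le_lt_trans; apply.
  rewrite -invfM mulrC ltr_pMl ?ltr1n//.
  by rewrite mulrC invr_gt0 !mulr_gt0.
have [|h1 [h2 [h12 neq hh]]] := repetition s adm irr rge0 h0 hdelta.
  rewrite ler_pdivrMr ?exprn_gt0 ?mulr_gt0// mul1r lerXn2r ?nnegrE ?addr_ge0 ?mulr_ge0//.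
  by lra.
have [|phir repr] := hr1 r; first by apply: le_lt_trans br; rewrite le_max lexx.
have : phi r < euclidean_dist (model_point L F s h1) (model_point L F s h2).
  apply: repr => //.
  - by apply/(cut_projectP adm reg); exists h1.
  - by apply/(cut_projectP adm reg); exists h2.
  - exact: (proj2 (patch_class_point adm reg r h1 h2)).
apply/negP; rewrite -leNgt.
apply: le_trans phir.
have [_ /(_ N%:R (ler0n _ _))] := distC h1 h2.
have hbN : bounded_by (N%:R : R) (h2 - h1).
  by move=> j; rewrite h12 -intr_norm -[N%:R]/((N%:Z)%:~R) ler_int.
move=> /(_ hbN) /le_trans; apply.
apply: (@le_trans _ _ (2 * C * N%:R)); first by nra.
rewrite ler_pdivlMr ?powR_gt0// -(@ler_pXn2r _ d) ?nnegrE ?mulr_ge0 ?powR_ge0 ?exprn_ge0 ?(ltW C0) ?(ltW c_gt0)//.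
rewrite exprMn powR_invX ?(ltW lnr0)// [leRHS]exprMn -exprM rX /Z.
rewrite [(2 * C * _) ^+ d]exprMn.
apply: (@le_trans _ _ ((2 * C) ^+ d * N%:R ^+ d * (d.+2%:R * ln N%:R))).
  by rewrite ler_wpM2l// mulr_ge0// exprn_ge0// mulr_ge0// ltW.
rewrite (_ : _ * (d.+2%:R * _) = (2 * C) ^+ d * d.+2%:R * (N%:R ^+ d * ln N%:R)); last by ring.
rewrite (_ : c ^+ d * _ = c ^+ d * A * Q * (N%:R ^+ d * ln N%:R)); last by ring.
by rewrite ler_wpM2r// ltW// mulr_gt0.
Qed.

Section gaps.
Variable e : R.
Hypothesis e_gt0 : 0 < e.
Hypothesis row_bound : exists N0 : nat, forall i N, (N0 <= N)%N ->
  forall (h : 'cV[int]_d) (p : int), h != 0 -> (forall j, `|h j 0| <= N%:Z) ->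
  1 < `|linear_form L h i - p%:~R| * N%:R ^+ d * ln N%:R `^ (1 + e).

Let e1_gt0 : 0 < 1 + e. Proof. by rewrite addr_gt0. Qed.

Lemma same_pattern_gap : \forall r \near +oo, forall h h', same_pattern L s r h h' ->
  forall i, `|height L s h i - height L s h' i| * r ^+ d <=
    8 * (8 * ln r `^ (1 + e)) ^+ d.
Proof.
have [N0 hN0] := row_bound.
pose X0 := maxn N0 (Num.truncn (expR 1 : R)).+1.
near=> r => h h' hh' i.
have r1 : expR 1 < r by near: r; apply: nbhs_pinfty_gt; rewrite num_real.
have r0 : 0 < r by exact: lt_trans (expR_gt0 1) r1.
have t1 : 1 < ln r by rewrite -[ltLHS]expRK ltr_ln// posrE expR_gt0.
have X0r : X0%:R * 4 * ln r `^ (1 + e) <= r by near: r; exact: ln_powR_little.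
pose T0 := ln r `^ (1 + e); have T00 : 0 < T0 by apply: powR_gt0; exact: lt_trans t1.
have T01 : 1 <= T0 by rewrite -(powRr0 (ln r)) ler_powR// ltW.
(* [gap_cover] uses vectors of size 2 n X with n <= 2 (ln X)^(1 + e), and this X keeps them within
   r. *)
pose x := r / (4 * T0).
have x0 : 0 < x by rewrite divr_gt0// mulr_gt0.
pose X := Num.truncn x.
have /andP[Xx xX] : X%:R <= x < X.+1%:R by apply: truncn_itv; exact: ltW.
have X0X : (X0 <= X)%N.
  rewrite -ltnS -(ltr_nat R); apply: le_lt_trans xX.
  by rewrite ler_pdivlMr ?mulr_gt0// mulrA.
have X_gt0 : (0 < X)%N by apply: leq_trans X0X; rewrite leq_max orbT.
have XR : 0 < X%:R :> R by rewrite ltr0n.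
have XR1 : 1 <= X%:R :> R by rewrite ler1n.
have Xbig : r <= 8 * T0 * X%:R.
  move: xX; rewrite -natr1 ltr_pdivrMr ?mulr_gt0// => xX.
  by nra.
have Xle : 4 * T0 * X%:R <= r by rewrite mulrC -ler_pdivlMr// mulr_gt0.
pose T := ln X%:R `^ (1 + e).
have lnX : 1 <= ln X%:R :> R.
  rewrite -[leLHS]expRK ler_ln ?posrE ?expR_gt0//.
  have /andP[_ /ltW /le_trans] := truncn_itv (expR_ge0 (1 : R)); apply.
  by rewrite ler_nat (leq_trans _ X0X)// leq_max leqnn orbT.
have T1 : 1 <= T by rewrite -(powRr0 (ln X%:R)) ler_powR// ltW.
have T0' : 0 < T by exact: lt_le_trans T1.
have TT0 : T <= T0.
  apply: ge0_ler_powR; rewrite ?nnegrE ?(ltW e1_gt0)//.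
  - by rewrite (le_trans _ lnX).
  - by rewrite ltW// (lt_trans _ t1).
  - by rewrite ler_ln ?posrE//; apply: le_trans Xle; nra.
(* The separation that [row_bound] gives for 0 < |h| < X; then n X^d [delta] = n / T exceeds 1 for n
   = [truncn T] + 1. *)
pose delta := (X%:R ^+ d * T)^-1.
have delta0 : 0 < delta by rewrite invr_gt0 mulr_gt0 ?exprn_gt0.
pose n := (Num.truncn T).+1.
have /andP[nT Tn] : n.-1%:R <= T < n%:R by apply: truncn_itv; exact: ltW.
have n2T : n%:R <= 2 * T by rewrite -natr1; move: nT; rewrite /n/=; lra.
have Xd0 : X%:R ^+ d != 0 :> R by rewrite lt0r_neq0// exprn_gt0.
have cover k w : exists l (p : int), bounded_by r l /\
    `|linear_form L l k - p%:~R - w| <= 4 / X%:R ^+ d.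
  have [l p l0 lX||l [p [lX hl]]] := @gap_cover _ _ (fun l => linear_form L l k)
    (fun l l' => linear_formB L l l' k) X delta X_gt0 delta0 _ n _ w.
  - rewrite ltW// /delta -[_^-1]mul1r ltr_pdivrMr ?mulr_gt0 ?exprn_gt0// mulrA.
    apply: hN0 => //; first by rewrite (leq_trans _ X0X)// leq_max leqnn.
    by move=> j; exact: ltW.
  - rewrite natrM natrX /delta (_ : _ * _ = n%:R / T) ?ltr_pdivlMr ?mul1r//.
    by field; rewrite Xd0 lt0r_neq0.
  exists l, p; split=> [j|].
    rewrite -intr_norm; apply: (@le_trans _ _ ((2 * n * X)%N%:Z%:~R)).
      by rewrite ler_int.
    apply: le_trans Xle; rewrite -[_%:~R]/((2 * n * X)%:R) natrM ler_wpM2r//.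
    by rewrite natrM; lra.
  apply: (le_trans hl); rewrite natrM /delta (_ : _ * _ = n%:R / T * (2 / X%:R ^+ d)).
    rewrite (_ : 4 / _ = 2 * (2 / X%:R ^+ d)); last by field.
    by rewrite ler_wpM2r ?divr_ge0 ?exprn_ge0// ler_pdivrMr.
  by field; rewrite Xd0 lt0r_neq0.
have := separation adm reg hh' cover i; set w := `|_ - _| => hw.
apply: (@le_trans _ _ (2 * (4 / X%:R ^+ d) * r ^+ d)); first by rewrite ler_wpM2r ?exprn_ge0// ltW.
apply: (@le_trans _ _ (2 * (4 / X%:R ^+ d) * (8 * T0 * X%:R) ^+ d)).
  rewrite ler_wpM2l ?mulr_ge0 ?invr_ge0 ?exprn_ge0//.
  by rewrite lerXn2r ?nnegrE ?mulr_ge0// ltW.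
rewrite [(_ * X%:R) ^+ d]exprMn.
move: ((8 * T0) ^+ d) => Y; rewrite le_eqVlt (_ : _ * (Y * _) = 8 * Y) ?eqxx//.
by field.
Unshelve. all: by end_near.
Qed.

End gaps.

(** A repetition at distance at most [phi r] has displacement of size N <= 2 Phi and row errors at
    most the gap bound. Then th^m N^d (ln N)^(1 + e) is at most K (ln r)^(-a), which is at most 1
    for large r and contradicts the bound for all rows. *)
Lemma repulsive_of_badly_approximable (eps : R) : 0 < eps ->
  let e := d%:R * eps / (2 * (1 + (m * d)%:R)) in
  (exists N0 : nat, forall i N, (N0 <= N)%N ->
    forall (h : 'cV[int]_d) (p : int), h != 0 -> (forall j, `|h j 0| <= N%:Z) ->
    1 < `|linear_form L h i - p%:~R| * N%:R ^+ d * ln N%:R `^ (1 + e)) ->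
  (exists N0 : nat, forall N, (N0 <= N)%N ->
    forall (h : 'cV[int]_d) (p : 'I_m -> int), h != 0 -> (forall j, `|h j 0| <= N%:Z) ->
    exists i, 1 < `|linear_form L h i - (p i)%:~R| ^+ m * N%:R ^+ d * ln N%:R `^ (1 + e)) ->
  (\forall r \near +oo, phi r <= c * r ^+ m / (ln r `^ (d%:R^-1 + m%:R + eps))) ->
  repulsive L F s phi.
Proof.
move=> eps0 e row_bound [N0 bound] phi_le.
have d0 : 0 < d%:R :> R by rewrite ltr0n.
have deps : 0 < d%:R * eps by rewrite mulr_gt0.
have e0 : 0 < e by rewrite divr_gt0// mulr_gt0// ltr_pwDl.
have gap := same_pattern_gap e0 row_bound.
have [C C0 distC] := distance_bounds adm reg.
pose b := d%:R^-1 + m%:R + eps.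
have b0 : 0 < b by rewrite addr_gt0// ltr_pwDl ?invr_gt0.
(* Phi >= M ensures both N >= N0 and Phi + C + 1 <= 2 Phi. *)
pose M := N0%:R + C + 1.
(* The powers of 8 come from the gap bound, 2^d c^d from N <= 2 Phi, and the last factor from ln N
   <= (m + 1) ln r. *)
pose K : R := 8 ^+ m * 8 ^+ (d * m) * 2 ^+ d * c ^+ d * m.+1%:R `^ (1 + e).
have K0 : 0 < K by rewrite !mulr_gt0 ?exprn_gt0// powR_gt0.
pose a := d%:R * eps / 2; have a0 : 0 < a by rewrite divr_gt0.
near=> r; move=> y y' /(cut_projectP adm reg)[h ->] /(cut_projectP adm reg)[h' ->] neq.
move=> /(patch_class_point adm reg) hh'.
rewrite ltNge; apply/negP => dist_le.
have r1 : expR 1 < r by near: r; apply: nbhs_pinfty_gt; rewrite num_real.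
have r0 : 0 < r by exact: lt_trans (expR_gt0 1) r1.
have rge1 : 1 <= r by apply: le_trans (ltW r1); rewrite -[leLHS]expR0 ler_expR.
have t1 : 1 < ln r by rewrite -[ltLHS]expRK ltr_ln// posrE expR_gt0.
have t0 : 0 < ln r by exact: lt_trans t1.
have rc : 2 * c <= r by near: r; apply: nbhs_pinfty_ge; rewrite num_real.
have rM : M / c * ln r `^ b <= r by near: r; exact: ln_powR_little.
have rK : K <= ln r `^ a.
  have : expR (K `^ a^-1) <= r by near: r; apply: nbhs_pinfty_ge; rewrite num_real.
  rewrite -[in X in X -> _]ler_ln ?posrE ?expR_gt0// expRK => hK.
  rewrite -[K]powRr1 ?(ltW K0)// -(mulVf (lt0r_neq0 a0)) powRrM.
  by apply: ge0_ler_powR; rewrite ?nnegrE ?powR_ge0// ltW.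
have phir : phi r <= c * r ^+ m / ln r `^ b by near: r.
have gapr := near gap r.
have gap1 : forall i, `|height L s h i - height L s h' i| * r ^+ d <= 8 * (8 * ln r `^ (1 + e)) ^+ d.
  by apply: gapr => //; near: r.
have {}dist_le := le_trans dist_le phir.
set U := ln r `^ b in rM phir dist_le.
have U0 : 0 < U by exact: powR_gt0.
have U1 : 1 <= U by rewrite -(powRr0 (ln r)) ler_powR// ltW.
pose Phi := c * r ^+ m / U; rewrite -/Phi in dist_le.
have rm : r <= r ^+ m by rewrite -[leLHS]expr1 ler_weXn2l.
have PhiM : M <= Phi.
  rewrite ler_pdivlMr//; apply: le_trans (ler_wpM2l (ltW c_gt0) rm).
  by rewrite -ler_pdivrMl// mulrA [_ * M]mulrC.
have M0 : 0 < M by rewrite /M ltr_wpDl// addr_ge0// ltW.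
have Phi0 : 0 < Phi by exact: lt_le_trans PhiM.
pose N := (Num.truncn (Phi + C)).+1.
have /andP[Nle Nlt] : N.-1%:R <= Phi + C < N%:R by apply: truncn_itv; rewrite addr_ge0// ltW.
have N2 : N%:R <= 2 * Phi.
  rewrite -[N]/(N.-1.+1) -natr1; move: PhiM; rewrite /M => PhiM.
  have : 0 <= N0%:R :> R by []. 
  by lra.
have N0N : (N0 <= N)%N.
  by rewrite -(ler_nat R); move: PhiM; rewrite /M => PhiM; lra.
pose g := h' - h.
have g0 : g != 0.
  by apply: contra_notN neq; rewrite subr_eq0 => /eqP ->.
have gN j : `|g j 0| <= N%:Z.
  rewrite -(ler_int R) intr_norm; have [/(_ j) + _] := distC h h'.
  move=> /le_trans; apply; rewrite -[_%:~R]/(N%:R).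
  by apply: le_trans (ltW Nlt); rewrite lerD2r.
have /choice[p hp] := heightB L s h h'.
have [i] := bound N N0N g p g0 gN.
apply/negP; rewrite -leNgt -hp.
pose th : R := `|height L s h i - height L s h' i|; rewrite -/th.
have th0 : 0 <= th by exact: normr_ge0.
have th_le : th * r ^+ d <= 8 * (8 * ln r `^ (1 + e)) ^+ d by exact: gap1.
pose T := ln r `^ (1 + e); rewrite -/T in th_le.
have T0 : 0 < T by exact: powR_gt0.
have NR : 0 < N%:R :> R by rewrite ltr0n.
have lnN : ln N%:R `^ (1 + e) <= m.+1%:R `^ (1 + e) * T.
  rewrite -powRM ?(ltW t0)//; apply: ge0_ler_powR; rewrite ?nnegrE ?ln_ge0 ?ler1n ?mulr_ge0 ?(ltW t0)//.
    by rewrite addr_ge0// ltW.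
  rewrite mulr_natl -lnXn// ler_ln ?posrE ?exprn_gt0//.
  apply: (le_trans N2); rewrite /Phi mulrA ler_pdivrMr//.
  apply: (@le_trans _ _ (r ^+ m.+1)); last by rewrite ler_peMr ?exprn_ge0 ?(ltW r0).
  by rewrite mulrA exprS ler_wpM2r// exprn_ge0// ltW.
have Nd : N%:R ^+ d <= (2 * Phi) ^+ d.
  by apply: lerXn2r; rewrite ?nnegrE//; apply: mulr_ge0 => //; exact: ltW.
have rmd0 : 0 < (r ^+ d) ^+ m by rewrite !exprn_gt0.
rewrite -(ler_pM2l rmd0) mulr1.
(* The choice of e makes a = d * eps - e * (1 + m * d). *)
have UE : U ^+ d = ln r `^ a * (T ^+ d) ^+ m * T.
  have tne x : x ==> (ln r != 0) by rewrite (gt_eqF t0) implybT.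
  rewrite /U -powR_mulrn ?powR_ge0// -[in RHS]exprM -[T ^+ _]powR_mulrn ?powR_ge0//.
  rewrite /T -!powRrM -!powRD//.
  by congr powR; rewrite /a /b /e !natrM; field; rewrite !lt0r_neq0// ltr_pwDl// mulr_ge0.
have Phid : (2 * Phi) ^+ d * U ^+ d = 2 ^+ d * c ^+ d * (r ^+ d) ^+ m.
  rewrite -exprMn -exprM mulnC exprM -!exprMn; congr (_ ^+ d).
  by rewrite /Phi; field; rewrite lt0r_neq0.
have Td0 : 0 < (T ^+ d) ^+ m by rewrite !exprn_gt0.
have thm : (th * r ^+ d) ^+ m <= 8 ^+ m * 8 ^+ (d * m) * (T ^+ d) ^+ m.
  rewrite exprM -mulrA -!exprMn; apply: lerXn2r => //; rewrite nnegrE.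
    by apply: mulr_ge0 => //; apply: exprn_ge0; exact: ltW.
  by apply: mulr_ge0 => //; apply: exprn_ge0; rewrite mulr_ge0// ltW.
have Ud0 : 0 < U ^+ d by rewrite exprn_gt0.
apply: (@le_trans _ _ ((th * r ^+ d) ^+ m * (2 * Phi) ^+ d * (m.+1%:R `^ (1 + e) * T))).
  rewrite exprMn [_ ^+ m * _ ^+ m]mulrC -!mulrA; do 2 (rewrite ler_wpM2l ?exprn_ge0 ?(ltW r0)//).
  by apply: ler_pM; rewrite ?exprn_ge0 ?powR_ge0// ler0n.
apply: (@le_trans _ _ (8 ^+ m * 8 ^+ (d * m) * (T ^+ d) ^+ m * (2 * Phi) ^+ d * (m.+1%:R `^ (1 + e) * T))).
  apply: ler_wpM2r; first by rewrite mulr_ge0 ?powR_ge0.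
  by apply: ler_wpM2r => //; apply: exprn_ge0; rewrite mulr_ge0// ltW.
rewrite -(ler_pM2r Ud0).
rewrite (_ : _ * _ * U ^+ d = 8 ^+ m * 8 ^+ (d * m) * (T ^+ d) ^+ m * ((2 * Phi) ^+ d * U ^+ d) * (m.+1%:R `^ (1 + e) * T)); last by ring.
rewrite Phid UE (_ : _ * _ = (r ^+ d) ^+ m * ((T ^+ d) ^+ m * T) * K); last by rewrite /K; ring.
rewrite (_ : _ * (_ * _ * T) = (r ^+ d) ^+ m * ((T ^+ d) ^+ m * T) * ln r `^ a); last by ring.
by rewrite ler_wpM2l// ltW// !mulr_gt0.
Unshelve. all: by end_near.
Qed.

End repulsivity.

Theorem theorem1p3 (R : realType) (d k : nat) (hd : (0 < d)%N) (hdk : (d < k)%N)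
    (c eps : R) (hc : 0 < c) (heps : 0 < eps) :
  almost_all_linear (fun L : 'M[R]_(k - d, d) =>
    totally_irrational L ->
    forall (F : {vspace 'rV[R]_(d + (k - d))}) (s : 'rV[R]_(d + (k - d))),
      admissible L F -> regular L F s ->
      (forall phi : R -> R, (forall r, 0 <= r -> 0 <= phi r) ->
         (\forall r \near +oo,
            phi r >= c * r ^+ (k - d) / (ln r `^ (d%:R^-1))) ->
         ~ repulsive L F s phi) /\
      (forall phi : R -> R, (forall r, 0 <= r -> 0 <= phi r) ->
         (\forall r \near +oo,
            phi r <= c * r ^+ (k - d)
                     / (ln r `^ (d%:R^-1 + (k - d)%:R + eps))) ->
         repulsive L F s phi)).
Proof.
have m_gt0 : (0 < k - d)%N by rewrite subn_gt0.
pose e := d%:R * eps / (2 * (1 + ((k - d) * d)%:R)).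
have e_gt0 : 0 < e.
  by rewrite divr_gt0// mulr_gt0// ?ltr0n// ltr_pwDl// ler0n.
(* The convergence half with P a singleton, for each of the finitely many rows; this feeds the gap
   bound. *)
have rows : {ae @lebesgue_tuple R ((k - d) * d),
    forall t, forall i : 'I_(k - d), exists N0 : nat, forall N, (N0 <= N)%N ->
    forall (h : 'cV[int]_d) (p : int), h != 0 -> (forall j, `|h j 0| <= N%:Z) ->
    1 < `|linear_form (tuple_mx t) h i - p%:~R| * N%:R ^+ d * ln N%:R `^ (1 + e)}.
  apply: filter_forall => i.
  have P_gt0 : (0 < #|[set i]%SET|)%N by rewrite cards1.
  apply: filterS (khintchine_groshev_convergence d P_gt0 e_gt0) => t [N0 H].
  exists N0 => N N0N h p h0 hN; have [i'] := H N N0N h (fun=> p) h0 hN.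
  by rewrite finset.in_set1 cards1 expr1 => /eqP ->.
have P_gt0 : (0 < #|[set: 'I_(k - d)]%SET|)%N by rewrite cardsT card_ord.
apply: filterS3 (khintchine_groshev_divergence R m_gt0 hd)
  (khintchine_groshev_convergence d P_gt0 e_gt0) rows.
move=> t wa [N0 all_rows] /choice[N1 one_row] irr F s adm reg.
split=> phi phi_ge0 phi_bound.
  exact: (not_repulsive m_gt0 hd adm reg hc irr wa phi_bound).
apply: (repulsive_of_badly_approximable m_gt0 hd adm reg hc heps) phi_bound.
  exists (\max_i N1 i)%N => i N N1N; apply: one_row; apply: leq_trans N1N.
  exact: leq_bigmax.
exists N0 => N N0N h p h0 hN; have [i _] := all_rows N N0N h p h0 hN.
by rewrite cardsT card_ord; exists i.
Qed.
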